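(* Let $G\subseteq U(2)$ be a finite unitary reflection group and let $E\subseteq\mathbb C^2$ be a good bounded $G$-invariant domain containing the origin, with Bergman kernel $K(z,w)$. Assume: (i) the holomorphic function $(z,\zeta)\mapsto K(z,\overline{\zeta})$ on $\widetilde{E}=\{(z,\overline{w})\colon z,w\in E\}\subseteq\mathbb{C}^2\times\mathbb{C}^2$ can be analytically continued past every boundary point $(z,\overline{w})\in b\widetilde E$ with $z\neq w$; (ii) there are two $G$-invariant sets $\mathcal S_1,\mathcal S_2\subseteq\mathcal R_G$ such that (a) $\mathcal R_G=\mathcal S_1\cup\mathcal S_2$; (b) $\mathcal S_1\cap\mathcal S_2=\emptyset$; (c) $\mathcal S_j=\mathcal R_{G_j}$ for $j=1,2$, where $G_j=G_{\mathcal S_j}$ is the subgroup of $G$ generated by all reflections of $G$ whose reflecting hyperplane lies in $\mathcal S_j$. For $p\in(1,+\infty)$ and $H\in\{G,G_1,G_2\}$ set $$K_{H,p}(z,w)=|J_H(z)|^{\frac{2}{p}-1}K_H(z,w)|J_H(w)|^{1-\frac{2}{p}},\qquad K_H(z,w)=\frac{1}{|H|}\sum_{h\in H}K(z,h.w)\overline{\det(h)}.$$ Then for every $p\in(1,+\infty)$ there exists a positive constant $C$ such that for all $z,w\in E$, $$|K_{G,p}(z,w)|\leq C\frac{1}{|G|}\sum_{g\in G}\left(|K_{G_1,p}(g.z,w)|+|K_{G_2,p}(g.z,w)|+1\right).$$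
   Context: A (unitary) reflection is an element of $U(n)$ of finite order whose fixed point set is a (complex) hyperplane, its reflecting hyperplane $Y_r=\{v: r.v=v\}$. A finite unitary reflection group (f.u.r.g.) is a finite subgroup of $U(n)$ generated by reflections. For a f.u.r.g. $H$, $\mathcal R_H$ denotes the set of reflecting hyperplanes of reflections in $H$; $H$ acts on $\mathcal R_H$ by $g.Y=\{g.v: v\in Y\}$. For $Y\in\mathcal R_H$, $H_Y=\{g\in H: g.v=v\ \forall v\in Y\}$ is cyclic, of order $m_Y$ (the multiplicity of $Y$ in $H$). A root $e_Y$ of $Y$ is a unit vector orthogonal to $Y$. The Jacobian polynomial of $H$ is $J_H(z)=\prod_{Y\in\mathcal R_H}\langle z,e_Y\rangle^{m_Y-1}$ ($\langle\cdot,\cdot\rangle$ the standard Hermitian product); it depends on the choice of roots only up to a unimodular constant, so $|J_H|$ is well defined. A bounded $G$-invariant domain $E$ is good if for every $Y\in\mathcal R_G$, $Y\cap E$ is connected and $Y\cap bE=b_Y(Y\cap E)$, where $b_Y$ is the topological boundary relative to $Y$. The Bergman kernel $K(z,w)$ of $E$ is the integral kernel of the orthogonal projection $L^2(E)\to L^2(E)\cap\mathcal O(E)$; $(z,\zeta)\mapsto K(z,\overline\zeta)$ is holomorphic on $\widetilde E$. A holomorphic function on a domain $\Omega$ can be analytically continued past $q\in b\Omega$ if there is an open ball $B$ centered at $q$ such that it extends holomorphically to $\Omega\cup B$. *)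

(* Defs.v *)
From HB Require Import structures.
From mathcomp Require Import all_boot all_order all_algebra.
From mathcomp Require Import all_classical all_reals all_analysis.
From mathcomp Require Import finmap.
From mathcomp.real_closed Require Import complex.
Import Order.TTheory GRing.Theory Num.Theory numFieldNormedType.Exports.

Set Implicit Arguments. Unset Strict Implicit. Unset Printing Implicit Defensive.
Set Warnings "-redundant-canonical-projection -notation-overridden".

Local Open Scope classical_set_scope.
Local Open Scope ring_scope.

(* C = complex R is given its standard normed-module (over itself)
   structure, as analysis does for R via R^o; this gives the usual
   (Euclidean) topology on C and on C^2 = 'cV[C]_2 (max norm, same topology),
   and [differentiable] over the scalar field C is complex differentiability. *)
#[non_forgetful_inheritance]
HB.instance Definition _ (R : realType) :=
  NormedModule.copy (complex R) (complex R)^o.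

Section Defs.
Variable R : realType.
Local Notation C := (complex R).
Local Notation V := 'cV[C]_2.   (* points of C^2, column vectors *)

(* modulus of a complex number, real-valued *)
Definition cabs (z : C) : R :=
  Num.sqrt (complex.Re z ^+ 2 + complex.Im z ^+ 2).

(* standard Hermitian product <z,e> = sum_i z_i conj(e_i) *)
Definition hprod (z e : V) : C := \sum_i z i 0 * (e i 0)^*.

(* ---------- unitary reflections and reflection groups ---------- *)
Definition unitary (g : 'M[C]_2) : Prop := g *m (map_mx Num.conj g)^T = 1%:M.

(* fixed point set {v : g.v = v} *)
Definition fixset (g : 'M[C]_2) : set V := [set v | g *m v = v].

(* complex hyperplane of C^2: zero set of a nonzero linear functional *)
Definition hyperplane (Y : set V) : Prop :=
  exists a : 'rV[C]_2, a != 0 /\ Y = [set v | a *m v = 0].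

Definition reflection (g : 'M[C]_2) : Prop :=
  [/\ unitary g, (exists n : nat, (0 < n)%N /\ g ^+ n = 1) & hyperplane (fixset g)].

(* g lies in the subgroup generated by S: a finite product of elements of S
   and of inverses of elements of S (empty product = identity) *)
Definition gen_by (S : set 'M[C]_2) (g : 'M[C]_2) : Prop :=
  exists s : seq 'M[C]_2,
    (forall x, x \in s -> S x \/ S (invmx x)) /\ g = \prod_(x <- s) x.

(* finite unitary reflection group in U(2) (given by its finite set of
   elements): a subgroup of U(2) generated by a set of reflections *)
Definition fin_refl_group (G : {fset 'M[C]_2}) : Prop :=
  (forall g, g \in G -> unitary g) /\
  exists S : set 'M[C]_2, (forall r, S r -> reflection r) /\
    (forall g, g \in G <-> gen_by S g).

(* R_H : the set of reflecting hyperplanes of reflections of H *)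
Definition RH (H : {fset 'M[C]_2}) : set (set V) :=
  [set fixset r | r in [set r | r \in H /\ reflection r]].

(* m_Y = |H_Y|, H_Y = elements of H fixing Y pointwise *)
Definition mult (H : {fset 'M[C]_2}) (Y : set V) : nat :=
  size [seq g <- enum_fset H | `[< forall v, Y v -> g *m v = v >]].

(* a root of Y: a unit vector orthogonal to Y (chosen) *)
Definition root_of (Y : set V) : V :=
  xget 0 [set e | hprod e e = 1 /\ forall y, Y y -> hprod y e = 0].

(* |J_H(z)| = prod_{Y in R_H} |<z,e_Y>|^(m_Y - 1) *)
Definition absJ (H : {fset 'M[C]_2}) (z : V) : R :=
  \big[*%R/1]_(Y \in RH H) cabs (hprod z (root_of Y)) ^+ (mult H Y).-1.

(* K_H(z,w) = 1/|H| sum_{h in H} K(z, h.w) conj(det h) *)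
Definition KH (K : V -> V -> C) (H : {fset 'M[C]_2}) (z w : V) : C :=
  (#|` H|%:R)^-1 * \sum_(h <- enum_fset H) K z (h *m w) * (\det h)^*.

(* K_{H,p}(z,w) = |J_H(z)|^(2/p-1) K_H(z,w) |J_H(w)|^(1-2/p) *)
Definition KHp (K : V -> V -> C) (H : {fset 'M[C]_2}) (p : R) (z w : V) : C :=
  ((absJ H z `^ (2 / p - 1))%:C)%C * KH K H z w *
  ((absJ H w `^ (1 - 2 / p))%:C)%C.

(* G_S : elements of G in the subgroup generated by the reflections of G
   whose reflecting hyperplane lies in S *)
Definition Gsub (G : {fset 'M[C]_2}) (S : set (set V)) : {fset 'M[C]_2} :=
  [fset g in G | `[< gen_by [set r | r \in G /\ reflection r /\ S (fixset r)] g >]]%fset.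

(* ---------- domains ---------- *)
Definition domain (E : set V) : Prop := open E /\ connected E /\ E !=set0.

Definition G_invariant (G : {fset 'M[C]_2}) (E : set V) : Prop :=
  forall g v, g \in G -> E v -> E (g *m v).

Definition bdry {T : topologicalType} (A : set T) : set T :=
  closure A `\` interior A.

(* boundary of A relative to the subspace Y (closure in Y minus interior in Y) *)
Definition relbdry (Y A : set V) : set V :=
  [set y | (Y y /\ closure A y) /\
           ~ (A y /\ exists e : R, 0 < e /\ (ball y (e%:C)%C `&` Y) `<=` A)].

Definition good (G : {fset 'M[C]_2}) (E : set V) : Prop :=
  forall Y, RH G Y -> connected (Y `&` E) /\ Y `&` bdry E = relbdry Y (Y `&` E).

(* ---------- Lebesgue measure on C^2 = R^4 and integrals ---------- *)
Definition vol := (lebesgue_measure \x lebesgue_measure \x lebesgue_measure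
                   \x (@lebesgue_measure R))%E.

Definition toC2 (x : ((R * R) * R) * R) : V :=
  \col_i (if i == 0 then (x.1.1.1 +i* x.1.1.2)%C else (x.1.2 +i* x.2)%C).

(* integral over D of a complex-valued function *)
Definition cint (D : set V) (f : V -> C) : C :=
  ((Rintegral vol (toC2 @^-1` D) (fun x => complex.Re (f (toC2 x))))%:C
   + 'i * (Rintegral vol (toC2 @^-1` D) (fun x => complex.Im (f (toC2 x))))%:C)%C.

Definition L2 (D : set V) (f : V -> C) : Prop :=
  [/\ measurable_fun (toC2 @^-1` D) (fun x => complex.Re (f (toC2 x))),
      measurable_fun (toC2 @^-1` D) (fun x => complex.Im (f (toC2 x))) &
      vol.-integrable (toC2 @^-1` D) (fun x => ((cabs (f (toC2 x))) ^+ 2)%:E)].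

(* holomorphic = complex (Frechet) differentiable at every point *)
Definition holo_on {W : normedModType C} (D : set W) (f : W -> C) : Prop :=
  forall z, D z -> differentiable f z.

(* Bergman space A^2(D) *)
Definition A2 (D : set V) (f : V -> C) : Prop := holo_on D f /\ L2 D f.

(* K is the Bergman kernel of E: K(z,w) is antiholomorphic in w, and the
   integral operator f |-> (z |-> int_E K(z,w) f(w) dV(w)) is the orthogonal
   projection of L^2(E) onto A^2(E) *)
Definition bergman_kernel (E : set V) (K : V -> V -> C) : Prop :=
  (forall z, E z -> holo_on E (fun w => (K z w)^*)) /\
  forall f, L2 E f ->
    [/\ (forall z, E z -> vol.-integrable (toC2 @^-1` E)
                              (fun x => (cabs (K z (toC2 x) * f (toC2 x)))%:E)),
        A2 E (fun z => cint E (fun w => K z w * f w)) &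
        forall h, A2 E h ->
          cint E (fun w => (f w - cint E (fun u => K w u * f u)) * (h w)^*) = 0].

(* tilde E = {(z, conj w) : z, w in E} in C^2 x C^2 *)
Definition tildeE (E : set V) : set (V * V) :=
  [set q | exists z w, E z /\ E w /\ q = (z, map_mx Num.conj w)].

(* hypothesis (i) *)
Definition continuation_hyp (E : set V) (K : V -> V -> C) : Prop :=
  forall q : V * V, bdry (tildeE E) q -> q.1 != map_mx Num.conj q.2 ->
    exists r : R, 0 < r /\
    exists F : V * V -> C,
      holo_on (tildeE E `|` ball q (r%:C)%C) F /\
      (forall x, tildeE E x -> F x = K x.1 (map_mx Num.conj x.2)).

(* hypothesis (ii) *)
Definition splitting_hyp (G : {fset 'M[C]_2}) (S1 S2 : set (set V)) : Prop :=
  [/\ (forall g Y, g \in G -> S1 Y -> S1 [set g *m v | v in Y]),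
      (forall g Y, g \in G -> S2 Y -> S2 [set g *m v | v in Y]),
      RH G = S1 `|` S2,
      S1 `&` S2 = set0 &
      S1 = RH (Gsub G S1) /\ S2 = RH (Gsub G S2)].

End Defs.

(* Main.v *)
Require Import Defs.
From HB Require Import structures.
From mathcomp Require Import all_boot all_order all_algebra.
From mathcomp Require Import all_classical all_reals all_analysis.
From mathcomp Require Import finmap measurable_realfun.
From mathcomp.real_closed Require Import complex.
From mathcomp Require Import ring lra.
Import Order.TTheory GRing.Theory Num.Theory numFieldNormedType.Exports.
Set Implicit Arguments. Unset Strict Implicit. Unset Printing Implicit Defensive.
Local Open Scope classical_set_scope.
Local Open Scope ring_scope.

(* Write a = 2/p - 1, so that |a| < 1, and for T in G let Phi_T(z, w) be the sum of K(z, h w) conj(det h)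
   over h in T.  The kernel K is G-invariant because Lebesgue measure is, so if T is stable under multiplication
   by the stabilizer of w0, then Phi_T(z, g w) = det(g) Phi_T(z, w) for g fixing w0, and likewise in z.
   If all terms of Phi_T extend holomorphically in (z, conj w) across (z0, conj w0), this skew-invariance forces
   the extension to vanish to order m_Y - 1 on every mirror Y through w0, hence |Phi_T(z, w)| <= C |J_G(w)|
   nearby; by symmetry |Phi_T(z, w)| <= C |J_G(z)|.  The first bound if a >= 0, the second if a < 0, makes
   |J_G(z)|^a |Phi_T(z, w)| |J_G(w)|^(-a) bounded.

   If z0 is not in the orbit of w0, or if z0 is in E, take T = G: then K_{G,p} is bounded near (z0, w0).
   Otherwise |K_{G,p}(z, w)| = |K_{G,p}(g z, w)| reduces to z0 = w0 in bE, so w0 <> 0.  The stabilizer of w0 is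
   trivial or consists of the elements fixing the unique mirror through w0, so it lies in H = G_1 or H = G_2.
   With T = G \ H the singular term h = 1 is excluded; since Phi_G = Phi_H + Phi_T, and |J_G| and |J_H| are
   comparable near w0, K_{G,p} is bounded by C (|K_{H,p}| + 1).  Compactness of cl E x cl E concludes. *)

(** * One complex variable *)

(** Statements in several variables are reduced to complex lines, so that only one-variable function
    theory enters: Cauchy's formula on squares, finite Taylor expansions with remainder, and a
    maximum principle that carries a constant. Where this constant must go, the estimate is applied
    to N-th powers. The obstacle is the point 0, through which all mirrors pass. Elsewhere a single
    linear form has to be divided out, along the line orthogonal to its mirror; at 0 the whole
    product is divided out along lines in a generic direction that avoid 0. Dimension 2 enters here:
    two distinct mirrors meet only in 0. One bound suffices because |a| < 1: for a >= 0 the factor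
    |J_G(w)| absorbs |J_G(w)|^(-a) and leaves a positive power. Skew-invariance is known only for z,
    w in E, while (z0, w0) may lie on the boundary; a local identity theorem carries it over to the
    extension. Joint holomorphy of K inside E is drawn from (i) as well, at one off-diagonal
    boundary point, because the extension obtained there is holomorphic on all of the domain of K(z,
    conj w). *)

Section Cabs.
Variable R : realType.
Local Notation C := (complex R).
Implicit Types x y z : C.

Lemma cabsE z : ((cabs z)%:C)%C = `|z|.
Proof. by rewrite normc_def. Qed.

Lemma cabs_ge0 z : 0 <= cabs z.
Proof. exact: sqrtr_ge0. Qed.

Lemma cabsM x y : cabs (x * y) = cabs x * cabs y.
Proof. by apply: complexI; rewrite rmorphM /= !cabsE normrM. Qed.

Lemma cabsV x : cabs x^-1 = (cabs x)^-1.
Proof. by apply: complexI; rewrite fmorphV /= !cabsE normfV. Qed.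

Lemma cabsX x n : cabs (x ^+ n) = cabs x ^+ n.
Proof. by apply: complexI; rewrite rmorphXn /= !cabsE normrX. Qed.

Lemma cabsN x : cabs (- x) = cabs x.
Proof. by apply: complexI; rewrite !cabsE normrN. Qed.

Lemma cabsB x y : cabs (x - y) = cabs (y - x).
Proof. by rewrite -cabsN opprB. Qed.

Lemma cabs_eq0 x : (cabs x == 0) = (x == 0).
Proof. by rewrite -(inj_eq (@complexI R)) cabsE normr_eq0. Qed.

Lemma cabs_gt0 x : (0 < cabs x) = (x != 0).
Proof. by rewrite lt_def cabs_eq0 cabs_ge0 andbT. Qed.

Lemma cabs0 : cabs (0 : C) = 0.
Proof. by apply/eqP; rewrite cabs_eq0. Qed.

Lemma cabsR (r : R) : cabs (r%:C)%C = `|r|.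
Proof. by apply: complexI; rewrite cabsE normc_def /= expr0n /= addr0 sqrtr_sqr. Qed.

Lemma cabs1 : cabs (1 : C) = 1.
Proof. by rewrite (cabsR 1) normr1. Qed.

Lemma cabs_i : cabs ('i%C : C) = 1.
Proof. by rewrite /cabs /= expr0n expr1n add0r sqrtr1. Qed.

Lemma cabsJ z : cabs (z^*) = cabs z.
Proof. by apply: complexI; rewrite !cabsE norm_conjC. Qed.

Lemma cabsD x y : cabs (x + y) <= cabs x + cabs y.
Proof. by rewrite -lecR rmorphD /= !cabsE ler_normD. Qed.

Lemma cabs_sum I (r : seq I) (P : pred I) (F : I -> C) :
  cabs (\sum_(i <- r | P i) F i) <= \sum_(i <- r | P i) cabs (F i).
Proof.
by rewrite -lecR rmorph_sum /= cabsE (eq_bigr _ (fun i _ => cabsE (F i))) ler_norm_sum.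
Qed.

Lemma cabs_prod I (r : seq I) (P : pred I) (F : I -> C) :
  cabs (\prod_(i <- r | P i) F i) = \prod_(i <- r | P i) cabs (F i).
Proof. by apply: big_morph; [exact: cabsM|exact: cabs1]. Qed.

Lemma normRe_le_cabs z : `|complex.Re z| <= cabs z.
Proof. by rewrite -lecR cabsE normc_ge_Re. Qed.

Lemma normIm_le_cabs z : `|complex.Im z| <= cabs z.
Proof.
by rewrite /cabs -[X in X <= _]sqrtr_sqr ler_sqrt ?addr_ge0 ?sqr_ge0// lerDr sqr_ge0.
Qed.

Lemma cabs_le_ReIm z : cabs z <= `|complex.Re z| + `|complex.Im z|.
Proof.
rewrite /cabs -[leRHS]ger0_norm ?addr_ge0// -sqrtr_sqr ler_sqrt ?sqr_ge0//.
rewrite sqrrD -!normrX !(ger0_norm (sqr_ge0 _)) -addrA lerD2l lerDr.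
by rewrite mulrn_wge0 // mulr_ge0.
Qed.

(** The order on [C] compares only numbers with equal imaginary parts, so a positive radius in the
    topology of [C] is a real number. Through this all later estimates are written over [R] with
    [cabs]. *)
Lemma cltE (e : C) : 0 < e -> exists2 r : R, 0 < r & e = (r%:C)%C.
Proof.
by case: e => a b; rewrite ltcE /= => /andP[/eqP -> a0]; exists a.
Qed.

Lemma dnbhsC (t : C) (P : set C) : (\forall s \near t, P s) <->
  exists d : R, 0 < d /\ forall s, cabs (s - t) <= d -> P s.
Proof.
split.
  move=> /nbhs_ballP[e /= /cltE[r r0 ->]] H; exists (r / 2); rewrite divr_gt0//; split => // s sd.
  by apply: H; rewrite -ball_normE /= -cabsE ltcR cabsB (le_lt_trans sd)// ltr_pdivrMr// ltr_pMr// ltr1n.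
move=> [d [d0 H]]; apply/nbhs_ballP; exists (d%:C)%C => /=; first by rewrite ltcR.
by move=> s; rewrite -ball_normE /= -cabsE ltcR cabsB => /ltW/H.
Qed.

(** Multiplying the difference quotient out makes the inequality meaningful at [s = t] and gives the
    error term the form that Goursat's argument needs. *)
Lemma diff_epsdelta (f : C -> C) t : differentiable f t <->
  exists a : C, forall e : R, 0 < e -> exists d : R, 0 < d /\
    forall s, cabs (s - t) <= d -> cabs (f s - f t - a * (s - t)) <= e * cabs (s - t).
Proof.
split.
  move=> /derivable1_diffP df; exists ('D_1 f t) => e e0.
  have /cvgrPdist_le/(_ (e%:C)%C) := df; rewrite ltcR => /(_ e0).
  rewrite /dnbhs /within /= => /dnbhsC[d [d0 H]]; exists d; split => // s sd.
  have [->|st] := eqVneq s t; first by rewrite !subrr mulr0 subr0 cabs0 mulr0.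
  have := H (s - t); rewrite subr0 sd subr_eq0 => /(_ erefl st).
  rewrite -cabsE lecR /GRing.scale /= mulr1 subrK => H2.
  rewrite -ler_pdivrMr ?cabs_gt0 ?subr_eq0// -cabsV -cabsM.
  apply: le_trans H2; rewrite -cabsN le_eqVlt; apply/orP; left; apply/eqP; congr cabs.
  by rewrite mulrBl mulfK ?subr_eq0// opprB mulrC.
move=> [a H]; apply/derivable1_diffP; apply/cvg_ex; exists a.
apply/cvgrPdist_le => _ /cltE[e e0 ->].
have [d [d0 {}H]] := H e e0; rewrite /dnbhs /within /=; apply/dnbhsC.
exists d; split=> // h; rewrite subr0 => hd h0.
rewrite -cabsE lecR /GRing.scale /= mulr1.
have := H (h + t); rewrite addrK => /(_ hd).
rewrite -ler_pdivrMr ?cabs_gt0// -cabsV -cabsM; apply: le_trans.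
by rewrite cabsB mulrBl mulfK// mulrC.
Qed.

End Cabs.

(** * Integrals of continuous complex functions over a real segment *)

Section LineIntegral.
Variable R : realType.
Local Notation C := (complex R).
Local Notation mu := (@lebesgue_measure R).
Implicit Types (phi psi : R -> C) (a b x : R).

Definition rcont phi x := forall e : R, 0 < e ->
  exists d : R, 0 < d /\ forall y, `|y - x| <= d -> cabs (phi y - phi x) <= e.

Lemma rcontB phi psi x : rcont phi x -> rcont psi x ->
  rcont (fun y => phi y - psi y) x.
Proof.
move=> h1 h2 e e0; have e20 : 0 < e / 2 by rewrite divr_gt0.
have [d1 [d10 {}h1]] := h1 _ e20; have [d2 [d20 {}h2]] := h2 _ e20.
exists (Num.min d1 d2); split; first by rewrite lt_min d10.
move=> y; rewrite le_min => /andP[/h1 {}h1 /h2 {}h2].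
rewrite opprD addrACA -opprD (splitr e); apply: le_trans (cabsD _ _) _.
by rewrite cabsN; apply: lerD.
Qed.

Lemma rcont_cst (k : C) x : rcont (fun=> k) x.
Proof. by move=> e e0; exists 1; split => // y _; rewrite subrr cabs0 ltW. Qed.

Lemma rcontZ (k : C) phi x : rcont phi x -> rcont (fun y => k * phi y) x.
Proof.
move=> h e e0; have k0 : 0 < cabs k + 1 by rewrite ltr_wpDl ?cabs_ge0.
have [d [d0 {}h]] := h _ (divr_gt0 e0 k0); exists d; split => // y /h.
rewrite -mulrBr cabsM ler_pdivlMr// mulrC; apply: le_trans.
by rewrite ler_wpM2r ?cabs_ge0// lerDl.
Qed.

Lemma rcont_Re phi x : rcont phi x ->
  {for x, continuous (fun y => complex.Re (phi y))}.
Proof.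
move=> h; apply/(@cvgrPdist_le _ R^o) => e /h[d [d0 H]].
apply/nbhs_ballP; exists d => //= y; rewrite /ball /= => /ltW xy.
rewrite distrC -raddfB (le_trans (normRe_le_cabs _))//; apply: H.
by rewrite distrC.
Qed.

Lemma rcont_Im phi x : rcont phi x ->
  {for x, continuous (fun y => complex.Im (phi y))}.
Proof.
move=> h; apply/(@cvgrPdist_le _ R^o) => e /h[d [d0 H]].
apply/nbhs_ballP; exists d => //= y; rewrite /ball /= => /ltW xy.
rewrite distrC -raddfB (le_trans (normIm_le_cabs _))//; apply: H.
by rewrite distrC.
Qed.

Definition rconton a b phi := forall x, a <= x <= b -> rcont phi x.

Lemma rconton_integrable a b phi : rconton a b phi ->
  mu.-integrable `[a, b] (EFin \o (fun y => complex.Re (phi y))) /\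
  mu.-integrable `[a, b] (EFin \o (fun y => complex.Im (phi y))).
Proof.
move=> h; split.
  apply: continuous_compact_integrable; first exact: segment_compact.
  apply: continuous_in_subspaceT => x /set_mem /=; rewrite in_itv /= => /h.
  exact: rcont_Re.
apply: continuous_compact_integrable; first exact: segment_compact.
apply: continuous_in_subspaceT => x /set_mem /=; rewrite in_itv /= => /h.
exact: rcont_Im.
Qed.

Definition cI a b phi : C :=
  Complex (\int[mu]_(x in `[a, b]) complex.Re (phi x))
          (\int[mu]_(x in `[a, b]) complex.Im (phi x)).

Lemma eq_cI a b phi psi : (forall x, a <= x <= b -> phi x = psi x) ->
  cI a b phi = cI a b psi.
Proof.
by move=> h; rewrite /cI; congr Complex; apply: eq_Rintegral => x;
  move=> /set_mem /=; rewrite in_itv /= => /h ->.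
Qed.

Lemma cID a b phi psi : rconton a b phi -> rconton a b psi ->
  cI a b (fun x => phi x + psi x) = cI a b phi + cI a b psi.
Proof.
move=> /rconton_integrable[h1 h2] /rconton_integrable[h3 h4].
rewrite /cI [RHS]/GRing.add /=; congr Complex; rewrite -RintegralD//;
  by apply: eq_Rintegral => x _; rewrite raddfD.
Qed.

Lemma cIZ a b (k : C) phi : rconton a b phi ->
  cI a b (fun x => k * phi x) = k * cI a b phi.
Proof.
move=> /rconton_integrable[h1 h2].
have Zl r g : mu.-integrable `[a, b] (EFin \o g) ->
    mu.-integrable `[a, b] (EFin \o (fun y => r * g y)) /\
    \int[mu]_(x in `[a, b]) (r * g x) = r * \int[mu]_(x in `[a, b]) g x.
  move=> ig; split; last by apply: RintegralZl.
  by have := @integrableZl _ _ _ mu _ _ r _ ig; apply.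
case: k => k1 k2; rewrite /cI [RHS]/GRing.mul /=.
have -> : \int[mu]_(x in `[a, b]) complex.Re ((k1 +i* k2)%C * phi x) =
    \int[mu]_(x in `[a, b]) (k1 * complex.Re (phi x) - k2 * complex.Im (phi x)).
  by apply: eq_Rintegral => x _; case: (phi x).
have -> : \int[mu]_(x in `[a, b]) complex.Im ((k1 +i* k2)%C * phi x) =
    \int[mu]_(x in `[a, b]) (k1 * complex.Im (phi x) + k2 * complex.Re (phi x)).
  by apply: eq_Rintegral => x _; case: (phi x).
have [i11 e11] := Zl k1 _ h1; have [i12 e12] := Zl k1 _ h2.
have [i21 e21] := Zl k2 _ h1; have [i22 e22] := Zl k2 _ h2.
congr Complex.
  by rewrite -e11 -e22; apply: RintegralB.
by rewrite -e12 -e21; apply: RintegralD.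
Qed.

Lemma cIB a b phi psi : rconton a b phi -> rconton a b psi ->
  cI a b (fun x => phi x - psi x) = cI a b phi - cI a b psi.
Proof.
move=> h1 h2; rewrite -mulN1r -cIZ// -cID//; last first.
  by move=> x /h2; apply: rcontZ.
by apply: eq_cI => x _; rewrite mulN1r.
Qed.

Lemma cI_cst a b (k : C) : a <= b -> cI a b (fun=> k) = k * ((b - a)%:C)%C.
Proof.
move=> ab; rewrite /cI !Rintegral_cst//= lebesgue_measure_itv /= lte_fin.
have [_|ba] := ltP a b; first by case: k => k1 k2; apply/eqP; rewrite eq_complex /= !mulr0 subr0 add0r !eqxx.
have -> : a = b by apply/eqP; rewrite eq_le ab.
by rewrite subrr !mulr0 /=.
Qed.

Lemma cI_split a x b phi : a <= x -> x <= b -> rconton a b phi ->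
  cI a b phi = cI a x phi + cI x b phi.
Proof.
move=> ax xb /rconton_integrable[h1 h2].
rewrite /cI [RHS]/GRing.add /=.
have S g : mu.-integrable `[a, b] (EFin \o g) ->
  \int[mu]_(t in `[a, b]) g t = \int[mu]_(t in `[a, x]) g t + \int[mu]_(t in `[x, b]) g t.
  move=> ig; rewrite -(@Rintegral_itv_obnd_cbnd _ x (BRight b)); last first.
    by apply: integrableS ig => //; apply: subset_itvr; rewrite bnd_simp.
  by rewrite -(@Rintegral_itvB _ g (BLeft a) (BRight b) x) ?bnd_simp// addrC subrK.
by rewrite -!S.
Qed.

(** The factor 2 comes from bounding the real and the imaginary part separately. *)
Lemma cI_le a b phi (M : R) : a <= b -> rconton a b phi ->
  (forall x, a <= x <= b -> cabs (phi x) <= M) ->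
  cabs (cI a b phi) <= 2 * M * (b - a).
Proof.
move=> ab cphi hM; have [h1 h2] := rconton_integrable cphi.
have B g : mu.-integrable `[a, b] (EFin \o g) ->
  (forall x, a <= x <= b -> `|g x| <= M) -> `|\int[mu]_(t in `[a, b]) g t| <= M * (b - a).
  move=> ig gM; apply: le_trans (le_normr_Rintegral _ ig) _ => //.
  have -> : M * (b - a) = \int[mu]_(t in `[a, b]) M.
    have := cI_cst (M%:C)%C ab; rewrite /cI => /(congr1 (@complex.Re R)) /= ->.
    by rewrite mulr0 subr0.
  apply: le_Rintegral => //.
  - exact: (integrable_norm ig).
  - have ? : rconton a b (fun=> (M%:C)%C) by move=> x _; exact: rcont_cst.
    by have [] := rconton_integrable (phi := fun=> (M%:C)%C) (a := a) (b := b).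
apply: le_trans (cabs_le_ReIm _) _; rewrite /= mulr_natl mulr2n mulrDl; apply: lerD; apply: B => //.
  by move=> x /hM; apply: le_trans; exact: normRe_le_cabs.
by move=> x /hM; apply: le_trans; exact: normIm_le_cabs.
Qed.

Lemma Re_cI_ge a b phi (M : R) : a <= b -> rconton a b phi ->
  (forall x, a <= x <= b -> M <= complex.Re (phi x)) ->
  M * (b - a) <= complex.Re (cI a b phi).
Proof.
move=> ab cphi hM; have [h1 h2] := rconton_integrable cphi.
have -> : M * (b - a) = \int[mu]_(t in `[a, b]) M.
  have := cI_cst (M%:C)%C ab; rewrite /cI => /(congr1 (@complex.Re R)) /= ->.
  by rewrite mulr0 subr0.
apply: le_Rintegral => //.
- by have [] := rconton_integrable (phi := fun=> (M%:C)%C) (a := a) (b := b)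
    (fun x _ => @rcont_cst _ x).
Qed.

End LineIntegral.

(** * Bisection of rectangles *)

Section RectBisect.
Variable R : realType.
Implicit Types (a b c d x y : R) (P : R -> R -> R -> R -> Prop).

(** Here [u n] is the left end of the n-th of a sequence of nested intervals, of length
    [L / 2 ^+ n]; the supremum of the left ends lies in all of them. *)
Lemma nested_halves (u : nat -> R) (L : R) : 0 <= L ->
  (forall n, u n <= u n.+1 <= u n + L / 2 ^+ n.+1) ->
  exists x, forall n, u n <= x <= u n + L / 2 ^+ n.
Proof.
move=> L0 hu.
have up m n : (m <= n)%N -> u m <= u n.
  by move=> /subnK <-; elim: (n - m)%N => // k /le_trans; apply; rewrite addSn; case/andP: (hu (k + m)%N).
have dn m n : (m <= n)%N -> u n + L / 2 ^+ n <= u m + L / 2 ^+ m.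
  move=> /subnK <-; elim: (n - m)%N => // k; apply: le_trans; rewrite addSn.
  have /andP[_ h] := hu (k + m)%N.
  have -> : L / 2 ^+ (k + m) = L / 2 ^+ (k + m).+1 + L / 2 ^+ (k + m).+1.
    by rewrite exprS -mulrDl; field; rewrite expf_neq0.
  by rewrite addrA lerD2r.
have L2 n : 0 <= L / 2 ^+ n by rewrite divr_ge0// exprn_ge0.
have ub n m : u m <= u n + L / 2 ^+ n.
  have [mn|/ltnW nm] := leqP m n; first by rewrite (le_trans (up _ _ mn))// lerDl.
  by rewrite (le_trans _ (dn _ _ nm))// lerDl.
have hs n : ubound (range u) (u n + L / 2 ^+ n) by move=> _ [m _ <-].
exists (sup (range u)) => n; apply/andP; split.
  by apply: ub_le_sup; [exists (u 0%N + L / 2 ^+ 0); exact: hs|exists n].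
by apply: ge_sup; [exists (u n), n|exact: hs].
Qed.

Lemma half_pow_small (L e : R) : 0 < e -> exists n, L / 2 ^+ n <= e.
Proof.
move=> e0; have [n hn] : exists n : nat, L / e <= n%:R.
  have := archi_boundP (normr_ge0 (L / e)).
  by move=> /ltW h; eexists; exact: le_trans (ler_norm _) h.
exists n; rewrite ler_pdivrMr ?exprn_gt0// mulrC -ler_pdivrMr//.
by rewrite (le_trans hn)// -natrX ler_nat ltnW// ltn_expl.
Qed.

(** Cousin's argument: if [P] failed, quartering would produce nested rectangles on which it fails,
    shrinking to a point where the local hypothesis gives a contradiction. *)
Lemma rect_bisect P a0 b0 c0 d0 : a0 <= b0 -> c0 <= d0 ->
  (forall a b c d, a <= b -> c <= d ->
     P a ((a + b) / 2) c ((c + d) / 2) -> P ((a + b) / 2) b c ((c + d) / 2) ->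
     P a ((a + b) / 2) ((c + d) / 2) d -> P ((a + b) / 2) b ((c + d) / 2) d ->
     P a b c d) ->
  (forall x y, a0 <= x <= b0 -> c0 <= y <= d0 -> exists e, 0 < e /\
     forall a b c d, a <= x <= b -> c <= y <= d -> b - a <= e -> d - c <= e ->
     P a b c d) ->
  P a0 b0 c0 d0.
Proof.
move=> ab cd hstep hloc; apply: contrapT => nP.
pose L1 := b0 - a0; pose L2 := d0 - c0.
have L10 : 0 <= L1 by rewrite subr_ge0.
have L20 : 0 <= L2 by rewrite subr_ge0.
pose bad n (q : R * R) := ~ P q.1 (q.1 + L1 / 2 ^+ n) q.2 (q.2 + L2 / 2 ^+ n).
pose nxt n (q q' : R * R) := [/\ bad n.+1 q', q.1 <= q'.1 <= q.1 + L1 / 2 ^+ n.+1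
   & q.2 <= q'.2 <= q.2 + L2 / 2 ^+ n.+1].
have exn n q : bad n q -> exists q', nxt n q q'.
  move=> bq; apply: contrapT => nex; apply: bq.
  have L1n : L1 / 2 ^+ n = L1 / 2 ^+ n.+1 + L1 / 2 ^+ n.+1.
    by rewrite exprS; field; rewrite expf_neq0.
  have L2n : L2 / 2 ^+ n = L2 / 2 ^+ n.+1 + L2 / 2 ^+ n.+1.
    by rewrite exprS; field; rewrite expf_neq0.
  have p1 : 0 <= L1 / 2 ^+ n.+1 by rewrite divr_ge0// exprn_ge0.
  have p2 : 0 <= L2 / 2 ^+ n.+1 by rewrite divr_ge0// exprn_ge0.
  move: L1n L2n p1 p2 nex; rewrite /nxt /bad.
  set l1 := L1 / 2 ^+ n.+1; set l2 := L2 / 2 ^+ n.+1 => -> -> p1 p2 nex.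
  have m1 : (q.1 + (q.1 + (l1 + l1))) / 2 = q.1 + l1 by field.
  have m2 : (q.2 + (q.2 + (l2 + l2))) / 2 = q.2 + l2 by field.
  have G x y : (x = q.1 \/ x = q.1 + l1) -> (y = q.2 \/ y = q.2 + l2) ->
    P x (x + l1) y (y + l2).
    move=> hx hy; apply: contrapT => nP'; apply: nex; exists (x, y); split => //=.
      by case: hx => ->; rewrite lexx ?lerDl p1.
    by case: hy => ->; rewrite lexx ?lerDl p2.
  have e1 : q.1 + (l1 + l1) = q.1 + l1 + l1 by rewrite addrA.
  have e2 : q.2 + (l2 + l2) = q.2 + l2 + l2 by rewrite addrA.
  apply: hstep; rewrite ?m1 ?m2 ?e1 ?e2 ?lerDl ?addr_ge0//.
  - by rewrite -addrA lerDl addr_ge0.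
  - by rewrite -addrA lerDl addr_ge0.
  - by apply: G; left.
  - by apply: G; [right|left].
  - by apply: G; [left|right].
  - by apply: G; right.
(* The fallback [q] is never reached along the sequence [s]: each [s n] is bad, so [exn] provides a
   successor. *)
pose F n q : R * R := if pselect (exists q', nxt n q q') is left h then sval (cid h) else q.
pose s := fix s n := if n is m.+1 then F m (s m) else (a0, c0).
have bads n : bad n (s n).
  elim: n => [|n IH] /=.
    by rewrite /bad /= expr0 !divr1 /L1 /L2 (addrC a0) (addrC c0) !subrK.
  rewrite /F; case: pselect => [h|/(_ (exn _ _ IH))//].
  by case: (cid h) => q' /= [].
have nxts n : nxt n (s n) (s n.+1).
  rewrite /= /F; case: pselect => [h|/(_ (exn _ _ (bads n)))//].
  by case: (cid h).
have [x hx] := @nested_halves (fun n => (s n).1) L1 L10 (fun n => let: And3 _ h _ := nxts n in h).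
have [y hy] := @nested_halves (fun n => (s n).2) L2 L20 (fun n => let: And3 _ _ h := nxts n in h).
have := hx 0%N; have := hy 0%N; rewrite /= expr0 !divr1 /L1 /L2 (addrC a0) (addrC c0) !subrK => hy0 hx0.
have [e [e0 H]] := hloc x y hx0 hy0.
have [n1 hn1] := half_pow_small L1 e0; have [n2 hn2] := half_pow_small L2 e0.
pose n := maxn n1 n2.
have sm L k : 0 <= L -> (k <= n)%N -> L / 2 ^+ k <= e -> L / 2 ^+ n <= e.
  move=> L0 kn; apply: le_trans; rewrite ler_wpM2l// lef_pV2 ?posrE ?exprn_gt0//.
  by rewrite ler_eXn2l// ltr1n.
apply: (bads n); apply: H; rewrite ?hx ?hy//.
  by rewrite addrC addKr; apply: sm hn1 => //; rewrite leq_maxl.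
by rewrite addrC addKr; apply: sm hn2 => //; rewrite leq_maxr.
Qed.
End RectBisect.

(** * Contour integrals over rectangles and Goursat's theorem *)

Section Goursat.
Variable R : realType.
Local Notation C := (complex R).
Implicit Types (f g : C -> C) (a b c d x y : R) (t : C).

Definition ccont f t := forall e : R, 0 < e ->
  exists d : R, 0 < d /\ forall s, cabs (s - t) <= d -> cabs (f s - f t) <= e.

Lemma differentiable_ccont f t : differentiable f t -> ccont f t.
Proof.
move=> /diff_epsdelta[k H] e e0.
have [d [d0 {}H]] := H 1 ltr01.
have k0 : 0 < cabs k + 1 by rewrite ltr_wpDl ?cabs_ge0.
exists (Num.min d (e / (cabs k + 1))); split; first by rewrite lt_min d0 divr_gt0.
move=> s; rewrite le_min => /andP[/H {}H hs].
have -> : f s - f t = (f s - f t - k * (s - t)) + k * (s - t) by rewrite subrK.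
apply: le_trans (cabsD _ _) _; rewrite cabsM.
rewrite ler_pdivlMr// in hs; apply: le_trans (lerD H (lexx _)) _.
by rewrite -mulrDl addrC mulrC.
Qed.

Lemma ccontB f g t : ccont f t -> ccont g t -> ccont (fun s => f s - g s) t.
Proof.
move=> h1 h2 e e0; have e20 : 0 < e / 2 by rewrite divr_gt0.
have [d1 [d10 {}h1]] := h1 _ e20; have [d2 [d20 {}h2]] := h2 _ e20.
exists (Num.min d1 d2); split; first by rewrite lt_min d10.
move=> y; rewrite le_min => /andP[/h1 {}h1 /h2 {}h2].
rewrite opprD addrACA -opprD (splitr e); apply: le_trans (cabsD _ _) _.
by rewrite cabsN; apply: lerD.
Qed.

Lemma ccont_horiz f x y : ccont f (x +i* y)%C -> rcont (fun u => f (u +i* y)%C) x.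
Proof.
move=> h e /h[d [d0 H]]; exists d; split => // u ud; apply: H.
have -> : (u +i* y - x +i* y)%C = ((u - x)%:C)%C by apply/eqP; rewrite eq_complex /= subrr !eqxx.
by rewrite cabsR.
Qed.

Lemma ccont_vert f x y : ccont f (x +i* y)%C -> rcont (fun u => f (x +i* u)%C) y.
Proof.
move=> h e /h[d [d0 H]]; exists d; split => // u ud; apply: H.
have -> : (x +i* u - x +i* y)%C = 'i%C * ((u - y)%:C)%C.
  by apply/eqP; rewrite eq_complex /=; apply/andP; split; apply/eqP; ring.
by rewrite cabsM cabsR cabs_i mul1r.
Qed.

Definition conton f a b c d :=
  forall x y, a <= x <= b -> c <= y <= d -> ccont f (x +i* y)%C.

(* The integral of [f dz] over the counterclockwise boundary of [a, b] x [c, d]. *)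
Definition RI f a b c d : C :=
  cI a b (fun x => f (x +i* c)%C - f (x +i* d)%C) +
  'i%C * cI c d (fun y => f (b +i* y)%C - f (a +i* y)%C).

(** Continuity is asked along the boundary alone, so that the integral can be handled around points
    where [f] is singular. *)
Definition contbd f a b c d := forall x y, a <= x <= b -> c <= y <= d ->
  x = a \/ x = b \/ y = c \/ y = d -> ccont f (x +i* y)%C.

Lemma conton_bd f a b c d : conton f a b c d -> contbd f a b c d.
Proof. by move=> H x y hx hy _; apply: H. Qed.

Lemma rcontonH f a b c d y : contbd f a b c d -> c <= d -> y = c \/ y = d ->
  rconton a b (fun x => f (x +i* y)%C).
Proof.
move=> H cd hy x hx; apply: ccont_horiz; apply: H => //; last by right; right.
by case: hy => ->; rewrite lexx cd.
Qed.

Lemma rcontonV f a b c d x : contbd f a b c d -> a <= b -> x = a \/ x = b ->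
  rconton c d (fun y => f (x +i* y)%C).
Proof.
move=> H ab hx y hy; apply: ccont_vert; apply: H => //; last by case: hx; [left|right; left].
by case: hx => ->; rewrite lexx ab.
Qed.

Lemma contonS f a b c d a' b' c' d' : a <= a' -> b' <= b -> c <= c' -> d' <= d ->
  conton f a b c d -> conton f a' b' c' d'.
Proof.
move=> h1 h2 h3 h4 H x y /andP[hx1 hx2] /andP[hy1 hy2].
by apply: H; rewrite ?(le_trans h1)// ?(le_trans h3)// ?(le_trans hx2)// (le_trans hy2).
Qed.

Lemma rcontonB a b (phi psi : R -> C) : rconton a b phi -> rconton a b psi ->
  rconton a b (fun x => phi x - psi x).
Proof. by move=> h1 h2 x hx; apply: rcontB; [exact: h1|exact: h2]. Qed.

Lemma rcontonS a b a' b' (phi : R -> C) : a <= a' -> b' <= b -> rconton a b phi ->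
  rconton a' b' phi.
Proof.
by move=> h1 h2 H x /andP[hx1 hx2]; apply: H; rewrite (le_trans h1)// (le_trans hx2).
Qed.

Lemma RI_le f a b c d (M : R) : a <= b -> c <= d -> contbd f a b c d ->
  (forall x y, a <= x <= b -> c <= y <= d ->
     x = a \/ x = b \/ y = c \/ y = d -> cabs (f (x +i* y)%C) <= M) ->
  cabs (RI f a b c d) <= 4 * M * ((b - a) + (d - c)).
Proof.
move=> ab cd H hM; apply: le_trans (cabsD _ _) _.
have aab : a <= a <= b by rewrite lexx.
have bab : a <= b <= b by rewrite lexx ab.
have ccd : c <= c <= d by rewrite lexx.
have dcd : c <= d <= d by rewrite lexx cd.
rewrite cabsM cabs_i mul1r mulrDr; have -> : 4 * M = 2 * (M + M) by ring.
apply: lerD.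
  apply: cI_le => //.
    by apply: rcontonB; apply: (rcontonH H cd); [left|right].
  move=> x hx; apply: le_trans (cabsD _ _) _; rewrite cabsN; apply: lerD; apply: hM => //.
    by right; right; left.
  by right; right; right.
apply: cI_le => //.
  by apply: rcontonB; apply: (rcontonV H ab); [right|left].
move=> x hx; apply: le_trans (cabsD _ _) _; rewrite cabsN; apply: lerD; apply: hM => //.
  by right; left.
by left.
Qed.

Lemma RI_splitx f a x b c d : a <= x -> x <= b -> c <= d -> contbd f a b c d ->
  rconton c d (fun y => f (x +i* y)%C) ->
  RI f a b c d = RI f a x c d + RI f x b c d.
Proof.
move=> ax xb cd H hx; have ab := le_trans ax xb.
have Va := rcontonV H ab (or_introl erefl).
have Vb := rcontonV H ab (or_intror erefl).
rewrite /RI (cI_split ax xb); last first.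
  by apply: rcontonB; apply: (rcontonH H cd); [left|right].
rewrite [X in _ + _ * X](_ : _ = cI c d (fun y => f (b +i* y)%C - f (x +i* y)%C) +
    cI c d (fun y => f (x +i* y)%C - f (a +i* y)%C)); first by ring.
rewrite -cID; do ?by apply: rcontonB.
by apply: eq_cI => y _; rewrite subrKA.
Qed.

Lemma RI_splity f a b c y d : a <= b -> c <= y -> y <= d -> contbd f a b c d ->
  rconton a b (fun x => f (x +i* y)%C) ->
  RI f a b c d = RI f a b c y + RI f a b y d.
Proof.
move=> ab cy yd H hy; have cd := le_trans cy yd.
have Hc := rcontonH H cd (or_introl erefl).
have Hd := rcontonH H cd (or_intror erefl).
rewrite /RI (cI_split cy yd); last first.
  by apply: rcontonB; apply: (rcontonV H ab); [right|left].
rewrite [X in X + _](_ : _ = cI a b (fun x => f (x +i* c)%C - f (x +i* y)%C) +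
    cI a b (fun x => f (x +i* y)%C - f (x +i* d)%C)); first by ring.
rewrite -cID; do ?by apply: rcontonB.
by apply: eq_cI => x _; rewrite subrKA.
Qed.

Lemma RIB f g a b c d : a <= b -> c <= d -> contbd f a b c d -> contbd g a b c d ->
  RI (fun t => f t - g t) a b c d = RI f a b c d - RI g a b c d.
Proof.
move=> ab cd hf hg.
have fH : rconton a b (fun x => f (x +i* c)%C - f (x +i* d)%C).
  by apply: rcontonB; apply: (rcontonH hf cd); [left|right].
have gH : rconton a b (fun x => g (x +i* c)%C - g (x +i* d)%C).
  by apply: rcontonB; apply: (rcontonH hg cd); [left|right].
have fV : rconton c d (fun y => f (b +i* y)%C - f (a +i* y)%C).
  by apply: rcontonB; apply: (rcontonV hf ab); [right|left].
have gV : rconton c d (fun y => g (b +i* y)%C - g (a +i* y)%C).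
  by apply: rcontonB; apply: (rcontonV hg ab); [right|left].
rewrite /RI opprD addrACA -mulrBr -!cIB//.
by congr (_ + _ * _); apply: eq_cI => x _; ring.
Qed.

Lemma RIZ (k : C) f a b c d : a <= b -> c <= d -> contbd f a b c d ->
  RI (fun t => k * f t) a b c d = k * RI f a b c d.
Proof.
move=> ab cd hf.
rewrite /RI mulrDr mulrCA -(@cIZ _ a b k); last first.
  by apply: rcontonB; apply: (rcontonH hf cd); [left|right].
rewrite -(@cIZ _ c d k); last first.
  by apply: rcontonB; apply: (rcontonV hf ab); [right|left].
by congr (_ + _ * _); apply: eq_cI => x _; rewrite mulrBr.
Qed.

(** Differences across opposite sides are constant: the horizontal sides contribute i k1 (c - d)(b -
    a) and the vertical ones i k1 (b - a)(d - c). *)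
Lemma RI_affine (k0 k1 : C) a b c d : a <= b -> c <= d ->
  RI (fun t => k0 + k1 * t) a b c d = 0.
Proof.
move=> ab cd; rewrite /RI.
rewrite (@eq_cI _ a b _ (fun=> k1 * (0 +i* (c - d))%C)); last first.
  move=> x _; rewrite opprD addrACA subrr add0r -mulrBr; congr (_ * _).
  by apply/eqP; rewrite eq_complex /= subrr !eqxx.
rewrite (@eq_cI _ c d _ (fun=> k1 * ((b - a)%:C)%C)); last first.
  move=> x _; rewrite opprD addrACA subrr add0r -mulrBr; congr (_ * _).
  by apply/eqP; rewrite eq_complex /= subrr !eqxx.
rewrite !cI_cst//; case: k1 => u v.
apply/eqP; rewrite eq_complex /=; apply/andP; split; apply/eqP; ring.
Qed.

(** The bound [e * L ^+ 2], with [L] the half-perimeter, is exactly additive under quartering, since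
    4 (L/2)^2 = L^2. So [rect_bisect] reduces it to small rectangles around a point of
    differentiability. *)
Theorem goursat f a b c d : a <= b -> c <= d ->
  (forall x y, a <= x <= b -> c <= y <= d -> differentiable f (x +i* y)%C) ->
  RI f a b c d = 0.
Proof.
move=> ab cd df.
have cf : conton f a b c d by move=> x y hx hy; apply: differentiable_ccont; exact: df.
pose L := (b - a) + (d - c).
have L0 : 0 <= L by rewrite addr_ge0// subr_ge0.
suff H e : 0 < e -> cabs (RI f a b c d) <= e * L ^+ 2.
  apply/eqP; rewrite -cabs_eq0 eq_le cabs_ge0 andbT; apply/ler_addgt0Pr => e e0.
  have L20 : 0 < L ^+ 2 + 1 by rewrite ltr_wpDl// sqr_ge0.
  rewrite add0r; apply: le_trans (H (e / (L ^+ 2 + 1)) (divr_gt0 e0 L20)) _.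
  by rewrite mulrAC ler_pdivrMr// ler_wpM2l ?(ltW e0)// lerDl.
move=> e0.
pose P a' b' c' d' := a <= a' -> b' <= b -> c <= c' -> d' <= d -> a' <= b' -> c' <= d' ->
  cabs (RI f a' b' c' d') <= e * ((b' - a') + (d' - c')) ^+ 2.
suff : P a b c d by apply.
apply: rect_bisect => //.
  move=> a' b' c' d' ab' cd' h1 h2 h3 h4 ha hb hc hd _ _.
  pose mx := (a' + b') / 2; pose my := (c' + d') / 2.
  have [am mb] : a' <= mx /\ mx <= b' by rewrite /mx; split; lra.
  have [cm md] : c' <= my /\ my <= d' by rewrite /my; split; lra.
  have cf' : conton f a' b' c' d' by apply: contonS cf.
  have {}h1 := h1 ha (le_trans mb hb) hc (le_trans md hd) am cm.
  have {}h2 := h2 (le_trans ha am) hb hc (le_trans md hd) mb cm.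
  have {}h3 := h3 ha (le_trans mb hb) (le_trans hc cm) hd am md.
  have {}h4 := h4 (le_trans ha am) hb (le_trans hc cm) hd mb md.
  have xm y : c' <= y <= d' -> rconton a' b' (fun x => f (x +i* y)%C).
    by move=> hy x hx; apply: ccont_horiz; apply: cf'.
  have ym x : a' <= x <= b' -> rconton c' d' (fun y => f (x +i* y)%C).
    by move=> hx y hy; apply: ccont_vert; apply: cf'.
  have sub u v u' v' : a' <= u -> v <= b' -> c' <= u' -> v' <= d' -> contbd f u v u' v'.
    by move=> *; apply: conton_bd; apply: contonS cf'.
  rewrite (RI_splitx am mb cd'); [|exact: sub|by apply: ym; rewrite am].
  rewrite (RI_splity am cm md); [|exact: sub|]; last first.
    by apply: rcontonS (xm my _); rewrite ?lexx// cm.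
  rewrite (RI_splity mb cm md); [|exact: sub|]; last first.
    by apply: rcontonS (xm my _); rewrite ?lexx// cm.
  apply: le_trans (cabsD _ _) _.
  apply: le_trans (lerD (cabsD _ _) (cabsD _ _)) _.
  apply: le_trans (lerD (lerD h1 h3) (lerD h2 h4)) _.
  by rewrite /mx /my le_eqVlt; apply/orP; left; apply/eqP; field.
move=> x y hx hy; have [k H] := (diff_epsdelta f (x +i* y)%C).1 (df x y hx hy).
have [r [r0 {}H]] := H (e / 4) (divr_gt0 e0 (ltr0n _ 4)).
exists (r / 2); split; first by rewrite divr_gt0.
move=> a' b' c' d' hx' hy' hab hcd ha hb hc hd ab' cd'.
have cf' : conton f a' b' c' d' by apply: contonS cf.
set p := (x +i* y)%C in H *; set l := (b' - a') + (d' - c').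
have l0 : 0 <= l by rewrite addr_ge0// subr_ge0.
(* [A] is the first-order approximation of [f] at [p]. Its integral vanishes, so only the error, at
   most [e / 4 * l], is integrated; the 4 compensates the factor 4 of [RI_le]. *)
pose A t := (f p - k * p) + k * t.
have cA : conton A a' b' c' d'.
  move=> u v _ _ e' e'0; have k0 : 0 < cabs k + 1 by rewrite ltr_wpDl ?cabs_ge0.
  exists (e' / (cabs k + 1)); split; first by rewrite divr_gt0.
  move=> s; rewrite /A opprD addrACA subrr add0r -mulrBr cabsM ler_pdivlMr// mulrC.
  by apply: le_trans; rewrite ler_wpM2r ?cabs_ge0// lerDl.
have -> : RI f a' b' c' d' = RI (fun t => f t - A t) a' b' c' d'.
  by rewrite RIB ?RI_affine ?subr0//; apply: conton_bd.
apply: le_trans (RI_le (M := e / 4 * l) ab' cd' _ _) _.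
- by move=> u v hu hv _; apply: ccontB; [exact: cf'|exact: cA].
- move=> u v /andP[hu1 hu2] /andP[hv1 hv2] _.
  have -> : f (u +i* v)%C - A (u +i* v)%C = f (u +i* v)%C - f p - k * ((u +i* v)%C - p).
    by rewrite /A; ring.
  have sl : cabs ((u +i* v)%C - p) <= l.
    apply: le_trans (cabs_le_ReIm _) _; rewrite /=.
    move: hx' hy' => /andP[? ?] /andP[? ?].
    by apply: lerD; rewrite ler_norml; apply/andP; split; lra.
  apply: le_trans (H _ _) _; first by apply: le_trans sl _; rewrite /l; lra.
  by rewrite ler_wpM2l// divr_ge0// ltW.
by rewrite -/l le_eqVlt; apply/orP; left; apply/eqP; field.
Qed.

(** The frame between the two rectangles is cut into four rectangles to which Goursat's theorem
    applies; [f] may be singular strictly inside the inner one. *)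
Lemma RI_shrink f a b c d a' b' c' d' :
  a <= a' -> a' <= b' -> b' <= b -> c <= c' -> c' <= d' -> d' <= d ->
  (forall x y, a <= x <= b -> c <= y <= d ->
     x <= a' \/ b' <= x \/ y <= c' \/ d' <= y -> differentiable f (x +i* y)%C) ->
  RI f a b c d = RI f a' b' c' d'.
Proof.
move=> h1 h2 h3 h4 h5 h6 df.
have cf x y : a <= x <= b -> c <= y <= d ->
     x <= a' \/ b' <= x \/ y <= c' \/ d' <= y -> ccont f (x +i* y)%C.
  by move=> hx hy H; apply: differentiable_ccont; apply: df.
have ab' := le_trans h1 h2; have cd' := le_trans h4 h5.
have a'b := le_trans h2 h3; have c'd := le_trans h5 h6.
have ab := le_trans h1 a'b; have cd := le_trans h4 c'd.
have G u v w z : a <= u -> u <= v -> v <= b -> c <= w -> w <= z -> z <= d ->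
    v <= a' \/ b' <= u \/ z <= c' \/ d' <= w -> RI f u v w z = 0.
  move=> au uv vb cw wz zd H; apply: goursat => // x y /andP[ux xv] /andP[wy yz].
  apply: df.
  - by rewrite (le_trans au)// (le_trans xv).
  - by rewrite (le_trans cw)// (le_trans yz).
  - case: H => [H|[H|[H|H]]].
    + by left; exact: le_trans H.
    + by right; left; exact: le_trans ux.
    + by right; right; left; exact: le_trans H.
    + by right; right; right; exact: le_trans wy.
have bd u v w z : a <= u -> v <= b -> c <= w -> z <= d -> u <= a' -> b' <= v -> w <= c' -> d' <= z ->
    contbd f u v w z.
  move=> au vb cw zd ua bv wc dz x y /andP[ux xv] /andP[wy yz] H; apply: cf.
  - by rewrite (le_trans au)// (le_trans xv).
  - by rewrite (le_trans cw)// (le_trans yz).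
  - by case: H => [->|[->|[->|->]]]; [left|right; left|right; right; left|right; right; right].
have V x : a <= x -> x <= b -> x <= a' \/ b' <= x -> rconton c d (fun y => f (x +i* y)%C).
  move=> ax xb H y hy; apply: ccont_vert; apply: cf => //; first by rewrite ax.
  by case: H; [left|right; left].
have H y : c <= y -> y <= d -> y <= c' \/ d' <= y -> rconton a' b' (fun x => f (x +i* y)%C).
  move=> cy yd Hy x /andP[ax xb]; apply: ccont_horiz; apply: cf.
  - by rewrite (le_trans h1)// (le_trans xb).
  - by rewrite cy.
  - by case: Hy; right; right; [left|right].
rewrite (RI_splitx h1 a'b cd); [|exact: bd|by apply: (V _ h1 a'b); left].
rewrite (RI_splitx h2 h3 cd); [|exact: bd|by apply: (V _ ab' h3); right].
rewrite (RI_splity h2 h4 c'd); [|exact: bd|by apply: (H _ h4 c'd); left].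
rewrite (RI_splity h2 h5 h6); [|exact: bd|by apply: (H _ cd' h6); right].
rewrite (G a a')//; last by left.
rewrite (G b' b)//; last by right; left.
rewrite (G a' b' c c')//; last by right; right; left.
rewrite (G a' b' d' d)//; last by right; right; right.
by rewrite !add0r !addr0.
Qed.
End Goursat.

(** * Square contours centred at 0 *)

Section Cauchy.
Variable R : realType.
Local Notation C := (complex R).
Implicit Types (f g : C -> C) (r x y : R) (s t : C).

Lemma cabs_nat n : cabs (n%:R : C) = n%:R.
Proof. by rewrite -(rmorph_nat (real_complex R)) cabsR normr_nat. Qed.

Lemma differentiable_fun_id t : differentiable (fun s : C => s) t.
Proof. exact: ex_diff. Qed.

Lemma differentiable_funB f g t : differentiable f t -> differentiable g t ->
  differentiable (fun s => f s - g s) t.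
Proof. by move=> hf hg; exact: (differentiableB hf hg). Qed.

Lemma differentiable_funD f g t : differentiable f t -> differentiable g t ->
  differentiable (fun s => f s + g s) t.
Proof. by move=> hf hg; exact: (differentiableD hf hg). Qed.

Lemma differentiable_funC (k : C) t : differentiable (fun=> k) t.
Proof. exact: (@differentiable_cst _ _ _ k). Qed.

Lemma differentiable_funM f g t : differentiable f t -> differentiable g t ->
  differentiable (fun s => f s * g s) t.
Proof. by move=> hf hg; exact: (differentiableM hf hg). Qed.

Lemma differentiable_funX f n t : differentiable f t ->
  differentiable (fun s => f s ^+ n) t.
Proof.
move=> hf; elim: n => [|n IH].
  by apply: (@differentiable_cst _ _ _ (1 : C)).
by under eq_fun do rewrite exprS; exact: differentiable_funM.
Qed.

Lemma differentiable_funV f t : differentiable f t -> f t != 0 ->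
  differentiable (fun s => (f s)^-1) t.
Proof. by move=> hf ft; exact: (differentiableV hf ft). Qed.

Lemma differentiable_sub t0 t : differentiable (fun s : C => s - t0) t.
Proof.
apply: differentiable_funB; first exact: differentiable_fun_id.
exact: (@differentiable_cst _ _ _ t0).
Qed.

Lemma differentiable_big_prod (I : Type) (l : seq I) (f : I -> C -> C) t :
  (forall i, differentiable (f i) t) -> differentiable (fun u => \prod_(i <- l) f i u) t.
Proof.
move=> df; elim: l => [|i l IH].
  by under eq_fun do rewrite big_nil; exact: differentiable_funC.
by under eq_fun do rewrite big_cons; apply: differentiable_funM; [exact: df|exact: IH].
Qed.

Notation SQ f r := (RI f (- r) r (- r) r).

Definition onsq r s := exists x y, [/\ s = (x +i* y)%C, - r <= x <= r, - r <= y <= r &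
  x = - r \/ x = r \/ y = - r \/ y = r].

(** This is the source of the annuli [r <= cabs s <= 2 * r] in the later hypotheses: they contain
    the boundary of the square of half-side [r]. *)
Lemma onsq_le r s : 0 < r -> onsq r s -> r <= cabs s <= 2 * r.
Proof.
move=> r0 [x [y [-> hx hy H]]]; apply/andP; split; last first.
  apply: le_trans (cabs_le_ReIm _) _; rewrite /= mulr_natl mulr2n.
  by apply: lerD; rewrite ler_norml.
have [h|h] : `|x| = r \/ `|y| = r.
  case: H => [->|[->|[->|->]]]; rewrite ?normrN; [left|left|right|right]; exact: gtr0_norm.
  by rewrite -h; exact: normRe_le_cabs (x +i* y)%C.
by rewrite -h; exact: normIm_le_cabs (x +i* y)%C.
Qed.

Lemma SQ_le f r M : 0 < r -> (forall s, onsq r s -> ccont f s /\ cabs (f s) <= M) ->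
  cabs (SQ f r) <= 16 * M * r.
Proof.
move=> r0 H; have rr : - r <= r by rewrite ge0_cp// ltW.
have -> : 16 * M * r = 4 * M * ((r - - r) + (r - - r)) by ring.
by apply: RI_le => // x y hx hy hxy; apply: (H (x +i* y)%C _).1 || apply: (H (x +i* y)%C _).2; exists x, y.
Qed.

Lemma SQ_shrink f r L : 0 < r -> r <= L ->
  (forall s, r <= cabs s <= 2 * L -> differentiable f s) -> SQ f L = SQ f r.
Proof.
move=> r0 rL H; apply: RI_shrink; rewrite ?lerN2//; do ?lra.
move=> x y /andP[x1 x2] /andP[y1 y2] hxy; apply: H; apply/andP; split; last first.
  apply: le_trans (cabs_le_ReIm _) _; rewrite /= mulr_natl mulr2n.
  by apply: lerD; rewrite ler_norml; apply/andP; split; lra.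
have [h|h] : r <= `|x| \/ r <= `|y|.
  case: hxy => [h|[h|[h|h]]]; [left|left|right|right]; rewrite ler_normr; apply/orP;
   by [left; lra|right; lra].
  by apply: le_trans h _; exact: normRe_le_cabs (x +i* y)%C.
by apply: le_trans h _; exact: normIm_le_cabs (x +i* y)%C.
Qed.

(* The circulation of 1/s: on opposite sides the integrand adds up to 2 i r / (x^2 + r^2). *)
Lemma SQ_inv_ge r : 0 < r -> 4 <= cabs (SQ (fun s => s^-1) r).
Proof.
move=> r0; have rr : - r <= r by rewrite ge0_cp// ltW.
pose q x : R := 2 * r / (x ^+ 2 + r ^+ 2).
have q0 x : x ^+ 2 + r ^+ 2 != 0 by rewrite gt_eqF// ltr_wpDl ?sqr_ge0// exprn_gt0.
have cq : rconton (- r) r (fun x => ((q x)%:C)%C).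
  (* [q] is the restriction to the real axis of a rational function with poles at i r and - i r, so
     its continuity follows from complex differentiability. *)
  move=> x _; pose F (s : C) : C := (2 * r)%:C%C * (s ^+ 2 + (r ^+ 2)%:C%C)^-1.
  have := @ccont_horiz _ F x 0; rewrite /rcont.
  have E u : F (u +i* 0)%C = ((q u)%:C)%C.
    by rewrite /F /q complexr0 -rmorphXn -rmorphD -fmorphV -rmorphM.
  move=> H e e0; have [|d [d0 Hd]] := H _ e e0.
    apply: differentiable_ccont; apply: differentiable_funM.
      exact: differentiable_funC.
    apply: differentiable_funV.
      apply: differentiable_funD; last exact: differentiable_funC.
      by apply: differentiable_funX; exact: differentiable_fun_id.
    by rewrite complexr0 -rmorphXn -rmorphD fmorph_eq0.
  by exists d; split=> // y /Hd; rewrite !E.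
have -> : SQ (fun s => s^-1) r = 2 * 'i%C * cI (- r) r (fun x => ((q x)%:C)%C).
  have inv_sub (e k u v : C) x : e != 0 -> u * v = e * ((x ^+ 2 + r ^+ 2)%:C)%C ->
      v - u = e * k * ((2 * r)%:C)%C -> u^-1 - v^-1 = k * ((q x)%:C)%C.
    move=> e0 uv vu; have : u * v != 0 by rewrite uv mulf_neq0// fmorph_eq0 q0.
    rewrite mulf_eq0 negb_or => /andP[u0 v0].
    have -> : u^-1 - v^-1 = (v - u) / (u * v) by field; rewrite u0 v0.
    by rewrite uv vu -(mulrA e k) invfM mulrACA divff// mul1r /q [in RHS]rmorphM /= fmorphV /= mulrA.
  have E1 x : ((x +i* - r)%C^-1 - (x +i* r)%C^-1 : C) = 'i%C * ((q x)%:C)%C.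
    apply: (inv_sub 1); rewrite ?oner_eq0//;
      apply/eqP; rewrite eq_complex /=; apply/andP; split; apply/eqP; ring.
  have E2 y : ((r +i* y)%C^-1 - (- r +i* y)%C^-1 : C) = ((q y)%:C)%C.
    rewrite -[RHS]mul1r; apply: (inv_sub (- 1)); rewrite ?oppr_eq0 ?oner_eq0//;
      apply/eqP; rewrite eq_complex /=; apply/andP; split; apply/eqP; ring.
  rewrite /RI (eq_cI (fun x _ => E1 x)) (eq_cI (fun x _ => E2 x)) cIZ//; ring.
rewrite !cabsM cabs_nat.
rewrite cabs_i.
(* On the segment [x ^+ 2 + r ^+ 2 <= 2 * r ^+ 2], hence [q x >= r^-1]. The integral is at least 2
   and the circulation at least 4, a bound that stands in for its exact modulus 2 pi. *)
have H : r^-1 * (r - - r) <= complex.Re (cI (- r) r (fun x => ((q x)%:C)%C)).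
  apply: Re_cI_ge => // x /andP[x1 x2] /=.
  rewrite /q ler_pdivlMr ?ltr_wpDl ?sqr_ge0 ?exprn_gt0// mulrC ler_pdivrMr//.
  by nra.
have := le_trans (ler_norm _) (normRe_le_cabs (cI (- r) r (fun x => ((q x)%:C)%C))).
move/(le_trans H); have -> : r^-1 * (r - - r) = 2 by field; rewrite gt_eqF.
by move=> ?; lra.
Qed.
End Cauchy.

(** * Cauchy's formula and finite Taylor expansions *)

Section Taylor.
Variable R : realType.
Local Notation C := (complex R).
Implicit Types (f g : C -> C) (r x y : R) (s t : C).
Notation SQ f r := (RI f (- r) r (- r) r).

Lemma eq_SQ f g r : 0 < r -> (forall s, onsq r s -> f s = g s) -> SQ f r = SQ g r.
Proof.
move=> r0 H; have rr : - r <= r by rewrite ge0_cp// ltW.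
have m : - r <= - r <= r by rewrite lexx.
have p : - r <= r <= r by rewrite lexx rr.
rewrite /RI; congr (_ + _ * _); apply: eq_cI => x hx; rewrite !H//.
- by exists x, r; split => //; right; right; right.
- by exists x, (- r); split => //; right; right; left.
- by exists (- r), x; split => //; left.
- by exists r, x; split => //; right; left.
Qed.

Lemma SQB f g r : 0 < r -> (forall s, onsq r s -> differentiable f s) ->
  (forall s, onsq r s -> differentiable g s) ->
  SQ (fun s => f s - g s) r = SQ f r - SQ g r.
Proof.
move=> r0 hf hg; have rr : - r <= r by rewrite ge0_cp// ltW.
by apply: RIB => // x y hx hy hxy; apply: differentiable_ccont; [apply: hf|apply: hg]; exists x, y.
Qed.

Lemma SQZ (k : C) f r : 0 < r -> (forall s, onsq r s -> differentiable f s) ->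
  SQ (fun s => k * f s) r = k * SQ f r.
Proof.
move=> r0 hf; have rr : - r <= r by rewrite ge0_cp// ltW.
by apply: RIZ => // x y hx hy hxy; apply: differentiable_ccont; apply: hf; exists x, y.
Qed.

Lemma eq0_small (x M : R) : 0 <= x -> (forall e, 0 < e -> exists2 e', 0 < e' <= e & x <= M * e') -> x = 0.
Proof.
move=> x0 H; apply/eqP; rewrite eq_le x0 andbT; apply/ler_addgt0Pr => e e0; rewrite add0r.
have M0 : 0 < `|M| + 1 by rewrite ltr_wpDl.
have [e' /andP[e'0 he'] /le_trans] := H (e / (`|M| + 1)) (divr_gt0 e0 M0); apply.
rewrite ler_pdivlMr// in he'; apply: le_trans he'; rewrite mulrC ler_wpM2l ?(ltW e'0)//.
by apply: le_trans (ler_norm _) _; rewrite lerDl.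
Qed.

(** The contour is shrunk to a square of half-side [e] about [p], where the integral is at most
    [16 * M * e]. *)
Lemma SQ_removable f (p : C) (M d r : R) : 0 < r -> cabs p <= r / 2 -> 0 < d ->
  (forall s, cabs s <= 2 * r -> s != p -> differentiable f s) ->
  (forall s, cabs (s - p) <= d -> s != p -> cabs (f s) <= M) ->
  SQ f r = 0.
Proof.
move=> r0 pr d0 df fM; apply/eqP; rewrite -cabs_eq0; apply/eqP.
apply: (@eq0_small _ (16 * M)); first exact: cabs_ge0.
move=> e0 e00; pose e := Num.min e0 (Num.min (d / 2) (r / 2)).
have e_gt0 : 0 < e by rewrite !lt_min e00 !divr_gt0.
have ee0 : e <= e0 by rewrite ge_min lexx.
have ed : e <= d / 2 by rewrite !ge_min lexx orbT.
have er : e <= r / 2 by rewrite !ge_min lexx !orbT.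
exists e; first by rewrite e_gt0.
case: p pr df fM => px py pr df fM.
have /ler_normlP[px1 px2] := le_trans (normRe_le_cabs (px +i* py)%C) pr.
have /ler_normlP[py1 py2] := le_trans (normIm_le_cabs (px +i* py)%C) pr.
rewrite /= in px1 px2 py1 py2.
have np x y : x <= px - e \/ px + e <= x \/ y <= py - e \/ py + e <= y ->
    (x +i* y)%C != (px +i* py)%C.
  by move=> H; apply/eqP => -[ex ey]; move: H; rewrite ex ey => -[|[|[|]]]; lra.
rewrite (RI_shrink (a' := px - e) (b' := px + e) (c' := py - e) (d' := py + e)); do ?lra; last first.
  move=> x y /andP[x1 x2] /andP[y1 y2] hxy; apply: df; last exact: np.
  apply: le_trans (cabs_le_ReIm _) _; rewrite /= mulr_natl mulr2n.
  by apply: lerD; rewrite ler_norml; apply/andP; split.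
have -> : 16 * M * e = 4 * M * ((px + e - (px - e)) + (py + e - (py - e))) by ring.
apply: RI_le; do ?lra.
  move=> x y /andP[x1 x2] /andP[y1 y2] hxy; apply: differentiable_ccont; apply: df.
    apply: le_trans (cabs_le_ReIm _) _; rewrite /= mulr_natl mulr2n.
    by apply: lerD; rewrite ler_norml; apply/andP; split; lra.
  by apply: np; case: hxy => [->|[->|[->|->]]]; [left|right; left|right; right; left|right; right; right].
move=> x y /andP[x1 x2] /andP[y1 y2] hxy; apply: fM; last first.
  by apply: np; case: hxy => [->|[->|[->|->]]]; [left|right; left|right; right; left|right; right; right].
apply: le_trans (cabs_le_ReIm _) _; rewrite /= (splitr d).
by apply: lerD; rewrite ler_norml; apply/andP; split; lra.
Qed.

Lemma onsq_neq r t s : 0 < r -> cabs t <= r / 2 -> onsq r s ->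
  [/\ s != 0, s - t != 0 & r / 2 <= cabs (s - t)].
Proof.
move=> r0 tr /(onsq_le r0)/andP[rs _].
have H : r / 2 <= cabs (s - t).
  by have := cabsD (s - t) t; rewrite subrK => h; lra.
by split => //; rewrite -cabs_gt0; lra.
Qed.

Lemma differentiable_cauchy_kernel t n s : s != 0 -> s - t != 0 ->
  differentiable (fun s : C => (s ^+ n * (s - t))^-1) s.
Proof.
move=> s0 st; apply: differentiable_funV; last by rewrite mulf_neq0// expf_neq0.
apply: differentiable_funM; last exact: differentiable_sub.
by apply: differentiable_funX; exact: differentiable_fun_id.
Qed.

(** The integrands differ by t / (s (s - t)), which is O(L^-2) on the square of half-side [L], whose
    perimeter is O(L). The contour can be pushed outwards, so the difference of the integrals is
    0. *)
Lemma SQ_winding r t : 0 < r -> cabs t <= r / 2 ->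
  SQ (fun s => (s - t)^-1) r = SQ (fun s => s^-1) r.
Proof.
move=> r0 tr; apply/eqP; rewrite -subr_eq0 -SQB; [|exact: r0| |].
- pose g s := (s ^+ 1 * (s - t))^-1.
  rewrite (@eq_SQ _ (fun s => t * g s))// => [|s hs]; last first.
    have [s0 st _] := onsq_neq r0 tr hs; rewrite /g expr1; field.
    by rewrite s0 st.
  have dg s : s != 0 -> s - t != 0 -> differentiable g s by exact: differentiable_cauchy_kernel.
  rewrite SQZ; [|exact: r0|move=> s hs]; last first.
    by have [s0 st _] := onsq_neq r0 tr hs; apply: dg.
  suff -> : SQ g r = 0 by rewrite mulr0.
  apply/eqP; rewrite -cabs_eq0; apply/eqP; apply: (@eq0_small _ 32); first exact: cabs_ge0.
  move=> e e0; pose L := r + e^-1.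
  have ei : 0 < e^-1 by rewrite invr_gt0.
  have rL : r <= L by rewrite lerDl ltW.
  have L0 : 0 < L by rewrite addr_gt0.
  have tL : cabs t <= L / 2 by lra.
  exists L^-1.
    rewrite invr_gt0 L0 -[leRHS]invrK lef_pV2 ?posrE//.
    by rewrite lerDr ltW.
  rewrite -(@SQ_shrink _ g r L); [|exact: r0|exact: rL|move=> s /andP[rs _]]; last first.
    have := cabsD (s - t) t; rewrite subrK => h.
    by apply: dg; rewrite -cabs_gt0; lra.
  have -> : 32 * L^-1 = 16 * (L * (L / 2))^-1 * L by field; rewrite gt_eqF.
  apply: SQ_le => // s hs; have [s0 st h] := onsq_neq L0 tL hs; split.
    by apply: differentiable_ccont; apply: dg.
  have p1 : 0 < L * (L / 2) by rewrite mulr_gt0// divr_gt0.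
  have p2 : 0 < cabs s * cabs (s - t) by rewrite mulr_gt0// cabs_gt0.
  rewrite /g expr1 cabsV cabsM lef_pV2 ?posrE//.
  have /andP[Ls _] := onsq_le L0 hs.
  by apply: ler_pM => //; rewrite ?divr_ge0// ltW.
- move=> s hs; have [s0 st _] := onsq_neq r0 tr hs.
  by apply: differentiable_funV => //; exact: differentiable_sub.
- move=> s hs; have [s0 st _] := onsq_neq r0 tr hs.
  by apply: differentiable_funV => //; exact: differentiable_fun_id.
Qed.

(** The circulation of 1/s takes the place of 2 pi i. After [SQ_winding] the difference of the two
    sides is the integral of (f s - f t) / (s - t), which is bounded near [t] and thus falls under
    [SQ_removable]. *)
Lemma cauchy_formula f r t : 0 < r -> cabs t <= r / 2 ->
  (forall s, cabs s <= 2 * r -> differentiable f s) ->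
  SQ (fun s => f s * (s - t)^-1) r = f t * SQ (fun s => s^-1) r.
Proof.
move=> r0 tr df; have dfsq s : onsq r s -> differentiable f s.
  by move=> /(onsq_le r0)/andP[_]; exact: df.
rewrite -(SQ_winding r0 tr) -SQZ; [|exact: r0|move=> s hs]; last first.
  have [s0 st _] := onsq_neq r0 tr hs.
  by apply: differentiable_funV => //; exact: differentiable_sub.
apply/eqP; rewrite -subr_eq0 -SQB; [|exact: r0| |].
- rewrite (@eq_SQ _ (fun s => (f s - f t) * (s - t)^-1))// => [|s hs]; last by rewrite mulrBl.
  have dft : differentiable f t by apply: df; lra.
  have [k H] := (diff_epsdelta f t).1 dft; have [d [d0 {}H]] := H 1 ltr01.
  apply/eqP; apply: (@SQ_removable _ t (cabs k + 1) d r r0 tr d0).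
    move=> s sr st; apply: differentiable_funM.
      by apply: differentiable_funB; [exact: df|exact: differentiable_funC].
    by apply: differentiable_funV; [exact: differentiable_sub|rewrite subr_eq0].
  move=> s /H {}H st; rewrite cabsM cabsV ler_pdivrMr ?cabs_gt0 ?subr_eq0//.
  rewrite -[f s - f t](subrK (k * (s - t))) (le_trans (cabsD _ _))// cabsM mulrDl addrC.
  by rewrite lerD2l.
- move=> s hs; have [s0 st _] := onsq_neq r0 tr hs; apply: differentiable_funM; first exact: dfsq.
  by apply: differentiable_funV => //; exact: differentiable_sub.
- move=> s hs; have [s0 st _] := onsq_neq r0 tr hs; apply: differentiable_funM; first exact: differentiable_funC.
  by apply: differentiable_funV => //; exact: differentiable_sub.
Qed.

(** The coefficients are Cauchy integrals and the expansion is finite with exact remainder. The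
    remainder integral is at most 16 r M / (r^n r / 2) = 32 M / r^n, and division by the
    circulation, at least 4, gives the constant 8. *)
Theorem taylor f r M : 0 < r ->
  (forall s, cabs s <= 2 * r -> differentiable f s) ->
  (forall s, r <= cabs s <= 2 * r -> cabs (f s) <= M) ->
  exists a : nat -> C, forall n t, cabs t <= r / 2 ->
    cabs (f t - \sum_(k < n) a k * t ^+ k) <= 8 * M * (cabs t / r) ^+ n.
Proof.
move=> r0 df fM; have dfsq s : onsq r s -> differentiable f s.
  by move=> /(onsq_le r0)/andP[_]; exact: df.
pose W := SQ (fun s => s^-1) r; have W4 : 4 <= cabs W by exact: SQ_inv_ge.
have W0 : W != 0 by rewrite -cabs_gt0; exact: lt_le_trans W4.
pose A k := SQ (fun s => f s * (s ^+ k.+1)^-1) r.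
pose Q n t := SQ (fun s => f s * (s ^+ n * (s - t))^-1) r.
have dA k s : onsq r s -> differentiable (fun s => f s * (s ^+ k.+1)^-1) s.
  move=> hs; have [s0 _ _] := onsq_neq r0 (t := 0) (ltac:(by rewrite cabs0 divr_ge0// ltW)) hs.
  apply: differentiable_funM; first exact: dfsq.
  apply: differentiable_funV; last by rewrite expf_neq0.
  by apply: differentiable_funX; exact: differentiable_fun_id.
have dQ n t s : cabs t <= r / 2 -> onsq r s -> differentiable (fun s => f s * (s ^+ n * (s - t))^-1) s.
  move=> tr hs; have [s0 st _] := onsq_neq r0 tr hs.
  by apply: differentiable_funM; [exact: dfsq|exact: differentiable_cauchy_kernel].
(* One step of the geometric series: 1 / (s^n (s - t)) = 1 / s^(n+1) + t / (s^(n+1) (s - t)). *)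
have QS n t : cabs t <= r / 2 -> Q n t = A n + t * Q n.+1 t.
  move=> tr; apply/eqP; rewrite -subr_eq; rewrite /Q /A -SQZ; [|exact: r0|by move=> s hs; exact: dQ].
  rewrite -SQB; [|exact: r0|by move=> s hs; exact: dQ|move=> s hs]; last first.
    by apply: differentiable_funM; [exact: differentiable_funC|exact: dQ].
  apply/eqP; apply: eq_SQ => // s hs; have [s0 st _] := onsq_neq r0 tr hs.
  by rewrite !exprS; field; rewrite st s0 expf_neq0.
exists (fun k => A k / W) => n t tr.
have E : f t * W = \sum_(k < n) A k * t ^+ k + t ^+ n * Q n t.
  elim: n => [|n IH]; last first.
    by rewrite IH big_ord_recr /= (QS _ _ tr) mulrDr addrA mulrA -exprSr [A n * _]mulrC.
  rewrite big_ord0 add0r expr0 mul1r /W -(cauchy_formula r0 tr df); apply: eq_SQ => // s _.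
  by rewrite expr0 mul1r.
have -> : f t - \sum_(k < n) A k / W * t ^+ k = t ^+ n * Q n t / W.
  apply: (mulIf W0); rewrite mulrBl E mulfVK// big_distrl /=.
  rewrite [X in _ - X](eq_bigr (fun k : 'I_n => A k * t ^+ k)); first by rewrite addrC addKr.
  by move=> k _; rewrite mulrAC mulfVK.
rewrite cabsM cabsV ler_pdivrMr; last exact: lt_le_trans W4.
have HQ : cabs (Q n t) <= 16 * (M / (r ^+ n * (r / 2))) * r.
  apply: SQ_le => // s hs; split; first by apply: differentiable_ccont; apply: dQ.
  have [s0 st h] := onsq_neq r0 tr hs; have hs2 := onsq_le r0 hs; have /andP[rs _] := hs2.
  have h1 := fM _ hs2.
  rewrite cabsM cabsV; apply: ler_pM; rewrite ?invr_ge0 ?cabs_ge0//.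
  have p1 : 0 < r ^+ n * (r / 2) by rewrite mulr_gt0 ?exprn_gt0 ?divr_gt0.
  have p2 : 0 < cabs (s ^+ n * (s - t)) by rewrite cabs_gt0 mulf_neq0 ?expf_neq0.
  rewrite lef_pV2 ?posrE// cabsM cabsX; apply: ler_pM => //; rewrite ?exprn_ge0 ?divr_ge0 ?(ltW r0)//.
  by rewrite lerXn2r ?nnegrE ?cabs_ge0 ?(ltW r0).
rewrite cabsM cabsX; apply: le_trans (ler_wpM2l (exprn_ge0 _ (cabs_ge0 _)) HQ) _.
have -> : cabs t ^+ n * (16 * (M / (r ^+ n * (r / 2))) * r) = 8 * M * (cabs t / r) ^+ n * 4.
  by rewrite expr_div_n; field; rewrite expf_neq0 ?(gt_eqF r0).
rewrite ler_wpM2l// !mulr_ge0 ?exprn_ge0 ?divr_ge0 ?cabs_ge0 ?(ltW r0)//.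
have hr : onsq r (r +i* 0)%C.
  by exists r, 0; split => //; rewrite ?lexx ?oppr_le0 ?ge0_cp ?(ltW r0)//; right; left.
exact: le_trans (cabs_ge0 _) (fM _ (onsq_le r0 hr)).
Qed.
End Taylor.

(** * Identity principle, vanishing by symmetry, and division by a function *)

Section OneVar.
Variable R : realType.
Local Notation C := (complex R).
Implicit Types (f g : C -> C) (r x y : R) (s t : C).

(** A maximum principle up to the constant 8: the Taylor estimate with no terms, at the centre. *)
Lemma center_bound f r M : 0 < r ->
  (forall s, cabs s <= 2 * r -> differentiable f s) ->
  (forall s, r <= cabs s <= 2 * r -> cabs (f s) <= M) ->
  cabs (f 0) <= 8 * M.
Proof.
move=> r0 df fM; have [a Ha] := taylor r0 df fM.
have := Ha 0%N 0; rewrite cabs0 big_ord0 subr0 expr0 mulr1; apply.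
by rewrite divr_ge0// ltW.
Qed.

(** If [x > y > 0], the powers of [x / y] grow at least linearly by Bernoulli's inequality and
    cannot stay below [b / a]. This is how constants disappear from bounds valid for all powers. *)
Lemma pow_cancel (a b x y : R) : 0 < a -> 0 <= x -> 0 <= y ->
  (forall n, x ^+ n * a <= b * y ^+ n) -> x <= y.
Proof.
move=> a0 x0 y0 H; rewrite leNgt; apply/negP => yx.
have [y_eq0|y_neq0] := eqVneq y 0.
  have := H 1%N; rewrite y_eq0 !expr1 mulr0 leNgt mulr_gt0//.
  by rewrite -y_eq0.
have y_gt0 : 0 < y by rewrite lt_def y_neq0.
pose q := x / y; have q1 : 1 < q by rewrite ltr_pdivlMr// mul1r.
have Hq n : q ^+ n <= b / a.
  rewrite /q expr_div_n ler_pdivrMr ?exprn_gt0// mulrAC ler_pdivlMr//.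
have Bern n : 1 + n%:R * (q - 1) <= q ^+ n.
  elim: n => [|n IH]; first by rewrite mul0r addr0 expr0.
  rewrite exprS; apply: le_trans (ler_wpM2l _ IH); last by rewrite ltW// (lt_trans ltr01).
  rewrite -natr1 -subr_ge0; set u : R := n%:R.
  have -> : q * (1 + u * (q - 1)) - (1 + (u + 1) * (q - 1)) = u * (q - 1) ^+ 2 by ring.
  by rewrite mulr_ge0 ?sqr_ge0 ?ler0n.
have q10 : 0 < q - 1 by rewrite subr_gt0.
have [n hn] : exists n : nat, b / a / (q - 1) <= n%:R.
  have := archi_boundP (normr_ge0 (b / a / (q - 1))).
  by move=> /ltW h; eexists; exact: le_trans (ler_norm _) h.
have := le_trans (Bern n) (Hq n); rewrite ler_pdivrMr// in hn.
by move=> h; have := le_trans h hn; rewrite gerDr ler10.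
Qed.

Lemma taylor_coef0 (a : nat -> C) (d r M : R) : 0 < d -> 0 < r ->
  (forall n t, cabs t <= d -> cabs (\sum_(k < n) a k * t ^+ k) <= M * (cabs t / r) ^+ n) ->
  forall k, a k = 0.
Proof.
move=> d0 r0 H k; have [n] := ubnP k; elim: n k => // n IH k; rewrite ltnS => kn.
have a0 j : (j < k)%N -> a j = 0 by move=> jk; apply: IH; exact: leq_trans jk kn.
apply/eqP; rewrite -cabs_eq0; apply/eqP.
apply: (@eq0_small _ _ (M / r ^+ k.+1)); first exact: cabs_ge0.
move=> e e0; pose e' := Num.min e d; have e'0 : 0 < e' by rewrite lt_min e0.
exists e'; first by rewrite e'0 ge_min lexx.
have ce' : cabs (e'%:C)%C = e' by rewrite cabsR ger0_norm// ltW.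
have := H k.+1 (e'%:C)%C; rewrite ce' ge_min lexx orbT => /(_ isT).
rewrite big_ord_recr /= big1 => [|i _]; last by rewrite a0// mul0r.
rewrite add0r cabsM cabsX ce' expr_div_n => h.
have : cabs (a k) * e' ^+ k <= M / r ^+ k.+1 * e' * e' ^+ k.
  apply: le_trans h _; rewrite [e' ^+ k.+1]exprS le_eqVlt; apply/orP; left; apply/eqP; ring.
by rewrite ler_pM2r// exprn_gt0.
Qed.

(** All Taylor coefficients vanish, so the remainder estimate leaves [cabs (f s) <= 8 * M / 2 ^+ n]
    for every [n]. *)
Lemma identity_disc f r M d : 0 < r -> 0 < d ->
  (forall s, cabs s <= 2 * r -> differentiable f s) ->
  (forall s, r <= cabs s <= 2 * r -> cabs (f s) <= M) ->
  (forall s, cabs s <= d -> f s = 0) ->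
  forall s, cabs s <= r / 2 -> f s = 0.
Proof.
move=> r0 d0 df fM f0 s sr; have [a Ha] := taylor r0 df fM.
have a0 : forall k, a k = 0.
  apply: (@taylor_coef0 _ (Num.min d (r / 2)) r (8 * M)) => //.
    by rewrite lt_min d0 divr_gt0.
  move=> n t; rewrite le_min => /andP[td tr]; have := Ha n t tr.
  by rewrite f0// sub0r cabsN.
have H n : cabs (f s) * 2 ^+ n <= 8 * M * 1 ^+ n.
  have := Ha n s sr; rewrite big1 => [|i _]; last by rewrite a0 mul0r.
  rewrite subr0 expr1n mulr1 -ler_pdivlMr ?exprn_gt0// => /le_trans; apply.
  have M0 : 0 <= 8 * M by apply: le_trans (cabs_ge0 (f 0)) (center_bound r0 df fM).
  rewrite ler_wpM2l// -exprVn lerXn2r ?nnegrE ?divr_ge0 ?cabs_ge0 ?(ltW r0)//.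
  by rewrite ler_pdivrMr// mulrC.
apply/eqP; rewrite -cabs_eq0; apply: contraT => fs0.
have /pow_cancel : forall n, 2 ^+ n * cabs (f s) <= 8 * M * 1 ^+ n.
  by move=> n; rewrite mulrC; exact: H.
move=> /(_ (ltac:(by rewrite lt_def fs0 cabs_ge0)) (ltac:(done)) (ltac:(done))).
by rewrite (ler_nat R 2 1).
Qed.

(** Multiplication by an element [w0] permutes [Om], so the sum is unchanged when multiplied by
    [w0 ^+ j]. Some [w0] has [w0 ^+ j != 1], as otherwise X^j - 1 would have more than [j] roots. *)
Lemma power_sum0 (Om : seq C) j : uniq Om -> (forall w, w \in Om -> w != 0) ->
  (forall w w', w \in Om -> w' \in Om -> w * w' \in Om) ->
  (0 < j < size Om)%N -> \sum_(w <- Om) w ^+ j = 0.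
Proof.
move=> uOm nz cl /andP[j0 jm].
have [w0 w0Om w0j] : exists2 w0, w0 \in Om & w0 ^+ j != 1.
  apply: contrapT => nex; move: jm; rewrite ltnNge => /negP; apply.
  apply: max_unity_roots => //; apply/allP => w wOm.
  by apply/unity_rootP; apply: contrapT => h; apply: nex; exists w => //; apply/eqP.
have pe : perm_eq [seq w0 * w | w <- Om] Om.
  have um : uniq [seq w0 * w | w <- Om] by rewrite map_inj_uniq//; exact: mulfI (nz _ w0Om).
  apply: uniq_perm => //.
  have [] := uniq_min_size um (s2 := Om) _ _ => //.
  - by move=> _ /mapP[w wOm ->]; apply: cl.
  - by rewrite size_map.
have E : w0 ^+ j * \sum_(w <- Om) w ^+ j = \sum_(w <- Om) w ^+ j.
  rewrite -[RHS](perm_big _ pe) big_map big_distrr /=.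
  by apply: eq_bigr => w _; rewrite exprMn.
apply/eqP; have : (w0 ^+ j - 1) * \sum_(w <- Om) w ^+ j == 0.
  by rewrite mulrBl mul1r E subrr.
by rewrite mulf_eq0 subr_eq0 (negPf w0j).
Qed.

(** Averaging w f(w s) over [Om] returns f(s) and multiplies the k-th Taylor term by the mean of the
    w^(k+1). By [power_sum0] this kills the terms with 0 < k+1 < |Om|, so the remainder of order
    |Om| - 1 is all that is left. *)
Lemma symmetric_vanishing f r M (Om : seq C) : 0 < r ->
  (forall s, cabs s <= 2 * r -> differentiable f s) ->
  (forall s, r <= cabs s <= 2 * r -> cabs (f s) <= M) ->
  uniq Om -> (forall w, w \in Om -> cabs w = 1) ->
  (forall w w', w \in Om -> w' \in Om -> w * w' \in Om) -> (0 < size Om)%N ->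
  (forall w s, w \in Om -> cabs s <= r / 2 -> w * f (w * s) = f s) ->
  forall s, cabs s <= r / 2 -> cabs (f s) <= 8 * M * (cabs s / r) ^+ (size Om).-1.
Proof.
move=> r0 df fM uOm w1 cl m0 fw s sr; have [a Ha] := taylor r0 df fM.
set n := (size Om).-1.
pose rho t := f t - \sum_(k < n) a k * t ^+ k.
have E : (size Om)%:R * f s = \sum_(w <- Om) w * rho (w * s).
  have -> : \sum_(w <- Om) w * rho (w * s) =
      \sum_(w <- Om) (w * f (w * s)) - \sum_(w <- Om) w * (\sum_(k < n) a k * (w * s) ^+ k).
    by rewrite -sumrB; apply: eq_bigr => w _; rewrite /rho mulrBr.
  rewrite [X in _ - X](_ : _ = 0) ?subr0; last first.
    under eq_bigr do rewrite big_distrr /=.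
    rewrite exchange_big /= big1// => k _.
    have -> : \sum_(w <- Om) w * (a k * (w * s) ^+ k) =
        a k * s ^+ k * \sum_(w <- Om) w ^+ k.+1.
      by rewrite big_distrr /=; apply: eq_bigr => w _; rewrite exprMn exprS; ring.
    rewrite power_sum0 ?mulr0//; last by rewrite /= -[size Om]prednK// ltnS ltn_ord.
    by move=> w /w1 h; rewrite -cabs_gt0 h.
  rewrite (eq_big_seq (fun=> f s)) => [|w wOm]; last exact: fw.
  by rewrite big_const_seq count_predT iter_addr_0 mulr_natl.
have mp : 0 < (size Om)%:R :> R by rewrite ltr0n.
have Ec : (size Om)%:R * cabs (f s) = cabs (\sum_(w <- Om) w * rho (w * s)).
  by rewrite -E cabsM cabs_nat.
rewrite -(ler_pM2l mp) Ec.
apply: le_trans (cabs_sum _ _ _) _; rewrite big_seq.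
apply: le_trans (_ : \sum_(w <- Om | w \in Om) 8 * M * (cabs s / r) ^+ n <= _).
  apply: ler_sum => w wOm; rewrite cabsM w1// mul1r.
  have ws : cabs (w * s) = cabs s by rewrite cabsM w1// mul1r.
  by rewrite -ws; apply: Ha; rewrite ws.
by rewrite -big_seq big_const_seq count_predT iter_addr_0 -[leLHS]mulr_natl lexx.
Qed.

(* If |f| <= c |P| near each zero of P, then f / P is bounded; multiplying its N-th power by the square of a
   polynomial vanishing at these zeros gives a function differentiable everywhere, and N -> oo removes the factor. *)
Lemma quotient_center_bound f (P : C -> C) (ts : seq C) r M : 0 < r -> 0 <= M ->
  (forall s, cabs s <= 2 * r -> differentiable f s) ->
  (forall s, cabs s <= 2 * r -> differentiable P s) ->
  (forall s, cabs s <= 2 * r -> P s = 0 <-> s \in ts) ->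
  (forall s, cabs s <= 2 * r -> s \in ts -> exists d c, 0 < d /\
     forall u, cabs (u - s) <= d -> cabs (f u) <= c * cabs (P u)) ->
  (forall s, r <= cabs s <= 2 * r -> P s != 0 /\ cabs (f s) <= M * cabs (P s)) ->
  cabs (f 0) <= M * cabs (P 0).
Proof.
move=> r0 M0 df dP Pts loc fM.
have c02 : cabs (0 : C) <= 2 * r by rewrite cabs0 mulr_ge0// ltW.
have [P0|P0] := eqVneq (P 0) 0.
  have [d [c [d0 H]]] := loc 0 c02 ((Pts 0 c02).1 P0).
  by have := H 0; rewrite subrr cabs0 P0 cabs0 !mulr0; apply; exact: ltW.
pose Z u := \prod_(s <- ts) (u - s).
(* At the zeros of [P] the quotient is 0 by the convention for the inverse of 0, which keeps [q]
   bounded there. *)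
pose q u := f u * (P u)^-1.
pose g N u := q u ^+ N * Z u ^+ 2.
have dprod (l : seq C) t : differentiable (fun u => \prod_(s <- l) (u - s)) t.
  by apply: differentiable_big_prod => s; exact: differentiable_sub.
have dg N s : cabs s <= 2 * r -> differentiable (g N) s.
  move=> sr; have [sts|sts] := boolP (s \in ts); last first.
    have Ps : P s != 0 by apply/eqP => /(Pts s sr).1; rewrite (negPf sts).
    apply: differentiable_funM; apply: differentiable_funX; last exact: dprod.
    by apply: differentiable_funM; [exact: df|apply: differentiable_funV; [exact: dP|]].
  have [d [c [d0 H]]] := loc s sr sts.
  pose Z' u := \prod_(i <- rem s ts) (u - i).
  have ZE u : Z u = (u - s) * Z' u by rewrite /Z (perm_big _ (perm_to_rem sts)) big_cons.
  have [d' [d'0 H']] := differentiable_ccont (dprod (rem s ts) s) ltr01.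
  (* Near a zero [s] of [P] the factor [q] is bounded and [Z] contains [u - s], so [g N] is of the
     order of (u - s)^2 and has derivative 0 at [s]. *)
  apply/diff_epsdelta; exists 0 => e e0.
  pose B := `|c| ^+ N * (cabs (Z' s) + 1) ^+ 2 + 1.
  have B0 : 0 < B by rewrite ltr_wpDl// mulr_ge0 ?exprn_ge0// addr_ge0 ?cabs_ge0.
  exists (Num.min (Num.min d d') (e / B)); split; first by rewrite !lt_min d0 d'0 divr_gt0.
  move=> u; rewrite !le_min => /andP[/andP[/H {}H /H' {}H'] ue].
  have -> : g N s = 0 by rewrite /g ZE subrr mul0r expr0n mulr0.
  rewrite mul0r !subr0.
  have -> : cabs (g N u) = cabs (q u) ^+ N * (cabs (u - s) ^+ 2 * cabs (Z' u) ^+ 2).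
    by rewrite /g cabsM (cabsX (q u)) (cabsX (Z u)) ZE (cabsM (u - s)) exprMn.
  have Z'u : cabs (Z' u) <= cabs (Z' s) + 1.
    by rewrite -[Z' u](subrK (Z' s)) addrC (le_trans (cabsD _ _))// lerD2l.
  have qu : cabs (q u) <= `|c|.
    rewrite /q cabsM; have [->|Pu] := eqVneq (P u) 0; first by rewrite invr0 cabs0 mulr0.
    rewrite cabsV ler_pdivrMr ?cabs_gt0//; apply: le_trans H _.
    by rewrite ler_wpM2r ?cabs_ge0// ler_norm.
  have : cabs (q u) ^+ N * (cabs (u - s) ^+ 2 * cabs (Z' u) ^+ 2) <= B * cabs (u - s) ^+ 2.
    rewrite mulrCA mulrC ler_wpM2r ?sqr_ge0//; apply: le_trans (_ : `|c| ^+ N * (cabs (Z' s) + 1) ^+ 2 <= _).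
      by apply: ler_pM; rewrite ?exprn_ge0 ?cabs_ge0 // lerXn2r ?nnegrE ?addr_ge0 ?cabs_ge0.
    by rewrite lerDl.
  move/le_trans; apply; rewrite expr2 mulrA ler_wpM2r ?cabs_ge0// mulrC.
  by rewrite -ler_pdivlMr.
have Z0 : Z 0 != 0.
  rewrite /Z prodf_seq_neq0; apply/allP => s sts; rewrite sub0r oppr_eq0 /=.
  by apply: contraTneq sts => ->; apply: contraNN P0 => /(Pts 0 c02).2 ->.
pose ZM := \prod_(s <- ts) (2 * r + cabs s).
have ZMu u : cabs u <= 2 * r -> cabs (Z u) <= ZM.
  move=> ur; rewrite /Z cabs_prod /ZM; elim: (ts) => [|s l IH]; first by rewrite !big_nil.
  rewrite !big_cons; apply: ler_pM; rewrite ?cabs_ge0 ?prodr_ge0//.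
    by move=> i _; exact: cabs_ge0.
  by apply: le_trans (cabsD _ _) _; rewrite cabsN lerD2r.
have key N : (cabs (q 0)) ^+ N * cabs (Z 0) ^+ 2 <= 8 * ZM ^+ 2 * M ^+ N.
  rewrite -!cabsX -cabsM -mulrA; apply: (center_bound (f := g N) r0); first exact: dg.
  move=> s sr; have [Ps fs] := fM s sr; case/andP: sr => _ sr.
  rewrite /g cabsM !cabsX mulrC; apply: ler_pM; rewrite ?exprn_ge0 ?cabs_ge0//.
    rewrite lerXn2r ?nnegrE ?cabs_ge0 ?ZMu//.
    exact: le_trans (cabs_ge0 _) (ZMu s sr).
  by rewrite lerXn2r ?nnegrE ?cabs_ge0// /q cabsM cabsV ler_pdivrMr ?cabs_gt0.
have := pow_cancel _ (cabs_ge0 _) M0 key.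
rewrite exprn_gt0 ?cabs_gt0// => /(_ isT).
by rewrite /q cabsM cabsV ler_pdivrMr ?cabs_gt0.
Qed.
End OneVar.

(** * Vanishing of skew-invariant functions along mirrors *)

Section Vtop.
Variable R : realType.
Local Notation C := (complex R).
Local Notation V := 'cV[C]_2.
Implicit Types (v w z e : V) (t : C).

Lemma cV2P v w : v 0 0 = w 0 0 -> v 1 0 = w 1 0 -> v = w.
Proof.
move=> h0 h1; apply/matrixP => i j; rewrite (ord1 j).
by case/orP: (orbN (i == 0)) => [/eqP ->//|i0]; have -> : i = 1 by case: i i0 => [[|[|]]]// ? ?; exact: val_inj.
Qed.

(* The norm of the library on C^2 takes its values in C. *)
Definition vn v : R := cabs (v 0 0) + cabs (v 1 0).

Lemma cabs_le_vn v i : cabs (v i 0) <= vn v.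
Proof.
case/orP: (orbN (i == 0)) => [/eqP ->|i0]; first by rewrite lerDl cabs_ge0.
have -> : i = 1 by case: i i0 => [[|[|]]]// ? ?; exact: val_inj.
by rewrite lerDr cabs_ge0.
Qed.

Lemma vn_ge0 v : 0 <= vn v.
Proof. by rewrite addr_ge0 ?cabs_ge0. Qed.

Lemma vnD v w : vn (v + w) <= vn v + vn w.
Proof. by rewrite /vn !mxE addrACA lerD ?cabsD. Qed.

Lemma vnN v : vn (- v) = vn v.
Proof. by rewrite /vn !mxE !cabsN. Qed.

Lemma vnB v w : vn (v - w) = vn (w - v).
Proof. by rewrite -vnN opprB. Qed.

Lemma vnZ t v : vn (t *: v) = cabs t * vn v.
Proof. by rewrite /vn !mxE !cabsM mulrDr. Qed.

Lemma vn0 : vn 0 = 0.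
Proof. by rewrite /vn !mxE cabs0 addr0. Qed.

Lemma nbhsV z (P : set V) : (\forall v \near z, P v) <->
  exists d : R, 0 < d /\ forall v, vn (v - z) <= d -> P v.
Proof.
split.
  move=> /nbhs_ballP[e /= /cltE[r r0 ->]] H; exists (r / 2); rewrite divr_gt0//; split => // v vd.
  apply: H; split; [by rewrite ltcR|move=> i j]; rewrite (ord1 j) -ball_normE /= -cabsE ltcR cabsB.
  have r2 : r / 2 < r by rewrite ltr_pdivrMr// ltr_pMr// ltr1n.
  apply: le_lt_trans r2; apply: le_trans vd.
  by have := cabs_le_vn (v - z) i; rewrite !mxE.
move=> [d [d0 H]]; apply/nbhs_ballP; exists ((d / 2)%:C)%C => /=; first by rewrite ltcR divr_gt0.
move=> v hv; apply: H; rewrite /vn !mxE (splitr d).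
have h i : cabs (v i 0 - z i 0) <= d / 2.
  by have := hv.2 i 0; rewrite -ball_normE /= -cabsE ltcR cabsB => /ltW.
by apply: lerD; exact: h.
Qed.

Lemma nbhsVV (q : V * V) (P : set (V * V)) : (\forall x \near q, P x) <->
  exists d : R, 0 < d /\ forall v w, vn (v - q.1) <= d -> vn (w - q.2) <= d -> P (v, w).
Proof.
split.
  move=> [[A B] /= [/nbhsV[d1 [d10 H1]] /nbhsV[d2 [d20 H2]]] AB].
  exists (Num.min d1 d2); split; first by rewrite lt_min d10.
  move=> v w; rewrite !le_min => /andP[/H1 Av _] /andP[_ /H2 Bw].
  exact: (AB (v, w)).
move=> [d [d0 H]]; exists ([set v | vn (v - q.1) <= d], [set v | vn (v - q.2) <= d]).
  by split; apply/nbhsV; exists d.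
by move=> [v w] [] /=; exact: H.
Qed.

Lemma open_vn (A : set V) z : open A -> A z ->
  exists d : R, 0 < d /\ forall v, vn (v - z) <= d -> A v.
Proof. by move=> oA Az; apply/nbhsV; exact: open_nbhs_nbhs. Qed.

Lemma closure_vn (A : set V) z (d : R) : closure A z -> 0 < d ->
  exists2 a, A a & vn (a - z) <= d.
Proof.
move=> clA d0; have /clA[a [Aa ad]] : \forall v \near z, vn (v - z) <= d by apply/nbhsV; exists d.
by exists a.
Qed.

Lemma differentiable_vn_bounded (F : V * V -> C) (q : V * V) : differentiable F q ->
  exists d : R, 0 < d /\ forall v w, vn (v - q.1) <= d -> vn (w - q.2) <= d ->
    cabs (F (v, w)) <= cabs (F q) + 1.
Proof.
move=> /differentiable_continuous /cvgrPdist_le /(_ 1 ltr01) /nbhsVV[d [d0 H]].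
exists d; split => // v w hv hw; have := H v w hv hw.
rewrite -cabsE (lecR _ 1) cabsB => h; rewrite -[F (v, w)](subrK (F q)) addrC.
by rewrite (le_trans (cabsD _ _))// lerD2l.
Qed.

Lemma differentiable_lineV (F : V -> C) (p u : V) t : differentiable F (p + t *: u) ->
  differentiable (fun s : C => F (p + s *: u)) t.
Proof.
move=> h; apply: (@differentiable_comp _ _ _ _ (fun s : C => p + s *: u) F) => //.
Qed.

Lemma differentiable_lineVV (F : V * V -> C) (p u : V * V) t :
  differentiable F (p.1 + t *: u.1, p.2 + t *: u.2) ->
  differentiable (fun s : C => F (p.1 + s *: u.1, p.2 + s *: u.2)) t.
Proof.
move=> h; apply: (@differentiable_comp _ _ _ _ (fun s : C => (p.1 + s *: u.1, p.2 + s *: u.2)) F) => //.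
Qed.

Lemma hprodE z e : hprod z e = z 0 0 * (e 0 0)^* + z 1 0 * (e 1 0)^*.
Proof.
rewrite /hprod big_ord_recl big_ord1; congr (_ + z _ _ * (e _ _)^*); exact: val_inj.
Qed.

Lemma hprodD z w e : hprod (z + w) e = hprod z e + hprod w e.
Proof. by rewrite !hprodE !mxE; ring. Qed.

Lemma hprodZ t z e : hprod (t *: z) e = t * hprod z e.
Proof. by rewrite !hprodE !mxE; ring. Qed.

Lemma hprodN z e : hprod (- z) e = - hprod z e.
Proof. by rewrite -scaleN1r hprodZ mulN1r. Qed.

Lemma hprodB z w e : hprod (z - w) e = hprod z e - hprod w e.
Proof. by rewrite hprodD hprodN. Qed.

Lemma hprod_unit_le e : hprod e e = 1 -> cabs (e 0 0) <= 1 /\ cabs (e 1 0) <= 1.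
Proof.
have E (x : C) : x * x^* = ((cabs x ^+ 2)%:C)%C by rewrite -normCK -cabsE rmorphXn.
rewrite hprodE !E -rmorphD => /(@complexI R _ 1) h.
have g0 := sqr_ge0 (cabs (e 0 0)); have g1 := sqr_ge0 (cabs (e 1 0)).
by split; rewrite -(@ler_pXn2r _ 2)// ?nnegrE ?cabs_ge0// expr1n; lra.
Qed.

Lemma cabs_hprod_le z e : hprod e e = 1 -> cabs (hprod z e) <= vn z.
Proof.
move=> /hprod_unit_le[h0 h1]; rewrite hprodE (le_trans (cabsD _ _))// !cabsM !cabsJ.
by apply: lerD; rewrite ler_piMr ?cabs_ge0.
Qed.

Lemma vn_unit_le e : hprod e e = 1 -> vn e <= 2.
Proof. by move=> /hprod_unit_le[h0 h1]; rewrite /vn; lra. Qed.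

(** For a unit vector [e] this is the linear map that fixes the orthogonal complement of [e] and
    multiplies [e] by [t]. *)
Definition refl_map (e : V) t z : V := z + ((t - 1) * hprod z e) *: e.

(** [q] need only lie in the closure of the product of [A] and [B], so a boundary point is allowed.
    A nearby point (a, b) of the product is joined to (v, w) by a complex line, on which [G]
    vanishes near the parameter 0; the one-variable identity principle reaches the parameter 1. *)
Lemma id_local (G : V * V -> C) (q : V * V) (d M : R) (A B : set V) : 0 < d ->
  open A -> open B -> closure A q.1 -> closure B q.2 ->
  (forall v w, vn (v - q.1) <= d -> vn (w - q.2) <= d -> differentiable G (v, w)) ->
  (forall v w, vn (v - q.1) <= d -> vn (w - q.2) <= d -> cabs (G (v, w)) <= M) ->
  (forall v w, A v -> B w -> vn (v - q.1) <= d -> vn (w - q.2) <= d -> G (v, w) = 0) ->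
  forall v w, vn (v - q.1) <= d / 20 -> vn (w - q.2) <= d / 20 -> G (v, w) = 0.
Proof.
move=> d0 oA oB cA cB dG GM G0 v w hv hw; have d20 : 0 < d / 20 by rewrite divr_gt0.
have [a Aa ha] := closure_vn cA d20; have [b Bb hb] := closure_vn cB d20.
have [da [da0 Ha]] := open_vn oA Aa; have [db [db0 Hb]] := open_vn oB Bb.
pose f s := G (a + s *: (v - a), b + s *: (w - b)).
have line (x y z : V) s : vn (x - y) <= d / 20 -> vn (z - y) <= d / 20 -> cabs s <= 8 ->
    vn (x + s *: (z - x) - y) <= d.
  move=> hx hz hs; have -> : x + s *: (z - x) - y = (x - y) + s *: ((z - y) - (x - y)).
    by rewrite opprB addrA subrK addrAC.
  apply: le_trans (vnD _ _) _; rewrite vnZ.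
  have hzx := le_trans (vnD (z - y) (- (x - y))) (lerD hz (lexx _)); rewrite vnN in hzx.
  have h8 : cabs s * vn (z - y - (x - y)) <= 8 * (d / 20 + d / 20).
    by apply: ler_pM; rewrite ?cabs_ge0 ?vn_ge0//; lra.
  by lra.
have df s : cabs s <= 2 * 4 -> differentiable f s.
  move=> hs; apply: (@differentiable_lineVV G (a, b) (v - a, w - b)) => /=.
  by apply: dG; apply: line => //; rewrite (le_trans hs)// -natrM.
have fM s : 4 <= cabs s <= 2 * 4 -> cabs (f s) <= M.
  by move=> /andP[_ hs]; apply: GM; apply: line => //; rewrite (le_trans hs)// -natrM.
have pos x : 0 <= vn x + 1 by rewrite addr_ge0 ?vn_ge0.
pose dd := Num.min 1 (Num.min (da / (vn (v - a) + 1)) (db / (vn (w - b) + 1))).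
have dd0 : 0 < dd by rewrite !lt_min ltr01 !divr_gt0 ?ltr_wpDl ?vn_ge0.
have : f 1 = 0.
  apply: (@identity_disc _ f 4 M dd _ dd0 df fM); rewrite ?cabs1//; last by lra.
  move=> s; rewrite !le_min => /andP[s1 /andP[sa sb]]; apply: G0.
  - apply: Ha; rewrite addrC addKr vnZ; rewrite ler_pdivlMr ?ltr_wpDl ?vn_ge0// in sa.
    by apply: le_trans sa; rewrite ler_wpM2l ?cabs_ge0// lerDl.
  - apply: Hb; rewrite addrC addKr vnZ; rewrite ler_pdivlMr ?ltr_wpDl ?vn_ge0// in sb.
    by apply: le_trans sb; rewrite ler_wpM2l ?cabs_ge0// lerDl.
  - by apply: line => //; lra.
  - by apply: line => //; lra.
by rewrite /f !scale1r (addrC a) (addrC b) !subrK.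
Qed.
End Vtop.

(** * Order of vanishing along one mirror *)

Section Mirrors.
Variable R : realType.
Local Notation C := (complex R).
Local Notation V := 'cV[C]_2.
Implicit Types (v w z e : V) (t : C) (Om : seq C) (F : V * V -> C) (A B : set V).

(** [Om] stands for the determinants of the group elements that fix the mirror pointwise, or for
    their conjugates: a finite multiplicative group on the unit circle, with as many elements as the
    multiplicity. *)
Definition good_mirror e Om := [/\ hprod e e = 1, uniq Om, (forall t, t \in Om -> cabs t = 1),
  (forall t t', t \in Om -> t' \in Om -> t * t' \in Om) & (0 < size Om)%N].

Lemma differentiable_hprod e z : differentiable (fun v : V => hprod v e) z.
Proof.
under eq_fun do rewrite hprodE.
have h i : differentiable (fun v : V => v i 0 * (e i 0)^*) z.
  by apply: differentiableM; [exact: differentiable_coord|exact: differentiable_cst].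
by apply: (differentiableD (h 0) (h 1)).
Qed.

Lemma differentiable_fst (q : V * V) : differentiable (fun x : V * V => x.1) q.
Proof. exact: (@linear_differentiable _ _ _ fst q (fun=> cvg_fst)). Qed.

Lemma differentiable_snd (q : V * V) : differentiable (fun x : V * V => x.2) q.
Proof. exact: (@linear_differentiable _ _ _ snd q (fun=> cvg_snd)). Qed.

Lemma differentiable_slice F (x z : V) : differentiable F (x, z) ->
  differentiable (fun v => F (x, v)) z.
Proof.
move=> h; apply: (@differentiable_comp _ _ _ _ (fun v : V => (x, v)) F); last exact: h.
apply: differentiable_pair; last exact: ex_diff.
exact: differentiable_cst.
Qed.

Lemma differentiable_refl_map e t z : differentiable (refl_map e t) z.
Proof.
apply: differentiableD; first exact: ex_diff.
apply: differentiableZl; apply: differentiableM; last exact: differentiable_hprod.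
exact: differentiable_cst.
Qed.

Lemma refl_map_dist e t z z0 : hprod e e = 1 -> cabs t = 1 -> hprod z0 e = 0 ->
  vn (refl_map e t z - z0) <= 5 * vn (z - z0).
Proof.
move=> ee t1 ze; have -> : refl_map e t z - z0 = (z - z0) + ((t - 1) * hprod (z - z0) e) *: e.
  by rewrite /refl_map hprodB ze subr0 addrAC.
apply: le_trans (vnD _ _) _; rewrite vnZ cabsM.
have h1 : cabs (t - 1) <= 2 by rewrite (le_trans (cabsD _ _))// cabsN cabs1 t1.
have h2 := cabs_hprod_le (z - z0) ee; have h3 := vn_unit_le ee.
have : cabs (t - 1) * cabs (hprod (z - z0) e) * vn e <= 2 * vn (z - z0) * 2.
  by apply: ler_pM; rewrite ?mulr_ge0 ?cabs_ge0 ?vn_ge0//; apply: ler_pM; rewrite ?cabs_ge0.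
by have := vn_ge0 (z - z0); lra.
Qed.

(** The skew relation is known on the product of [A] and [B]; [id_local] extends it to a full
    neighbourhood of (x0, z0). On a line in direction [e] it then reads t f(t u) = f(u), and
    [symmetric_vanishing] gives the order. *)
Lemma equi_div F (x0 z0 : V) (d : R) A B e Om : 0 < d ->
  open A -> open B -> closure A x0 -> closure B z0 ->
  (forall v w, vn (v - x0) <= d -> vn (w - z0) <= d -> differentiable F (v, w)) ->
  good_mirror e Om -> hprod z0 e = 0 ->
  (forall t x z, t \in Om -> A x -> B z -> vn (x - x0) <= d -> vn (z - z0) <= d ->
     vn (refl_map e t z - z0) <= d -> t * F (x, refl_map e t z) = F (x, z)) ->
  exists d' c : R, [/\ 0 < d', 0 <= c & forall x z, vn (x - x0) <= d' -> vn (z - z0) <= d' ->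
    cabs (F (x, z)) <= c * cabs (hprod z e) ^+ (size Om).-1].
Proof.
move=> d0 oA oB cA cB dF [ee uOm Om1 Omm Oms] z0e Feq.
have dF0 : differentiable F (x0, z0) by apply: dF; rewrite subrr vn0 ltW.
have [db [db0 bF]] := differentiable_vn_bounded dF0; rewrite /= in bF.
set M := cabs (F (x0, z0)) + 1 in bF.
pose d1 := Num.min d db; have d10 : 0 < d1 by rewrite lt_min d0.
have d1d : d1 <= d by rewrite ge_min lexx.
have d1b : d1 <= db by rewrite ge_min lexx orbT.
pose d2 := d1 / 5; have d20 : 0 < d2 by rewrite divr_gt0.
have d21 : d2 <= d1 by rewrite /d2; lra.
pose d3 := d2 / 20; have d30 : 0 < d3 by rewrite divr_gt0.
have d32 : d3 <= d2 by rewrite /d3; lra.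
have eqv t x z : t \in Om -> vn (x - x0) <= d3 -> vn (z - z0) <= d3 ->
    t * F (x, refl_map e t z) = F (x, z).
  move=> tOm; have t1 := Om1 t tOm.
  have rd v : vn (v - z0) <= d2 -> vn (refl_map e t v - z0) <= d1.
    by move=> h; apply: le_trans (refl_map_dist v ee t1 z0e) _; rewrite /d2 in h; lra.
  pose G (q : V * V) := t * F (q.1, refl_map e t q.2) - F q.
  move=> hx hz; apply/eqP; rewrite -subr_eq0; apply/eqP.
  apply: (@id_local _ G (x0, z0) d2 (M + M) A B d20 oA oB cA cB _ _ _ x z hx hz) => /=.
  - move=> v w hv hw; apply: differentiableB; last first.
      by apply: dF; [apply: le_trans hv _|apply: le_trans hw _]; apply: le_trans d1d.
    apply: differentiableM; first exact: differentiable_cst.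
    apply: (@differentiable_comp _ _ _ _ (fun q : V * V => (q.1, refl_map e t q.2)) F).
      apply: differentiable_pair; first exact: differentiable_fst.
      apply: (@differentiable_comp _ _ _ _ (fun q : V * V => q.2) (refl_map e t)).
        exact: differentiable_snd.
      exact: differentiable_refl_map.
    apply: dF; first by apply: le_trans hv _; exact: le_trans d1d.
    by apply: le_trans (rd _ hw) d1d.
  - move=> v w hv hw; rewrite /G /=; apply: le_trans (cabsD _ _) _.
    rewrite cabsN cabsM t1 mul1r; apply: lerD; apply: bF.
    + by apply: le_trans hv _; exact: le_trans d1b.
    + by apply: le_trans (rd _ hw) d1b.
    + by apply: le_trans hv _; exact: le_trans d1b.
    + by apply: le_trans hw _; exact: le_trans d1b.
  - move=> v w Av Bw hv hw; rewrite /G /= Feq ?subrr//.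
    + by apply: le_trans hv _; exact: le_trans d1d.
    + by apply: le_trans hw _; exact: le_trans d1d.
    + by apply: le_trans (rd _ hw) d1d.
pose r := d3 / 8; have r0 : 0 < r by rewrite divr_gt0.
pose m := (size Om).-1.
exists (d3 / 16), (8 * M / r ^+ m); split; first by rewrite divr_gt0.
  by rewrite divr_ge0 ?mulr_ge0 ?addr_ge0 ?cabs_ge0 ?exprn_ge0 ?(ltW r0).
(* [y] is the orthogonal projection of [z] to the mirror and [s] the coordinate of [z] along [e], so
   [z] is the point of parameter [s] on the line. *)
move=> x z hx hz; pose s := hprod z e; pose y := z - s *: e.
have sE : s = hprod (z - z0) e by rewrite hprodB z0e subr0.
have sle : cabs s <= d3 / 16 by rewrite sE (le_trans (cabs_hprod_le _ ee)).
have ve := vn_unit_le ee.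
have ye : hprod y e = 0 by rewrite hprodB hprodZ ee mulr1 subrr.
have yd u : cabs u <= 2 * r -> vn (y + u *: e - z0) <= d3.
  move=> hu; have -> : y + u *: e - z0 = (z - z0) + ((u - s) *: e).
    by rewrite /y scalerBl; apply: cV2P; rewrite !mxE; ring.
  apply: le_trans (vnD _ _) _; rewrite vnZ.
  have h1 : cabs (u - s) <= 2 * r + d3 / 16.
    by apply: le_trans (cabsD _ _) _; rewrite cabsN lerD.
  have : cabs (u - s) * vn e <= (2 * r + d3 / 16) * 2.
    by apply: ler_pM; rewrite ?cabs_ge0 ?vn_ge0.
  by rewrite /r; lra.
have xd : vn (x - x0) <= d3 by lra.
have d3d1 : d3 <= d1 by exact: le_trans d21.
pose f u := F (x, y + u *: e).
have df u : cabs u <= 2 * r -> differentiable f u.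
  move=> hu; apply: (@differentiable_lineV _ (fun v => F (x, v))).
  apply: differentiable_slice; apply: dF.
    by apply: le_trans xd _; exact: le_trans d1d.
  by apply: le_trans (yd _ hu) _; exact: le_trans d1d.
have fM u : r <= cabs u <= 2 * r -> cabs (f u) <= M.
  move=> /andP[_ hu]; apply: bF.
    by apply: le_trans xd _; exact: le_trans d1b.
  by apply: le_trans (yd _ hu) _; exact: le_trans d1b.
have := @symmetric_vanishing _ f r M Om r0 df fM uOm Om1 Omm Oms.
have fs : f s = F (x, z) by rewrite /f /y subrK.
have E : 8 * M / r ^+ m * cabs s ^+ m = 8 * M * (cabs s / r) ^+ m.
  by rewrite (expr_div_n (cabs s)) [cabs s ^+ m / _]mulrC mulrA.
rewrite -/s -/m E -fs; apply; last by rewrite /r; lra.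
move=> t u tOm hu; rewrite /f; have := eqv t x (y + u *: e) tOm xd (yd _ _).
have -> : refl_map e t (y + u *: e) = y + (t * u) *: e.
  rewrite /refl_map hprodD hprodZ ye ee add0r mulr1 -addrA -scalerDl.
  by congr (y + _ *: e); ring.
by apply; lra.
Qed.
End Mirrors.

(** * Bound by the product of linear forms, away from 0 *)

Section MirrorProduct.
Variables (R : realType) (T : eqType).
Local Notation C := (complex R).
Local Notation V := 'cV[C]_2.
Implicit Types (v w z : V) (t : C) (F : V * V -> C) (A B : set V).
Implicit Types (L : seq T) (e : T -> V) (Om : T -> seq C).

Definition mirror_prod e Om L z : R :=
  \prod_(Y <- L) cabs (hprod z (e Y)) ^+ (size (Om Y)).-1.

Lemma mirror_prod_ge0 e Om L z : 0 <= mirror_prod e Om L z.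
Proof. by apply: prodr_ge0 => Y _; rewrite exprn_ge0 ?cabs_ge0. Qed.

Lemma mirror_prod_lb e Om L z0 :
  (forall Y, Y \in L -> hprod (e Y) (e Y) = 1) ->
  (forall Y, Y \in L -> hprod z0 (e Y) != 0) ->
  exists d c : R, [/\ 0 < d, 0 < c & forall z, vn (z - z0) <= d -> c <= mirror_prod e Om L z].
Proof.
elim: L => [|Y L IH] eu h.
  by exists 1, 1; split => // z _; rewrite /mirror_prod big_nil.
have [|Y' Y'L|d [c [d0 c0 H]]] := IH.
- by move=> Y' Y'L; apply: eu; rewrite inE Y'L orbT.
- by apply: h; rewrite inE Y'L orbT.
have Y1 := eu Y (mem_head _ _); have Y0 := h Y (mem_head _ _).
set b := cabs (hprod z0 (e Y)); have b0 : 0 < b by rewrite cabs_gt0.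
exists (Num.min d (b / 2)), ((b / 2) ^+ (size (Om Y)).-1 * c); split.
- by rewrite lt_min d0 divr_gt0.
- by rewrite mulr_gt0 ?exprn_gt0 ?divr_gt0.
move=> z; rewrite le_min => /andP[/H hz hb]; rewrite /mirror_prod big_cons.
apply: ler_pM; rewrite ?exprn_ge0 ?divr_ge0 ?(ltW b0) ?(ltW c0)//.
rewrite lerXn2r ?nnegrE ?divr_ge0 ?(ltW b0) ?cabs_ge0//.
have := cabs_hprod_le (z - z0) Y1; rewrite hprodB cabsB => h1.
have := cabsD (hprod z0 (e Y) - hprod z (e Y)) (hprod z (e Y)).
by rewrite subrK -/b; lra.
Qed.

Definition skew_near F (x0 z0 : V) (d : R) A B (e1 : V) (Om1 : seq C) :=
  forall t x z, t \in Om1 -> A x -> B z -> vn (x - x0) <= d -> vn (z - z0) <= d ->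
     vn (refl_map e1 t z - z0) <= d -> t * F (x, refl_map e1 t z) = F (x, z).

(** At most one mirror passes through [z0]; the other linear forms stay away from 0 nearby, so
    [equi_div] for that one mirror is enough. *)
Lemma mirror_bound_off0 F (x0 z0 : V) (d : R) A B e Om L : 0 < d ->
  open A -> open B -> closure A x0 -> closure B z0 ->
  (forall v w, vn (v - x0) <= d -> vn (w - z0) <= d -> differentiable F (v, w)) ->
  uniq L -> (forall Y, Y \in L -> good_mirror (e Y) (Om Y)) ->
  (forall Y Y', Y \in L -> Y' \in L -> hprod z0 (e Y) = 0 -> hprod z0 (e Y') = 0 -> Y = Y') ->
  (forall Y, Y \in L -> hprod z0 (e Y) = 0 -> skew_near F x0 z0 d A B (e Y) (Om Y)) ->
  exists d' c : R, [/\ 0 < d', 0 <= c & forall x z, vn (x - x0) <= d' -> vn (z - z0) <= d' ->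
    cabs (F (x, z)) <= c * mirror_prod e Om L z].
Proof.
move=> d0 oA oB cA cB dF uL gm one skew.
have eu Y : Y \in L -> hprod (e Y) (e Y) = 1 by move=> /gm[].
have [/hasP[Y YL /eqP Y0]|/hasPn none] := boolP (has (fun Y => hprod z0 (e Y) == 0) L).
  have [d1 [c1 [d10 c10 H1]]] := equi_div d0 oA oB cA cB dF (gm Y YL) Y0 (skew Y YL Y0).
  have [Y' Y'L|Y' Y'L|d2 [c2 [d20 c20 H2]]] := @mirror_prod_lb e Om (rem Y L) z0.
  - by apply: eu; exact: mem_rem Y'L.
  - apply/negP => /eqP Y'0; have := one _ _ YL (mem_rem Y'L) Y0 Y'0 => E.
    by move: Y'L; rewrite -E mem_rem_uniqF.
  exists (Num.min d1 d2), (c1 / c2); split; rewrite ?lt_min ?d10 ?divr_ge0 ?(ltW c20)//.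
  move=> x z; rewrite !le_min => /andP[hx _] /andP[hz /H2 hz2].
  apply: le_trans (H1 x z hx hz) _.
  rewrite /mirror_prod (perm_big _ (perm_to_rem YL)) big_cons /=.
  rewrite mulrCA [leLHS]mulrC; apply: ler_wpM2l; first by rewrite exprn_ge0 ?cabs_ge0.
  by rewrite -[leLHS]mulr1 -mulrA; apply: ler_wpM2l => //; rewrite mulrC ler_pdivlMr// mul1r.
have dF0 : differentiable F (x0, z0) by apply: dF; rewrite subrr vn0 ltW.
have [d1 [d10 H1]] := differentiable_vn_bounded dF0; rewrite /= in H1.
have [Y YL|Y YL|d2 [c2 [d20 c20 H2]]] := @mirror_prod_lb e Om L z0; first exact: eu; first exact: none.
set M := cabs (F (x0, z0)) + 1 in H1.
have M0 : 0 <= M by rewrite addr_ge0 ?cabs_ge0.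
exists (Num.min d1 d2), (M / c2); split; rewrite ?lt_min ?d10 ?divr_ge0 ?(ltW c20)//.
move=> x z; rewrite !le_min => /andP[hx _] /andP[hz /H2 hz2].
apply: le_trans (H1 x z hx hz) _.
by rewrite -mulrA -[leLHS]mulr1; apply: ler_wpM2l => //; rewrite mulrC ler_pdivlMr// mul1r.
Qed.

End MirrorProduct.

(** * The same bound at 0, where all mirrors meet *)

Section MirrorAt0.
Variables (R : realType) (T : eqType).
Local Notation C := (complex R).
Local Notation V := 'cV[C]_2.
Implicit Types (v w z : V) (t : C) (F : V * V -> C) (A B : set V).
Implicit Types (L : seq T) (e : T -> V) (Om : T -> seq C).

Definition slope (k : nat) : V := \col_i (if i == 0 then 1 else k%:R).

Lemma hprod_slope k (e : V) : hprod (slope k) e = (e 0 0)^* + k%:R * (e 1 0)^*.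
Proof. by rewrite hprodE !mxE mul1r. Qed.

(** A mirror contains at most one of the vectors (1, k), since the pairing with its root is a
    nonzero affine function of [k]. *)
Lemma generic_slope e L : (forall Y, Y \in L -> hprod (e Y) (e Y) = 1) ->
  exists N, forall k, (N <= k)%N -> forall Y, Y \in L -> hprod (slope k) (e Y) != 0.
Proof.
elim: L => [|Y L IH] eu; first by exists 0%N.
have [|N1 H1] := IH; first by move=> Y' Y'L; apply: eu; rewrite inE Y'L orbT.
have Y1 := eu Y (mem_head _ _).
suff [N2 H2] : exists N2, forall k, (N2 <= k)%N -> hprod (slope k) (e Y) != 0.
  exists (maxn N1 N2) => k; rewrite geq_max => /andP[k1 k2] Y'; rewrite inE => /orP[/eqP ->|]; [exact: H2|exact: H1].
have [e1|e1] := eqVneq (e Y 1 0) 0.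
  exists 0%N => k _; rewrite hprod_slope e1 conjC0 mulr0 addr0 conjC_eq0.
  by apply: contra_eq_neq Y1 => e0; rewrite hprodE e0 e1 conjC0 !mulr0 addr0 eq_sym oner_eq0.
have e10 : 0 < cabs (e Y 1 0) by rewrite cabs_gt0.
have := archi_boundP (divr_ge0 (cabs_ge0 (e Y 0 0)) (cabs_ge0 (e Y 1 0))).
set N := Num.bound _ => hN; exists N => k Nk; apply/eqP; rewrite hprod_slope => /eqP.
rewrite addr_eq0 => /eqP /(congr1 (@cabs R)); rewrite cabsN cabsM !cabsJ cabs_nat => E.
move: hN; rewrite E mulfK ?gt_eqF// ltr_nat ltnNge Nk//.
Qed.

Lemma finite_lower_bound L (f : T -> R) : (forall Y, Y \in L -> 0 < f Y) ->
  exists2 b : R, 0 < b & forall Y, Y \in L -> b <= f Y.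
Proof.
elim: L => [|Y L IH] H; first by exists 1.
have [|b b0 Hb] := IH; first by move=> Y' Y'L; apply: H; rewrite inE Y'L orbT.
exists (Num.min b (f Y)); first by rewrite lt_min b0 H ?mem_head.
by move=> Y'; rewrite inE => /orP[/eqP ->|/Hb h]; rewrite ge_min ?lexx ?orbT// h.
Qed.

Lemma ccont_le_limit (f P : C -> C) (c d : R) : 0 < d -> 0 <= c -> ccont f 0 -> ccont P 0 ->
  (forall t, t != 0 -> cabs t <= d -> cabs (f t) <= c * cabs (P t)) ->
  cabs (f 0) <= c * cabs (P 0).
Proof.
move=> d0 c0 cf cP H; apply/ler_addgt0Pr => e e0.
have c10 : 0 < c + 1 by rewrite ltr_wpDl.
have e1 : 0 < e / (c + 1) by rewrite divr_gt0.
have [d1 [d10 H1]] := cf _ e1; have [d2 [d20 H2]] := cP _ e1.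
pose t : C := ((Num.min d (Num.min d1 d2))%:C)%C.
have t0 : 0 < Num.min d (Num.min d1 d2) by rewrite !lt_min d0 d10.
have ct : cabs t = Num.min d (Num.min d1 d2) by rewrite cabsR ger0_norm// ltW.
have := H1 t; have := H2 t; rewrite subr0 ct !ge_min !lexx !orbT => /(_ isT) h2 /(_ isT) h1.
have := H t; rewrite ct ge_min lexx -cabs_gt0 ct => /(_ t0 isT) h.
have f0 : cabs (f 0) <= cabs (f t) + e / (c + 1).
  by rewrite -[X in cabs X <= _](subrK (f t)) addrC (le_trans (cabsD _ _))// lerD2l cabsB.
have Pt : cabs (P t) <= cabs (P 0) + e / (c + 1).
  by rewrite -[X in cabs X <= _](subrK (P 0)) addrC (le_trans (cabsD _ _))// lerD2l.
apply: le_trans f0 _; have := ler_wpM2l c0 Pt; rewrite mulrDr => h3.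
have E : c * (e / (c + 1)) + e / (c + 1) = e.
  by rewrite -[X in _ + X]mul1r -mulrDl mulrC divfK// gt_eqF.
by rewrite -[X in _ <= _ + X]E addrA lerD2r; apply: le_trans h3; exact: h.
Qed.

(* At 0 all mirrors meet.  On a complex line in a generic direction that avoids 0, a point lies on at most one
   mirror, so [mirror_bound_off0] makes F divided by the product of the linear forms locally bounded there. *)
Lemma mirror_bound_at0 F (x0 : V) (d : R) A B e Om L : 0 < d ->
  open A -> open B -> (forall z, vn z <= d -> B z) ->
  (forall v w, vn (v - x0) <= d -> vn w <= d -> differentiable F (v, w)) ->
  uniq L -> (forall Y, Y \in L -> good_mirror (e Y) (Om Y)) ->
  (forall z Y Y', z != 0 -> Y \in L -> Y' \in L -> hprod z (e Y) = 0 -> hprod z (e Y') = 0 -> Y = Y') ->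
  (forall Y, Y \in L -> skew_near F x0 0 d A B (e Y) (Om Y)) ->
  exists d' c : R, [/\ 0 < d', 0 <= c & forall x z, A x -> vn (x - x0) <= d' -> vn z <= d' ->
    cabs (F (x, z)) <= c * mirror_prod e Om L z].
Proof.
move=> d0 oA oB hB dF uL gm one skew.
have eu Y : Y \in L -> hprod (e Y) (e Y) = 1 by move=> /gm[].
have dF0 : differentiable F (x0, 0) by apply: dF; rewrite ?subrr vn0 ltW.
have [db [db0 bF]] := differentiable_vn_bounded dF0; rewrite /= in bF.
set M := cabs (F (x0, 0)) + 1 in bF.
have M0 : 0 <= M by rewrite addr_ge0 ?cabs_ge0.
pose d1 := Num.min d db; have d10 : 0 < d1 by rewrite lt_min d0.
have d1d : d1 <= d by rewrite ge_min lexx.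
have d1b : d1 <= db by rewrite ge_min lexx orbT.
have loc x1 z1 : A x1 -> vn (x1 - x0) <= d / 2 -> z1 != 0 -> vn z1 <= d / 2 ->
    exists d' c : R, [/\ 0 < d', 0 <= c & forall x z, vn (x - x1) <= d' -> vn (z - z1) <= d' ->
    cabs (F (x, z)) <= c * mirror_prod e Om L z].
  move=> Ax1 hx1 z1n0 hz1.
  have tri (p q o : V) : vn (p - q) <= d / 2 -> vn (q - o) <= d / 2 -> vn (p - o) <= d.
    by move=> h1 h2; rewrite -[p - o](subrKA q) (le_trans (vnD _ _))// (splitr d) lerD.
  have hz1' : vn (z1 - 0) <= d / 2 by rewrite subr0.
  have d20 : 0 < d / 2 by rewrite divr_gt0.
  have cB : closure B z1 by apply: subset_closure; apply: hB; lra.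
  apply: (@mirror_bound_off0 _ _ F x1 z1 (d / 2) A B e Om L d20 oA oB (subset_closure Ax1) cB _ uL gm).
  - move=> v w hv hw; apply: dF; first exact: tri hv hx1.
    by rewrite -[w]subr0; exact: tri hw hz1'.
  - by move=> Y Y' YL Y'L; apply: one.
  - move=> Y YL _ t x z tO Ax Bz hx hz hr; apply: (skew Y YL t x z tO Ax Bz).
    + exact: tri hx hx1.
    + exact: tri hz hz1'.
    + exact: tri hr hz1'.
have [N HN] := generic_slope eu; pose v := slope N.
have hv Y : Y \in L -> hprod v (e Y) != 0 by exact: HN.
have [b b0 Hb] := @finite_lower_bound L (fun Y => cabs (hprod v (e Y))) (fun Y YL => ltac:(by rewrite cabs_gt0 hv)).
have v10 : 0 < vn v + 1 by rewrite ltr_wpDl ?vn_ge0.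
(* Chosen so that moving along [v] with parameter at most [2 * r] shifts a point by at most
   [d1 / 8]. *)
pose r := d1 / (16 * (vn v + 1)).
have r0 : 0 < r by rewrite divr_gt0// mulr_gt0.
have rv : 2 * r * vn v <= d1 / 8.
  have -> : d1 / 8 = 2 * r * (vn v + 1) by rewrite /r; field; rewrite gt_eqF.
  by apply: ler_wpM2l; [rewrite mulr_ge0 ?(ltW r0)|rewrite lerDl].
pose d' := Num.min (d1 / 8) (r * b / 2).
have rb0 : 0 < r * b / 2 by rewrite (divr_gt0 (mulr_gt0 r0 b0)).
have d'0 : 0 < d' by rewrite lt_min (divr_gt0 d10)// rb0.
have d'1 : d' <= d1 / 8 by rewrite ge_min lexx.
have d'2 : d' <= r * b / 2 by rewrite ge_min lexx orbT.
pose gam := \prod_(Y <- L) (r * b / 2) ^+ (size (Om Y)).-1.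
have gam0 : 0 < gam by apply: prodr_gt0 => Y _; rewrite exprn_gt0.
pose Mg := M / gam; have Mg0 : 0 <= Mg by rewrite divr_ge0// ltW.
have inball z u : vn z <= d' -> cabs u <= 2 * r -> vn (z + u *: v) <= d1 / 4.
  move=> hz hu; apply: le_trans (vnD _ _) _; rewrite vnZ.
  have := ler_wpM2r (vn_ge0 v) hu; lra.
(* For [r <= cabs u] the part [u * hprod v (e Y)] has modulus at least [r * b], and [hprod z (e Y)]
   at most [d' <= r * b / 2]. So every linear form is at least [r * b / 2] on the annulus. *)
have ann z u : vn z <= d' -> r <= cabs u -> gam <= mirror_prod e Om L (z + u *: v).
  move=> hz hu; rewrite /gam /mirror_prod big_seq [leRHS]big_seq.
  apply: ler_prod => Y YL; rewrite exprn_ge0 ?(ltW rb0)//=.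
  rewrite lerXn2r ?nnegrE ?cabs_ge0 ?(ltW rb0)//.
  have h1 := cabs_hprod_le z (eu Y YL); have h2 := Hb Y YL.
  have := cabsD (hprod (z + u *: v) (e Y)) (- hprod z (e Y)).
  have -> : hprod (z + u *: v) (e Y) - hprod z (e Y) = u * hprod v (e Y).
    by rewrite hprodD hprodZ addrAC subrr add0r.
  rewrite cabsM cabsN => h3.
  have h4 : r * b <= cabs u * cabs (hprod v (e Y)) by apply: ler_pM => //; rewrite ltW.
  by lra.
pose pz z u := \prod_(Y <- L) hprod (z + u *: v) (e Y) ^+ (size (Om Y)).-1.
have dhp z w Y t : differentiable (fun u : C => hprod (z + u *: w) (e Y) ^+ (size (Om Y)).-1) t.
  apply: differentiable_funX.
  by apply: (@differentiable_lineV _ (fun x => hprod x (e Y))); exact: differentiable_hprod.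
have pzE z w u : cabs (\prod_(Y <- L) hprod (z + u *: w) (e Y) ^+ (size (Om Y)).-1) =
    mirror_prod e Om L (z + u *: w).
  by rewrite cabs_prod; apply: eq_bigr => Y _; rewrite cabsX.
(* The condition says that [z] is not a multiple of [v], that is, the line through [z] in direction
   [v] misses 0. *)
have generic x z : A x -> vn (x - x0) <= d' -> vn z <= d' -> z 1 0 != N%:R * z 0 0 ->
    cabs (F (x, z)) <= Mg * mirror_prod e Om L z.
  move=> Ax hx hz zn.
  have nz u : z + u *: v != 0.
    apply: contra_neq zn => h; have := congr1 (fun w : V => w 0 0) h.
    have := congr1 (fun w : V => w 1 0) h; rewrite !mxE /= mulr1 => h1 h0.
    move/eqP: h1; have -> : u = - z 0 0 by apply/eqP; rewrite -addr_eq0 addrC h0.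
    by rewrite addr_eq0 mulNr opprK => /eqP ->; rewrite mulrC.
  have xd : vn (x - x0) <= d / 2 by lra.
  (* Parameters at which the line meets the mirrors. Mirrors of exponent 0 are filtered out, because
     their factor is the constant 1 and has no zero. *)
  pose ts := [seq - (hprod z (e Y)) / hprod v (e Y) | Y <- L & (0 < (size (Om Y)).-1)%N].
  have := @quotient_center_bound _ (fun u => F (x, z + u *: v)) (pz z) ts r Mg r0 Mg0.
  rewrite /pz pzE scale0r addr0; apply.
  - move=> s hs; apply: (@differentiable_lineV _ (fun w => F (x, w))); apply: differentiable_slice.
    by apply: dF; [lra|have := inball z s hz hs; lra].
  - move=> s _; apply: differentiable_big_prod => Y; exact: dhp.
  - move=> s _; split.
      move=> /eqP; rewrite prodf_seq_eq0 => /hasP[Y YL /=].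
      rewrite expf_eq0 => /andP[k0 h0]; apply/mapP; exists Y; first by rewrite mem_filter k0.
      have v0 := hv Y YL; move: h0; rewrite hprodD hprodZ addrC addr_eq0 => /eqP <-.
      by rewrite mulfK.
    move=> /mapP[Y]; rewrite mem_filter => /andP[k0 YL] ->; apply/eqP.
    rewrite prodf_seq_eq0; apply/hasP; exists Y => //=; rewrite expf_eq0 k0 /=.
    by rewrite hprodD hprodZ divfK ?hv// subrr.
  - move=> s hs _; have hzs := inball z s hz hs.
    have [|d2 [c2 [d20 c20 H2]]] := loc x (z + s *: v) Ax xd (nz s); first by lra.
    exists (d2 / (vn v + 1)), c2; split; first by rewrite divr_gt0.
    move=> u hu; rewrite pzE; apply: H2; first by rewrite subrr vn0 ltW.
    rewrite opprD addrACA subrr add0r -scalerBl vnZ; rewrite ler_pdivlMr// in hu.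
    by apply: le_trans hu; rewrite ler_wpM2l ?cabs_ge0// lerDl.
  - move=> s /andP[rs hs]; have hg := ann z s hz rs; have g0 := lt_le_trans gam0 hg.
    split; first by rewrite -cabs_gt0 pzE.
    rewrite pzE; apply: le_trans (_ : M <= _).
      by apply: bF; [lra|rewrite subr0; have := inball z s hz hs; lra].
    by rewrite -mulrA -[leLHS]mulr1; apply: ler_wpM2l => //; rewrite mulrC ler_pdivlMr// mul1r.
exists (d' / 2), Mg; split; rewrite ?divr_gt0// => x z Ax hx hz.
have [zn|zn] := eqVneq (z 1 0) (N%:R * z 0 0); last first.
  by apply: generic => //; lra.
(* For [z] on the line spanned by [v] the bound is a limit: a displacement along (0, 1) leaves that
   line at once. *)
pose w : V := \col_i (if i == 0 then 0 else 1).
have wE : vn w = 1 by rewrite /vn !mxE /= cabs0 cabs1 add0r.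
pose Pw u := \prod_(Y <- L) hprod (z + u *: w) (e Y) ^+ (size (Om Y)).-1.
have d'20 : 0 < d' / 2 by rewrite divr_gt0.
have := @ccont_le_limit (fun u => F (x, z + u *: w)) Pw Mg (d' / 2) d'20 Mg0.
rewrite /Pw pzE scale0r addr0; apply.
- apply: differentiable_ccont; apply: (@differentiable_lineV _ (fun w => F (x, w))).
  by apply: differentiable_slice; apply: dF; rewrite ?scale0r ?addr0; lra.
- by apply: differentiable_ccont; apply: differentiable_big_prod => Y; exact: dhp.
- move=> t t0 ht; rewrite pzE; apply: generic => //; first by lra.
    by apply: le_trans (vnD _ _) _; rewrite vnZ wE mulr1; lra.
  rewrite !mxE /= mulr0 addr0 mulr1 zn; apply: contra_neq t0 => h.
  by move/eqP: h; rewrite -subr_eq0 addrAC subrr add0r => /eqP.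
Qed.
End MirrorAt0.

(** * Unitary invariance of the Bergman kernel *)

Lemma measurable_preim d d' (X : measurableType d) (Y : measurableType d') (f : X -> Y) B :
  measurable_fun setT f -> measurable B -> measurable (f @^-1` B).
Proof. by move=> mf mB; rewrite -[_ @^-1` _]setTI; apply: mf. Qed.

Section ProductSigmaFinite.
Local Open Scope ereal_scope.
Context d1 d2 (X1 : measurableType d1) (X2 : measurableType d2) (R : realType).
Variables (m1 : {sigma_finite_measure set X1 -> \bar R}) (m2 : {sigma_finite_measure set X2 -> \bar R}).

Lemma sigma_finite_product : sigma_finite setT (m1 \x m2).
Proof.
have /sigma_finiteP[F [TF ndF Foo]] := sigma_finiteT m1.
have /sigma_finiteP[G [TG ndG Goo]] := sigma_finiteT m2.
exists (fun n => F n `*` G n).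
  apply/seteqP; split=> // -[x y] _.
  have [n _ Fx] : (\bigcup_i F i) x by rewrite -TF.
  have [k _ Gy] : (\bigcup_i G i) y by rewrite -TG.
  exists (maxn n k) => //; split => /=.
    by move: x Fx; apply/subsetPset/ndF/leq_maxl.
  by move: y Gy; apply/subsetPset/ndG/leq_maxr.
move=> k; have [? ?] := Foo k; have [? ?] := Goo k; split; first exact: measurableX.
by rewrite product_measure1E// lte_mul_pinfty// ge0_fin_numE.
Qed.

Definition sfprod : {sigma_finite_measure set (X1 * X2)%type -> \bar R} :=
  HB.pack (m1 \x m2) (Measure_isSigmaFinite.Build _ _ _ (m1 \x m2) sigma_finite_product).

(** The pushforward agrees with the product measure on measurable rectangles, and these determine
    the product measure. *)
Lemma product_measure_preserving (f1 : X1 -> X1) (f2 : X2 -> X2) :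
  measurable_fun setT f1 -> measurable_fun setT f2 ->
  (forall A, measurable A -> m1 (f1 @^-1` A) = m1 A) ->
  (forall A, measurable A -> m2 (f2 @^-1` A) = m2 A) ->
  forall A, measurable A -> (m1 \x m2) ((fun x => (f1 x.1, f2 x.2)) @^-1` A) = (m1 \x m2) A.
Proof.
move=> mf1 mf2 h1 h2 A mA; apply/esym.
have mf : measurable_fun setT (fun x : X1 * X2 => (f1 x.1, f2 x.2)).
  by apply: measurable_fun_pair; apply: measurableT_comp.
apply: (@product_measure_unique _ _ _ _ _ m1 m2 (pushforward (m1 \x m2) (fun x : X1 * X2 => (f1 x.1, f2 x.2)))) => //.
move=> B1 B2 mB1 mB2 /=; rewrite /pushforward.
rewrite -h1// -h2//; apply: product_measure1E.
  exact: (measurable_preim mf1).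
exact: (measurable_preim mf2).
Qed.
End ProductSigmaFinite.

Section Shift.
Variable R : realType.
Notation T1 := (measurableTypeR R).
Notation leb := (@lebesgue_measure R).

Lemma lebesgue_measure_shift (a : R) (A : set T1) : measurable A ->
  leb ((fun x : T1 => (x + a : T1)) @^-1` A) = leb A.
Proof.
move=> mA; have ms : measurable_fun setT (fun x : T1 => (x + a : T1)).
  exact: measurable_funD.
apply/esym; apply: (@lebesgue_measure_unique _ (pushforward leb (fun x : T1 => (x + a : T1)))) => //.
move=> _ [[x y] _ <-]; rewrite /= /pushforward.
have -> : (fun z : T1 => (z + a : T1)) @^-1` `]x, y] = `]x - a, y - a]%classic.
  by apply/seteqP; split => z /=; rewrite !in_itv /= ltrBlDr lerBrDr.
rewrite !lebesgue_measure_itv /= !lte_fin ltrD2r; case: ifP => // _.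
by rewrite -!EFinB; congr EFin; ring.
Qed.

Notation T4 := (T1 * T1 * T1 * T1)%type.

Definition shift4 (a x : T4) : T4 :=
  (x.1.1.1 + a.1.1.1, x.1.1.2 + a.1.1.2, x.1.2 + a.1.2, x.2 + a.2).

Lemma measurable_shift1 d (X : measurableType d) (g : X -> T1) (a : R) :
  measurable_fun setT g -> measurable_fun setT (fun x => (g x + a : T1)).
Proof. by move=> mg; apply: (measurable_funD mg); exact: measurable_cst. Qed.

Lemma measurable_coord4 : [/\ measurable_fun setT (fun x : T4 => x.1.1.1),
  measurable_fun setT (fun x : T4 => x.1.1.2), measurable_fun setT (fun x : T4 => x.1.2) &
  measurable_fun setT (fun x : T4 => x.2)].
Proof.
have m1 : measurable_fun setT (fun x : T4 => x.1) by exact: measurable_fst.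
have m11 : measurable_fun setT (fun x : T4 => x.1.1).
  exact: (measurableT_comp (f := fst) measurable_fst m1).
split.
- exact: (measurableT_comp (f := fst) measurable_fst m11).
- exact: (measurableT_comp (f := snd) measurable_snd m11).
- exact: (measurableT_comp (f := snd) measurable_snd m1).
- exact: measurable_snd.
Qed.

Lemma measurable_shift4 a : measurable_fun setT (shift4 a).
Proof.
have [c1 c2 c3 c4] := measurable_coord4.
apply: measurable_fun_pair; last exact: measurable_shift1 c4.
apply: measurable_fun_pair; last exact: measurable_shift1 c3.
by apply: measurable_fun_pair; [exact: measurable_shift1 c1|exact: measurable_shift1 c2].
Qed.

(** [leb4] is [vol] by conversion, but each stage carries the sigma-finiteness that uniqueness of
    product measures and Tonelli's theorem ask for. *)
Definition leb2 : {sigma_finite_measure set (T1 * T1)%type -> \bar R} := sfprod leb leb.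
Definition leb3 : {sigma_finite_measure set (T1 * T1 * T1)%type -> \bar R} := sfprod leb2 leb.
Definition leb4 : {sigma_finite_measure set T4 -> \bar R} := sfprod leb3 leb.

Lemma vol_shift (a : T4) (A : set T4) : measurable A -> @vol R (shift4 a @^-1` A) = @vol R A.
Proof.
have s1 b : measurable_fun setT (fun x : T1 => (x + b : T1)).
  by apply: (measurable_shift1 (g := fun x : T1 => x)); exact: measurable_id.
have s2 b c : measurable_fun setT (fun x : T1 * T1 => (x.1 + b, x.2 + c) : T1 * T1).
  apply: measurable_fun_pair; apply: measurable_shift1; [exact: measurable_fst|exact: measurable_snd].
have l1 b B : measurable B -> leb ((fun x : T1 => (x + b : T1)) @^-1` B) = leb B.
  exact: lebesgue_measure_shift.
move=> mA; refine (@product_measure_preserving _ _ _ _ R leb3 leb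
  (fun x => ((x.1.1 + a.1.1.1, x.1.2 + a.1.1.2), x.2 + a.1.2)) (fun x => x + a.2) _ _ _ _ A mA).
- apply: measurable_fun_pair; last by apply: measurable_shift1; exact: measurable_snd.
  by apply: (measurableT_comp (s2 _ _)); exact: measurable_fst.
- exact: s1.
- apply: (@product_measure_preserving _ _ _ _ R leb2 leb
    (fun x => (x.1 + a.1.1.1, x.2 + a.1.1.2)) (fun x => x + a.1.2)).
  + exact: s2.
  + exact: s1.
  + apply: (@product_measure_preserving _ _ _ _ R leb leb
      (fun x => x + a.1.1.1) (fun x => x + a.1.1.2)); [exact: s1|exact: s1|exact: l1|exact: l1].
  + exact: l1.
- exact: l1.
Qed.
End Shift.

(** * Borel sets of C^2 in real coordinates *)

Section R4.
Variable R : realType.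
Local Notation C := (complex R).
Local Notation V := 'cV[C]_2.
Notation T1 := (measurableTypeR R).
Notation T4 := (T1 * T1 * T1 * T1)%type.
Notation leb := (@lebesgue_measure R).

Definition ofC2 (v : V) : T4 :=
  (complex.Re (v 0 0), complex.Im (v 0 0), complex.Re (v 1 0), complex.Im (v 1 0)).

Lemma toC2E (x : T4) : (toC2 x 0 0 = x.1.1.1 +i* x.1.1.2)%C /\ (toC2 x 1 0 = x.1.2 +i* x.2)%C.
Proof. by rewrite !mxE. Qed.

Lemma toC2K : cancel (@toC2 R) ofC2.
Proof. by move=> [[[a b] c] d]; rewrite /ofC2 !mxE. Qed.

Lemma ofC2K : cancel ofC2 (@toC2 R).
Proof.
by move=> v; apply: cV2P; rewrite !mxE /=; [case: (v 0 0)|case: (v 1 0)].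
Qed.

(** The half-open dyadic cube of side 2^-n with lower corner k / 2^n. *)
Definition cube (n : nat) (k : int * int * int * int) : set T4 :=
  [set x | [/\ Num.floor (x.1.1.1 * 2 ^+ n) = k.1.1.1, Num.floor (x.1.1.2 * 2 ^+ n) = k.1.1.2,
   Num.floor (x.1.2 * 2 ^+ n) = k.1.2 & Num.floor (x.2 * 2 ^+ n) = k.2]].

Lemma measurable_floor_eq d (X : measurableType d) (f : X -> T1) n (k : int) :
  measurable_fun setT f -> measurable [set x | Num.floor (f x * 2 ^+ n) = k].
Proof.
move=> mf; rewrite (_ : [set x | _] = f @^-1` `[k%:~R / 2 ^+ n, (k + 1)%:~R / 2 ^+ n[).
  by rewrite -[_ @^-1` _]setTI; apply: mf.
apply/seteqP; split => x /=; rewrite in_itv /= ler_pdivrMr ?exprn_gt0// ltr_pdivlMr ?exprn_gt0//.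
  by move=> <-; exact: floor_itv.
exact: floor_def.
Qed.

Lemma measurable_cube n k : measurable (cube n k).
Proof.
have [c1 c2 c3 c4] := @measurable_coord4 R.
rewrite (_ : cube n k = [set x : T4 | Num.floor (x.1.1.1 * 2 ^+ n) = k.1.1.1] `&`
  [set x : T4 | Num.floor (x.1.1.2 * 2 ^+ n) = k.1.1.2] `&`
  [set x : T4 | Num.floor (x.1.2 * 2 ^+ n) = k.1.2] `&`
  [set x : T4 | Num.floor (x.2 * 2 ^+ n) = k.2]).
  apply: measurableI; last exact: (measurable_floor_eq (f := fun x : T4 => x.2)).
  apply: measurableI; last exact: (measurable_floor_eq (f := fun x : T4 => x.1.2)).
  apply: measurableI; first exact: (measurable_floor_eq (f := fun x : T4 => x.1.1.1)).
  exact: (measurable_floor_eq (f := fun x : T4 => x.1.1.2)).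
by apply/seteqP; split => x /=; [move=> [? ? ? ?]|move=> [[[? ?] ?] ?]].
Qed.

Lemma toC2_dist (x y : T4) : vn (toC2 y - toC2 x) <=
  `|y.1.1.1 - x.1.1.1| + `|y.1.1.2 - x.1.1.2| + (`|y.1.2 - x.1.2| + `|y.2 - x.2|).
Proof.
rewrite /vn !mxE /=; apply: lerD; apply: le_trans (cabs_le_ReIm _) _; exact: lexx.
Qed.

(** An open set is the union of the dyadic cubes that it contains, and there are countably many of
    these. Sides of at most [d / 4] suffice, as [vn] adds up four real coordinates. *)
Lemma open_toC2_measurable (U : set V) : open U -> measurable (@toC2 R @^-1` U : set T4).
Proof.
move=> oU.
pose I : set (nat * (int * int * int * int)) := [set p | cube p.1 p.2 `<=` @toC2 R @^-1` U].
rewrite (_ : @toC2 R @^-1` U = \bigcup_(p in I) cube p.1 p.2).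
  pose F (p : nat * (int * int * int * int)) : set T4 := if `[< I p >] then cube p.1 p.2 else set0.
  rewrite (_ : \bigcup_(p in I) _ = \bigcup_p F p).
    apply: countable_bigcupT_measurable; first exact: countableP.
    by move=> p; rewrite /F; case: ifP => // _; exact: measurable_cube.
  apply/seteqP; split => x [p Ip Fx]; exists p => //.
    by rewrite /F asboolT.
    by move: Fx; rewrite /F; case: asboolP.
  by move: Fx; rewrite /F; case: asboolP.
apply/seteqP; split => x /=; last by move=> [p Ip]; apply: Ip.
move=> Ux; have [d [d0 Hd]] := open_vn oU Ux.
have d40 : 0 < d / 4 by rewrite divr_gt0.
have [n] := half_pow_small 1 d40; rewrite mul1r => hn.
exists (n, (Num.floor (x.1.1.1 * 2 ^+ n), Num.floor (x.1.1.2 * 2 ^+ n),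
  Num.floor (x.1.2 * 2 ^+ n), Num.floor (x.2 * 2 ^+ n))) => //.
move=> y /= [h1 h2 h3 h4]; apply: Hd; apply: le_trans (toC2_dist _ _) _.
have near a b : Num.floor (a * 2 ^+ n) = Num.floor (b * 2 ^+ n :> R) -> `|a - b| <= d / 4.
  move=> E; apply: le_trans hn.
  rewrite -[leRHS]mul1r ler_pdivlMr ?exprn_gt0// -[X in _ * X]ger0_norm ?exprn_ge0// -normrM mulrBl.
  have /andP[a1 a2] := floor_itv (a * 2 ^+ n); have /andP[b1 b2] := floor_itv (b * 2 ^+ n).
  rewrite E in a1 a2; rewrite intrD in a2 b2; rewrite ler_norml; apply/andP; split; lra.
have := near _ _ h1; have := near _ _ h2; have := near _ _ h3; have := near _ _ h4.
lra.
Qed.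

Lemma measurable_on_open (U : set V) (f : V -> R) : open U ->
  (forall z, U z -> forall e : R, 0 < e -> exists d : R, 0 < d /\
     forall w, vn (w - z) <= d -> `|f w - f z| <= e) ->
  measurable_fun (@toC2 R @^-1` U : set T4) (fun x => f (toC2 x)).
Proof.
move=> oU cf; apply: (measurability _ (RGenOpens.measurableE R)).
move=> _ [_ [a [b ->] <-]].
rewrite (_ : _ `&` _ = @toC2 R @^-1` (U `&` f @^-1` `]a, b[%classic)) //.
apply: open_toC2_measurable; rewrite openE => z [Uz /=]; rewrite in_itv /= => /andP[az zb].
have e0 : 0 < Num.min (f z - a) (b - f z) / 2.
  by rewrite divr_gt0// lt_min !subr_gt0 az.
have [d [d0 Hd]] := cf z Uz _ e0; have [d' [d'0 Hd']] := open_vn oU Uz.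
apply/nbhsV; exists (Num.min d d'); split; first by rewrite lt_min d0.
move=> w; rewrite le_min => /andP[/Hd h /Hd' Uw]; split => //=.
have m1 : Num.min (f z - a) (b - f z) <= f z - a by rewrite ge_min lexx.
have m2 : Num.min (f z - a) (b - f z) <= b - f z by rewrite ge_min lexx orbT.
move: h; rewrite in_itv /= ler_norml => /andP[h1 h2]; apply/andP; split; lra.
Qed.

End R4.

Section UnitaryV.
Variable R : realType.
Local Notation C := (complex R).
Local Notation V := 'cV[C]_2.

Lemma vn_mulmx (g : 'M[C]_2) (v : V) : vn (g *m v) <= (\sum_i \sum_j cabs (g i j)) * vn v.
Proof.
have h i : cabs ((g *m v) i 0) <= (\sum_j cabs (g i j)) * vn v.
  rewrite mxE (le_trans (cabs_sum _ _ _))// big_distrl /=; apply: ler_sum => j _.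
  by rewrite cabsM ler_wpM2l ?cabs_ge0// cabs_le_vn.
apply: le_trans (lerD (h 0) (h 1)) _; rewrite -mulrDl ler_wpM2r ?vn_ge0//.
rewrite [leRHS]big_ord_recl [X in _ <= _ + X]big_ord1.
by have -> : lift ord0 ord0 = 1 :> 'I_2 by exact: val_inj.
Qed.

Lemma vn_mulmx_le (g : 'M[C]_2) : exists k : R, 0 < k /\ forall v : V, vn (g *m v) <= k * vn v.
Proof.
pose k := \sum_i \sum_j cabs (g i j).
have k0 : 0 <= k by rewrite sumr_ge0// => i _; rewrite sumr_ge0// => j _; exact: cabs_ge0.
exists (k + 1); split; first by rewrite ltr_wpDl.
by move=> v; apply: le_trans (vn_mulmx g v) _; rewrite ler_wpM2r ?vn_ge0// lerDl.
Qed.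

Lemma mulmx_vn_cont (g : 'M[C]_2) (d : R) : 0 < d ->
  exists d' : R, 0 < d' /\ forall v w : V, vn (v - w) <= d' -> vn (g *m v - g *m w) <= d.
Proof.
move=> d0; have [k [k0 H]] := vn_mulmx_le g; exists (d / k); split; first by rewrite divr_gt0.
by move=> v w; rewrite ler_pdivlMr// mulrC -mulmxBr; apply: le_trans.
Qed.

Lemma unitaryC (g : 'M[C]_2) : unitary g -> (map_mx Num.conj g)^T *m g = 1%:M.
Proof. exact: mulmx1C. Qed.

Lemma hprod_mx (z e : V) : hprod z e = ((map_mx Num.conj e)^T *m z) 0 0.
Proof. by rewrite mxE /hprod; apply: eq_bigr => i _; rewrite !mxE mulrC. Qed.

Lemma hprod_unitary (g : 'M[C]_2) (z e : V) : unitary g -> hprod (g *m z) (g *m e) = hprod z e.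
Proof.
move=> /unitaryC gg; rewrite !hprod_mx map_mxM trmx_mul -mulmxA (mulmxA _ g) gg mul1mx.
by [].
Qed.

Lemma unitary_inv (g : 'M[C]_2) : unitary g ->
  [/\ g \in unitmx, invmx g = (map_mx Num.conj g)^T & unitary (invmx g)].
Proof.
move=> gu; have [gun e] : g \in unitmx /\ invmx g = (map_mx Num.conj g)^T.
  have gun : g \in unitmx by case/mulmx1_unit: gu.
  by split=> //; rewrite -[RHS]mul1mx -(mulVmx gun) -mulmxA gu mulmx1.
split=> //; rewrite e /unitary -[RHS](unitaryC gu); congr (_ *m _).
by apply/matrixP => i j; rewrite !mxE conjCK.
Qed.

Lemma unitary_det (g : 'M[C]_2) : unitary g -> cabs (\det g) = 1.
Proof.
move=> gu; have := congr1 determinant gu; rewrite det1 det_mulmx det_tr det_map_mx => h.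
have : cabs (\det g) ^+ 2 = 1 by rewrite expr2 -[X in _ * X]cabsJ -cabsM h cabs1.
by move/eqP; rewrite sqrp_eq1 ?cabs_ge0// => /eqP.
Qed.

Lemma unitary_detJ (g : 'M[C]_2) : unitary g -> \det g * (\det g)^* = 1.
Proof. by move=> gu; rewrite -normCK -cabsE unitary_det// expr1n. Qed.
End UnitaryV.

Lemma integral_cst_indic d (X : measurableType d) (R : realType) (m : {measure set X -> \bar R})
    (k : \bar R) (D : set X) : measurable D -> (0 <= k)%E ->
  (\int[m]_x (k * (\1_D x)%:E) = k * m D)%E.
Proof.
move=> mD k0; rewrite ge0_integralZl//; first by rewrite integral_indic// setIT.
by apply/measurable_EFinP; exact: measurable_indic.
Qed.

Lemma mule_cancel_fin (R : realType) (b u v : \bar R) :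
  (0 < b)%E -> (b < +oo)%E -> (b * u = b * v)%E -> u = v.
Proof.
case: b => [b| |]// b0 _ /(congr1 (fun t => ((b^-1)%:E * t)%E)).
by rewrite !muleA -EFinM mulVf ?mul1e// gt_eqF// -lte_fin.
Qed.

(** * Unitary invariance of volume *)

Section VolUnitary.
Variable R : realType.
Local Notation C := (complex R).
Local Notation V := 'cV[C]_2.
Notation T1 := (measurableTypeR R).
Notation T4 := (T1 * T1 * T1 * T1)%type.
Notation vol := (leb4 R).

Definition act (g : 'M[C]_2) (x : T4) : T4 := ofC2 (g *m toC2 x).

Lemma toC2_act g x : toC2 (act g x) = g *m toC2 x.
Proof. exact: ofC2K. Qed.

Lemma measurable_act g : measurable_fun setT (act g).
Proof.
have M f : (forall v w : V, `|f v - f w| <= vn (v - w)) ->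
    measurable_fun setT (fun x : T4 => f (g *m toC2 x) : T1).
  move=> hf; have := @measurable_on_open R setT (fun v => f (g *m v)) openT; apply.
  move=> z _ e e0; have [d [d0 H]] := mulmx_vn_cont g e0; exists d; split => // w /H.
  exact: le_trans.
have nR i (v w : V) : `|complex.Re (v i 0) - complex.Re (w i 0)| <= cabs ((v - w) i 0).
  by rewrite -raddfB (le_trans (normRe_le_cabs _))// !mxE.
have nI i (v w : V) : `|complex.Im (v i 0) - complex.Im (w i 0)| <= cabs ((v - w) i 0).
  by rewrite -raddfB (le_trans (normIm_le_cabs _))// !mxE.
have M1 := M (fun v => complex.Re (v 0 0)) (fun v w => le_trans (nR 0 v w) (cabs_le_vn _ _)).
have M2 := M (fun v => complex.Im (v 0 0)) (fun v w => le_trans (nI 0 v w) (cabs_le_vn _ _)).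
have M3 := M (fun v => complex.Re (v 1 0)) (fun v w => le_trans (nR 1 v w) (cabs_le_vn _ _)).
have M4 := M (fun v => complex.Im (v 1 0)) (fun v w => le_trans (nI 1 v w) (cabs_le_vn _ _)).
exact: (measurable_fun_pair (measurable_fun_pair (measurable_fun_pair M1 M2) M3) M4).
Qed.

Lemma measurable_shift_map d (X : measurableType d) (f h : X -> T4) :
  measurable_fun setT f -> measurable_fun setT h -> measurable_fun setT (fun x => shift4 (f x) (h x)).
Proof.
move=> mf mh; have [c1 c2 c3 c4] := @measurable_coord4 R.
have F := (measurableT_comp c1 mf, measurableT_comp c2 mf, measurableT_comp c3 mf, measurableT_comp c4 mf).
have H := (measurableT_comp c1 mh, measurableT_comp c2 mh, measurableT_comp c3 mh, measurableT_comp c4 mh).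
exact: (measurable_fun_pair (measurable_fun_pair (measurable_fun_pair
  (measurable_funD H.1.1.1 F.1.1.1) (measurable_funD H.1.1.2 F.1.1.2))
  (measurable_funD H.1.2 F.1.2)) (measurable_funD H.2 F.2)).
Qed.

Lemma toC2_shift a (x : T4) : toC2 (shift4 a x) = toC2 x + toC2 a.
Proof. by apply: cV2P; rewrite !mxE. Qed.

Definition unitball : set T4 :=
  [set x | x.1.1.1 ^+ 2 + x.1.1.2 ^+ 2 + (x.1.2 ^+ 2 + x.2 ^+ 2) <= 1].

Lemma measurable_unitball : measurable unitball.
Proof.
have [c1 c2 c3 c4] := @measurable_coord4 R.
pose f (x : T4) : T1 := x.1.1.1 ^+ 2 + x.1.1.2 ^+ 2 + (x.1.2 ^+ 2 + x.2 ^+ 2).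
have mf : measurable_fun setT f.
  exact: (measurable_funD (measurable_funD (measurable_funX 2 c1) (measurable_funX 2 c2))
   (measurable_funD (measurable_funX 2 c3) (measurable_funX 2 c4))).
rewrite (_ : unitball = f @^-1` `]-oo, 1]).
  by apply: measurable_preim mf _.
by apply/seteqP; split => x /=; rewrite in_itv.
Qed.

Definition box4 (a b : R) : set T4 :=
  `[a, b]%classic `*` `[a, b]%classic `*` `[a, b]%classic `*` `[a, b]%classic.

Lemma vol_box (a b : R) : a <= b ->
  vol (box4 a b) =
  (((b - a) ^+ 4)%:E)%E.
Proof.
move=> ab; have m : measurable (`[a, b]%classic : set T1) by [].
have l : @lebesgue_measure R `[a, b]%classic = (b - a)%:E.
  by rewrite lebesgue_measure_itv /= lte_fin; move: ab; rewrite le_eqVlt => /orP[/eqP ->|->]; rewrite ?ltxx ?subrr ?EFinB.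
rewrite /box4 /leb4 /= product_measure1E//=; last by apply: measurableX => //; exact: measurableX.
rewrite product_measure1E//=; last exact: measurableX.
rewrite product_measure1E//= !l -!EFinM.
by congr EFin; ring.
Qed.

(** The ball lies between the cubes [0, 1/2]^4 and [-1, 1]^4. A positive finite volume allows it to
    be cancelled in [vol_act]. *)
Lemma vol_unitball : (0 < vol unitball < +oo)%E.
Proof.
have m a b : measurable (box4 a b).
  have m1 : measurable (`[a, b]%classic : set T1) by [].
  exact: (measurableX (measurableX (measurableX m1 m1) m1) m1).
have h1 : (vol (box4 0 2^-1) <= vol unitball)%E.
  apply: le_measure; [apply/mem_set; exact: m|apply/mem_set; exact: measurable_unitball|].
  move=> x; rewrite /box4 /= => -[[[]]]; rewrite !in_itv /= => /andP[a1 a2] /andP[b1 b2] /andP[c1 c2] /andP[d1 d2].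
  have q (t : R) : 0 <= t -> t <= 2^-1 -> t ^+ 2 <= 4^-1 by move=> t0 t1; nra.
  by have := q _ a1 a2; have := q _ b1 b2; have := q _ c1 c2; have := q _ d1 d2; rewrite /unitball /=; lra.
have h2 : (vol unitball <= vol (box4 (- 1) 1))%E.
  apply: le_measure; [apply/mem_set; exact: measurable_unitball|apply/mem_set; exact: m|].
  move=> x; rewrite /unitball /box4 /= => h.
  have := sqr_ge0 x.1.1.1; have := sqr_ge0 x.1.1.2; have := sqr_ge0 x.1.2; have := sqr_ge0 x.2.
  move=> h1' h2' h3 h4.
  have q (t : R) : t ^+ 2 <= 1 -> t \in `[-1, 1].
    by move=> t1; rewrite in_itv /= -ler_norml -(@ler_pXn2r _ 2)// ?nnegrE// expr1n real_normK ?num_real.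
  by split; [split; [split|]|]; apply: q; lra.
rewrite vol_box ?invr_ge0// in h1; have b11 : (- 1 : R) <= 1 by lra.
rewrite (vol_box b11) in h2.
have p : (0 : R) < (2^-1 - 0) ^+ 4 by rewrite exprn_gt0// subr0 invr_gt0.
apply/andP; split; first by apply: lt_le_trans h1; rewrite lte_fin.
by apply: le_lt_trans h2 _; rewrite ltry.
Qed.

Lemma unitballE y : unitball y <-> hprod (toC2 y) (toC2 y) <= 1 :> C.
Proof.
have -> : hprod (toC2 y) (toC2 y) = ((y.1.1.1 ^+ 2 + y.1.1.2 ^+ 2 + (y.1.2 ^+ 2 + y.2 ^+ 2))%:C)%C :> C.
  rewrite hprodE !mxE /=; apply/eqP; rewrite eq_complex /=; apply/andP; split; apply/eqP; ring.
by rewrite (lecR _ 1).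
Qed.

Lemma unitball_act (g : 'M[C]_2) x : unitary g -> unitball (act g x) <-> unitball x.
Proof. by move=> gu; rewrite !unitballE toC2_act hprod_unitary. Qed.

Lemma leb4_shift a (A : set T4) : measurable A -> vol (shift4 a @^-1` A) = vol A.
Proof. exact: vol_shift. Qed.

(* Tonelli: both sides times the volume of the unit ball B equal the measure of {(x, y) | x in B, g x + y in A}. *)
Theorem vol_act (g : 'M[C]_2) (A : set T4) : unitary g -> measurable A ->
  vol (act g @^-1` A) = vol A.
Proof.
move=> gu mA; have [gun _ giu] := unitary_inv gu.
have mB := measurable_unitball; have /andP[B0 Boo] := vol_unitball.
pose S : set (T4 * T4) := [set p | unitball p.1 /\ A (shift4 (act g p.1) p.2)].
(* [S'] arises from [S] by replacing x by x - g^-1 y for each fixed y, so the sections at y are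
   translates of one another. *)
pose S' : set (T4 * T4) := [set p | unitball (shift4 (act (- invmx g) p.2) p.1) /\ A (act g p.1)].
have mS : measurable S.
  rewrite (_ : S = (fst @^-1` unitball) `&` ((fun p : T4 * T4 => shift4 (act g p.1) p.2) @^-1` A)) //.
  apply: measurableI; first exact: (measurable_preim (f := fst)).
  apply: measurable_preim => //; apply: measurable_shift_map; last exact: measurable_snd.
  exact: (measurableT_comp (measurable_act g) measurable_fst).
have mS' : measurable S'.
  rewrite (_ : S' = ((fun p : T4 * T4 => shift4 (act (- invmx g) p.2) p.1) @^-1` unitball) `&`
     ((act g \o fst) @^-1` A)) //.
  apply: measurableI.
    apply: measurable_preim => //; apply: measurable_shift_map; last exact: measurable_fst.
    exact: (measurableT_comp (measurable_act _) measurable_snd).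
  by apply: measurable_preim => //; exact: (measurableT_comp (measurable_act g) measurable_fst).
have sym (X : set (T4 * T4)) : measurable X ->
    (\int[vol]_x vol (xsection X x) = \int[vol]_y vol (ysection X y))%E.
  move=> mX; have := @product_measure_unique _ _ _ _ R vol vol (vol \x^ vol)%E.
  move=> /(_ _ X mX); rewrite /product_measure1 /product_measure2; apply.
  by move=> D1 D2 mD1 mD2; exact: (product_measure2E vol vol mD1 mD2).
have I1 : (\int[vol]_x vol (xsection S x) = vol A * vol unitball)%E.
  rewrite (_ : (fun x => _) = (fun x => vol A * (\1_unitball x)%:E)%E).
    by apply: integral_cst_indic; [assumption|exact: measure_ge0].
  apply/funext => x; rewrite indicE; have [xB|xB] := boolP (x \in unitball).
    rewrite mule1 -(leb4_shift (act g x) mA); f_equal; apply/seteqP; split => y; rewrite /xsection /= ?inE.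
      by move=> /set_mem[].
    by move=> Ay; apply/mem_set; split => //; exact/set_mem.
  rewrite mule0 (_ : xsection S x = set0) ?measure0//; apply/seteqP; split => y //.
  by rewrite /xsection /= => /set_mem[/= /mem_set]; rewrite (negbTE xB).
have I2 : (\int[vol]_x vol (xsection S' x) = vol unitball * vol (act g @^-1` A))%E.
  have mgA : measurable (act g @^-1` A) by apply: measurable_preim mA; exact: measurable_act.
  rewrite (_ : (fun x => _) = (fun x => vol unitball * (\1_(act g @^-1` A) x)%:E)%E).
    by apply: integral_cst_indic; [assumption|exact: measure_ge0].
  apply/funext => x; rewrite indicE; have [xB|xB] := boolP (x \in act g @^-1` A).
    rewrite mule1 -(leb4_shift (act (- g) x) mB); f_equal.
    (* The ball is invariant under -1 and under g^-1, so x - g^-1 y lies in it if and only if y - g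
       x does. As a condition on y this describes a translate of the ball. *)
    have key y : unitball (shift4 (act (- invmx g) y) x) <-> unitball (shift4 (act (- g) x) y).
      rewrite -(unitball_act (shift4 (act (- g) x) y) giu) -(unitball_act _ (g := - 1%:M)); last first.
        by rewrite /unitary map_mxN map_mx1 linearN /= trmx1 mulmxN mulNmx opprK mulmx1.
      suff -> : act (- 1%:M) (shift4 (act (- invmx g) y) x) = act (invmx g) (shift4 (act (- g) x) y) by [].
      rewrite /act; congr ofC2; rewrite !toC2_shift !toC2_act !mulmxDr !mulNmx !mul1mx !mulmxN mulmxA mulVmx// mul1mx opprK.
      by rewrite addrC.
    apply/seteqP; split => y; rewrite /xsection /=.
      by move=> /set_mem[/= /key].
    by move=> /key By; apply/mem_set; split => //; exact/set_mem.
  rewrite mule0 (_ : xsection S' x = set0) ?measure0//; apply/seteqP; split => y //.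
  by rewrite /xsection /= => /set_mem[/= _ Ax]; move/negP: xB; case; exact/mem_set.
have I12 : (\int[vol]_y vol (ysection S y) = \int[vol]_y vol (ysection S' y))%E.
  apply: eq_integral => y _.
  have mSy : measurable (ysection S y) by exact: measurable_ysection.
  rewrite -(leb4_shift (act (- invmx g) y) mSy); f_equal; apply/seteqP.
  have key x : A (shift4 (act g (shift4 (act (- invmx g) y) x)) y) <-> A (act g x).
    suff -> : shift4 (act g (shift4 (act (- invmx g) y) x)) y = act g x by [].
    rewrite -[LHS]toC2K -[RHS]toC2K; congr ofC2.
    rewrite !toC2_shift !toC2_act !toC2_shift !toC2_act mulmxDr mulNmx mulmxN mulmxA mulmxV// mul1mx.
    by rewrite addrC subrK.
  split => x; rewrite /ysection /=.
    by move=> /set_mem[/= h1 /key h2]; apply/mem_set; split.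
  by move=> /set_mem[/= h1 h2]; apply/mem_set; split => //=; apply/key.
have E : (vol unitball * vol (act g @^-1` A) = vol unitball * vol A)%E.
  etransitivity; first exact: (esym I2).
  etransitivity; first exact: (sym _ mS').
  etransitivity; first exact: (esym I12).
  etransitivity; first exact: (esym (sym _ mS)).
  etransitivity; first exact: I1.
  exact: muleC.
move: B0 Boo E; generalize (vol unitball) (vol (act g @^-1` A)) (vol A) => b u v.
exact: mule_cancel_fin.
Qed.
End VolUnitary.

Lemma integrable_dominated d (X : measurableType d) (R : realType) (m : {measure set X -> \bar R})
    (D : set X) (b f : X -> R) : measurable D -> m.-integrable D (fun x => (b x)%:E) ->
  measurable_fun D f -> (forall x, D x -> `|f x| <= b x) -> m.-integrable D (fun x => (f x)%:E).
Proof.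
move=> mD ib mf fb; apply: (le_integrable mD _ _ ib); first exact/measurable_EFinP.
by move=> x Dx /=; rewrite lee_fin (le_trans (fb x Dx))// ler_norm.
Qed.

Lemma integral_ge_subset d (X : measurableType d) (R : realType) (m : {measure set X -> \bar R})
    (D B : set X) (f : X -> R) (c : R) : measurable D -> measurable B -> B `<=` D -> 0 <= c ->
  measurable_fun D f -> (forall x, D x -> 0 <= f x) -> (forall x, B x -> c <= f x) ->
  (c%:E * m B <= \int[m]_(x in D) (f x)%:E)%E.
Proof.
move=> mD mB BD c0 mf f0 fc.
have <- : (\int[m]_(x in B) (cst c%:E) x = c%:E * m B)%E by rewrite integral_cst.
apply: le_trans (_ : \int[m]_(x in B) (f x)%:E <= _)%E.
  apply: ge0_le_integral; [exact: mB|by []|exact: measurable_cst| |].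
    by apply/measurable_EFinP; exact: measurable_funS mf.
  by move=> x Bx; rewrite lee_fin fc.
apply: ge0_subset_integral; [exact: mB|exact: mD|exact/measurable_EFinP| |exact: BD].
by move=> x Dx; rewrite lee_fin f0.
Qed.

(** * Integration and square-integrable functions on an open set *)

Section Integrals.
Variable R : realType.
Local Notation C := (complex R).
Local Notation V := 'cV[C]_2.
Notation T1 := (measurableTypeR R).
Notation T4 := (T1 * T1 * T1 * T1)%type.
Notation vol := (@vol R).
Variable E : set V.
Hypothesis oE : open E.
Notation E' := (@toC2 R @^-1` E : set T4).

Let mE : measurable E'. Proof. exact: open_toC2_measurable. Qed.

Lemma cintE (f : V -> C) : cint E f =
  Complex (Rintegral vol E' (fun x => complex.Re (f (toC2 x))))
          (Rintegral vol E' (fun x => complex.Im (f (toC2 x)))).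
Proof. by rewrite /cint [RHS]complexE. Qed.

Definition cmeas (f : V -> C) := measurable_fun E' (fun x => complex.Re (f (toC2 x))) /\
  measurable_fun E' (fun x => complex.Im (f (toC2 x))).

Definition cintg (f : V -> C) := vol.-integrable E' (fun x => (complex.Re (f (toC2 x)))%:E) /\
  vol.-integrable E' (fun x => (complex.Im (f (toC2 x)))%:E).

Lemma cmeasM f h : cmeas f -> cmeas h -> cmeas (fun w => f w * h w).
Proof.
move=> [f1 f2] [h1 h2]; split.
  rewrite (_ : (fun x => _) = (fun x : T4 => complex.Re (f (toC2 x)) * complex.Re (h (toC2 x))
    - complex.Im (f (toC2 x)) * complex.Im (h (toC2 x)))).
    exact: (measurable_funB (measurable_funM f1 h1) (measurable_funM f2 h2)).
  by apply/funext => x; case: (f _); case: (h _).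
rewrite (_ : (fun x => _) = (fun x : T4 => complex.Re (f (toC2 x)) * complex.Im (h (toC2 x))
    + complex.Im (f (toC2 x)) * complex.Re (h (toC2 x)))).
  exact: (measurable_funD (measurable_funM f1 h2) (measurable_funM f2 h1)).
by apply/funext => x; case: (f _); case: (h _).
Qed.

Lemma cmeasJ f : cmeas f -> cmeas (fun w => (f w)^*).
Proof.
move=> [f1 f2]; split.
  by rewrite (_ : (fun x => _) = (fun x : T4 => complex.Re (f (toC2 x))))//; apply/funext => x; case: (f _).
rewrite (_ : (fun x => _) = (fun x : T4 => - complex.Im (f (toC2 x)))); first exact: measurable_funN.
by apply/funext => x; case: (f _).
Qed.

Lemma cmeasB f h : cmeas f -> cmeas h -> cmeas (fun w => f w - h w).
Proof.
move=> [f1 f2] [h1 h2]; split.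
  rewrite (_ : (fun x => _) = (fun x : T4 => complex.Re (f (toC2 x)) - complex.Re (h (toC2 x)))).
    exact: measurable_funB.
  by apply/funext => x; rewrite raddfB.
rewrite (_ : (fun x => _) = (fun x : T4 => complex.Im (f (toC2 x)) - complex.Im (h (toC2 x)))).
  exact: measurable_funB.
by apply/funext => x; rewrite raddfB.
Qed.

Lemma cmeas_cabs2 f : cmeas f -> measurable_fun E' (fun x => cabs (f (toC2 x)) ^+ 2).
Proof.
move=> [f1 f2]; rewrite (_ : (fun x => _) = (fun x : T4 => complex.Re (f (toC2 x)) ^+ 2 + complex.Im (f (toC2 x)) ^+ 2)).
  exact: (measurable_funD (measurable_funX 2 f1) (measurable_funX 2 f2)).
by apply/funext => x; rewrite /cabs sqr_sqrtr// addr_ge0// sqr_ge0.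
Qed.

Lemma cmeas_cont f : (forall z, E z -> forall e : R, 0 < e -> exists d : R, 0 < d /\
     forall w, vn (w - z) <= d -> cabs (f w - f z) <= e) -> cmeas f.
Proof.
move=> cf; split.
  apply: (@measurable_on_open R E (fun v => complex.Re (f v))) => // z Ez e /(cf z Ez)[d [d0 H]].
  exists d; split => // w /H; apply: le_trans; rewrite -raddfB; exact: normRe_le_cabs.
apply: (@measurable_on_open R E (fun v => complex.Im (f v))) => // z Ez e /(cf z Ez)[d [d0 H]].
exists d; split => // w /H; apply: le_trans; rewrite -raddfB; exact: normIm_le_cabs.
Qed.

Lemma cintg_dom (f : V -> C) (b : T4 -> R) : cmeas f -> vol.-integrable E' (fun x => (b x)%:E) ->
  (forall x, E' x -> cabs (f (toC2 x)) <= b x) -> cintg f.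
Proof.
move=> [f1 f2] ib fb; split; apply: (integrable_dominated mE ib) => // x Ex.
  by apply: le_trans (fb x Ex); exact: normRe_le_cabs.
by apply: le_trans (fb x Ex); exact: normIm_le_cabs.
Qed.

Lemma cintB f h : cintg f -> cintg h -> cint E (fun w => f w - h w) = cint E f - cint E h.
Proof.
move=> [f1 f2] [h1 h2]; rewrite !cintE.
rewrite [RHS]/GRing.add /=; congr Complex; rewrite -RintegralB//;
  by apply: eq_Rintegral => x _; rewrite raddfB.
Qed.

Lemma eq_cint f h : (forall z, E z -> f z = h z) -> cint E f = cint E h.
Proof.
by move=> fh; rewrite !cintE; congr Complex; apply: eq_Rintegral => x /set_mem /= Ex; rewrite fh.
Qed.

Lemma L2_cmeas f : L2 E f -> cmeas f. Proof. by case. Qed.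

Lemma L2_mul f h : L2 E f -> L2 E h -> cintg (fun w => f w * (h w)^*).
Proof.
move=> [f1 f2 f3] [h1 h2 h3].
apply: (@cintg_dom _ (fun x => cabs (f (toC2 x)) ^+ 2 + cabs (h (toC2 x)) ^+ 2)).
- by apply: cmeasM => //; apply: cmeasJ.
- exact: (integrableD mE f3 h3).
- move=> x Ex; rewrite cabsM cabsJ; have := sqr_ge0 (cabs (f (toC2 x)) - cabs (h (toC2 x))).
  have := sqr_ge0 (cabs (f (toC2 x))); have := sqr_ge0 (cabs (h (toC2 x))); rewrite sqrrB; lra.
Qed.

Lemma L2B f h : L2 E f -> L2 E h -> L2 E (fun w => f w - h w).
Proof.
move=> Lf Lh; have [m1 m2] := cmeasB (L2_cmeas Lf) (L2_cmeas Lh).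
case: Lf Lh => [f1 f2 f3] [h1 h2 h3]; split => //.
have ib : vol.-integrable E' (fun x => (cabs (f (toC2 x)) ^+ 2 + cabs (h (toC2 x)) ^+ 2 +
   (cabs (f (toC2 x)) ^+ 2 + cabs (h (toC2 x)) ^+ 2))%:E).
  exact: (integrableD mE (integrableD mE f3 h3) (integrableD mE f3 h3)).
apply: (integrable_dominated mE ib); first exact: (@cmeas_cabs2 (fun w => f w - h w)).
move=> x Ex; rewrite ger0_norm ?sqr_ge0//.
have H := cabsD (f (toC2 x)) (- h (toC2 x)); rewrite cabsN in H.
have a0 := cabs_ge0 (f (toC2 x)); have b0 := cabs_ge0 (h (toC2 x)).
have := sqr_ge0 (cabs (f (toC2 x)) - cabs (h (toC2 x))); rewrite sqrrB => h4.
have : cabs (f (toC2 x) - h (toC2 x)) ^+ 2 <= (cabs (f (toC2 x)) + cabs (h (toC2 x))) ^+ 2.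
  by rewrite lerXn2r ?nnegrE ?cabs_ge0 ?addr_ge0.
rewrite sqrrD; lra.
Qed.

(** The bound from below holds on a small cube about [w0] inside [E], and this cube has positive
    volume. Its half-side is a quarter of the allowed distance because [vn] adds up four real
    coordinates. *)
Lemma Rintegral_pos (phi : V -> R) w0 (d c : R) : vol.-integrable E' (fun x => (phi (toC2 x))%:E) ->
  (forall w, E w -> 0 <= phi w) -> E w0 -> 0 < d -> 0 < c ->
  (forall w, vn (w - w0) <= d -> c <= phi w) ->
  Rintegral vol E' (fun x => phi (toC2 x)) <> 0.
Proof.
move=> iphi phi0 Ew0 d0 c0 hc I0.
have [d' [d'0 Hd']] := open_vn oE Ew0.
pose n := Num.min d d' / 4; have n0 : 0 < n by rewrite divr_gt0// lt_min d0.
pose o := ofC2 w0; pose no : T4 := (- o.1.1.1, - o.1.1.2, - o.1.2, - o.2).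
pose B := shift4 no @^-1` (box4 (- n) n).
have mb : measurable (box4 (- n) n).
  have m1 : measurable (`[- n, n]%classic : set T1) by [].
  exact: (measurableX (measurableX (measurableX m1 m1) m1) m1).
have mB : measurable B by apply: measurable_preim mb; exact: measurable_shift4.
have volB : vol B = ((n + n) ^+ 4)%:E.
  by rewrite vol_shift// -[LHS]/(leb4 R (box4 (- n) n)) vol_box ?opprK// ge0_cp// ltW.
have Bd x : B x -> vn (toC2 x - w0) <= Num.min d d'.
  rewrite /B /box4 /= => -[[[]]]; rewrite !in_itv /= -!ler_norml => h1 h2 h3 h4.
  have := toC2_dist o x; rewrite /o ofC2K => /le_trans; apply.
  have -> : Num.min d d' = n + n + (n + n) by rewrite /n; field.
  by rewrite !lerD.
have BE : B `<=` E' by move=> x /Bd; rewrite le_min => /andP[_ /Hd'].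
have : (c%:E * vol B <= \int[vol]_(x in E') (phi (toC2 x))%:E)%E.
  apply: (integral_ge_subset _ mE mB BE (ltW c0)).
  - by apply/measurable_EFinP; exact: (measurable_int vol).
  - by move=> x Ex; exact: phi0.
  - by move=> x Bx; apply: hc; apply: le_trans (Bd _ Bx) _; rewrite ge_min lexx.
have fin := integrable_fin_num mE iphi.
move: I0; rewrite /Rintegral => I0; rewrite -(fineK fin) I0 volB -EFinM lee_fin leNgt mulr_gt0//.
by rewrite exprn_gt0// addr_gt0.
Qed.

Section Act.
Variable g : 'M[C]_2.
Hypothesis gu : unitary g.
Hypothesis gE : forall v, E (g *m v) <-> E v.

Lemma act_preE : act g @^-1` E' = E'.
Proof. by apply/seteqP; split => x; rewrite /= toC2_act => /gE. Qed.

Lemma ge0_int_act (k : T4 -> \bar R) : measurable_fun E' k -> (forall x, (0 <= k x)%E) ->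
  (\int[vol]_(x in E') (k (act g x)) = \int[vol]_(x in E') k x)%E.
Proof.
move=> mk k0; rewrite -[in LHS]act_preE.
rewrite -(@ge0_integral_pushforward _ _ _ _ _ _ (measurable_act g) vol E' k mE mk (fun x _ => k0 x)).
apply: eq_measure_integral; [exact: measurable_act|move=> ? A mA _; exact: (vol_act gu mA)].
Qed.

Lemma int_act (k : T4 -> \bar R) : measurable_fun E' k ->
  (\int[vol]_(x in E') (k (act g x)) = \int[vol]_(x in E') k x)%E.
Proof.
move=> mk; rewrite integralE [RHS]integralE; congr (_ - _)%E.
  rewrite -(@ge0_int_act (k^\+)%E); [|exact: measurable_funepos|by move=> x; exact: funepos_ge0].
  by rewrite -[fun x => k (act g x)]/(k \o act g) funepos_comp.
rewrite -(@ge0_int_act (k^\-)%E); [|exact: measurable_funeneg|by move=> x; exact: funeneg_ge0].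
by rewrite -[fun x => k (act g x)]/(k \o act g) funeneg_comp.
Qed.

Lemma cint_act f : cmeas f -> cint E (fun w => f (g *m w)) = cint E f.
Proof.
move=> [f1 f2]; rewrite !cintE; congr Complex; rewrite /Rintegral; congr fine.
  rewrite -[RHS](@int_act (fun x => (complex.Re (f (toC2 x)))%:E)); last exact/measurable_EFinP.
  by apply: eq_integral => x _; rewrite toC2_act.
rewrite -[RHS](@int_act (fun x => (complex.Im (f (toC2 x)))%:E)); last exact/measurable_EFinP.
by apply: eq_integral => x _; rewrite toC2_act.
Qed.

Lemma measurable_fun_act (h : T4 -> R) : measurable_fun E' h -> measurable_fun E' (fun x => h (act g x)).
Proof.
move=> mh; apply: (@measurable_comp _ _ _ _ _ _ E' h E' (act g)) => //.
  by move=> _ [x Ex <-]; rewrite -act_preE in Ex.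
by apply: measurable_funTS; exact: measurable_act.
Qed.

Lemma cmeas_act f : cmeas f -> cmeas (fun w => f (g *m w)).
Proof.
move=> [f1 f2]; split.
  by have := measurable_fun_act f1; under eq_fun do rewrite toC2_act.
by have := measurable_fun_act f2; under eq_fun do rewrite toC2_act.
Qed.

Lemma L2_act f : L2 E f -> L2 E (fun w => f (g *m w)).
Proof.
move=> Lf; have [m1 m2] := cmeas_act (L2_cmeas Lf); case: Lf => f1 f2 f3; split => //.
have /integrableP[mf ifin] := f3; apply/integrableP; split.
  by apply/measurable_EFinP; exact: (@cmeas_cabs2 (fun w => f (g *m w))).
have := @ge0_int_act (fun x => `|(cabs (f (toC2 x)) ^+ 2)%:E|%E) _ _.
rewrite (_ : (fun x : T4 => `|(cabs (f (toC2 (act g x))) ^+ 2)%:E|%E) =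
  (fun x : T4 => `|(cabs (f (g *m toC2 x)) ^+ 2)%:E|%E)); last first.
  by apply/funext => x; rewrite toC2_act.
move=> ->//; apply: measurableT_comp => //.
Qed.
End Act.
End Integrals.

Lemma integrable_cst_fin d (X : measurableType d) (R : realType) (m : {measure set X -> \bar R})
    (D : set X) (c : R) : measurable D -> (m D < +oo)%E -> m.-integrable D (fun=> c%:E).
Proof.
move=> mD fD; apply/integrableP; split; first exact: measurable_cst.
rewrite (_ : (fun _ => _) = cst `|c|%:E)%E; last by apply/funext => x.
rewrite integral_cst//; have : m D \is a fin_num by rewrite ge0_fin_numE.
by move=> /fineK <-; rewrite -EFinM ltry.
Qed.

(** * Invariance of the Bergman kernel under unitary symmetries of the domain *)

Section KernelInvariance.
Variable R : realType.
Local Notation C := (complex R).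
Local Notation V := 'cV[C]_2.
Notation T1 := (measurableTypeR R).
Notation T4 := (T1 * T1 * T1 * T1)%type.

Lemma differentiable_vn_cont (f : V -> C) z : differentiable f z ->
  forall e : R, 0 < e -> exists d : R, 0 < d /\ forall w, vn (w - z) <= d -> cabs (f w - f z) <= e.
Proof.
move=> /differentiable_continuous /cvgrPdist_le H e e0.
have /H/nbhsV[d [d0 Hd]] : 0 < (e%:C)%C by rewrite ltcR.
by exists d; split => // w /Hd; rewrite -cabsE lecR cabsB.
Qed.

Lemma differentiable_mulmx (g : 'M[C]_2) (v : V) : differentiable (fun w : V => g *m w) v.
Proof.
apply: (@linear_differentiable _ _ _ (mulmx g)) => z A /nbhsV[e [e0 H]]; apply/nbhsV.
have [d [d0 Hd]] := mulmx_vn_cont g e0; exists d; split => // w hw.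
by apply: H; exact: Hd.
Qed.

Variables (E : set V) (K : V -> V -> C) (M : R).
Hypotheses (oE : open E) (bE : forall v, E v -> vn v <= M).
Hypothesis bK : bergman_kernel E K.
Notation E' := (@toC2 R @^-1` E : set T4).
Notation vol := (@vol R).

Let mE : measurable E'. Proof. exact: open_toC2_measurable. Qed.

(** It makes bounded measurable functions on [E] square-integrable. *)
Lemma finite_volume : (vol E' < +oo)%E.
Proof.
have [N [N0 bN]] : exists N, 0 <= N /\ forall v, E v -> vn v <= N.
  by exists `|M|; split => // v /bE /le_trans; apply; exact: ler_norm.
have m1 : measurable (`[- N, N]%classic : set T1) by [].
have mb : measurable (box4 (- N) N) by exact: (measurableX (measurableX (measurableX m1 m1) m1) m1).
have NN : - N <= N by rewrite ge0_cp//.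
apply: (@le_lt_trans _ _ (vol (box4 (- N) N))); last first.
  by rewrite -[vol _]/(leb4 R (box4 (- N) N)) vol_box// ltry.
apply: le_measure; [exact/mem_set|exact/mem_set|].
move=> x /= /bN hx.
have h0 := le_trans (cabs_le_vn (toC2 x) 0) hx; have h1 := le_trans (cabs_le_vn (toC2 x) 1) hx.
have [e0 e1] := toC2E x.
rewrite /box4 /=; split; [split; [split|]|]; rewrite in_itv /= -ler_norml.
- by apply: le_trans h0; have := normRe_le_cabs (toC2 x 0 0); rewrite e0.
- by apply: le_trans h0; have := normIm_le_cabs (toC2 x 0 0); rewrite e0.
- by apply: le_trans h1; have := normRe_le_cabs (toC2 x 1 0); rewrite e1.
- by apply: le_trans h1; have := normIm_le_cabs (toC2 x 1 0); rewrite e1.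
Qed.

Lemma kernel_conj_cont z w : E z -> E w -> forall e : R, 0 < e ->
  exists d : R, 0 < d /\ forall w', vn (w' - w) <= d -> cabs (K z w' - K z w) <= e.
Proof.
move=> Ez Ew e e0; have [d [d0 H]] := differentiable_vn_cont (bK.1 z Ez w Ew) e0.
by exists d; split => // w' /H; rewrite -rmorphB cabsJ.
Qed.

Lemma kernel_cmeas z : E z -> cmeas E (K z).
Proof. by move=> Ez; apply: cmeas_cont => // w Ew; exact: kernel_conj_cont. Qed.

Lemma kernel_cintg z f : E z -> L2 E f -> cintg E (fun w => K z w * f w).
Proof.
move=> Ez Lf; have [H _ _] := bK.2 f Lf.
apply: (@cintg_dom _ E oE _ (fun x => cabs (K z (toC2 x) * f (toC2 x)))); [|exact: H|by []].
by apply: cmeasM; [exact: kernel_cmeas|exact: L2_cmeas].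
Qed.

Definition proj f z := cint E (fun w => K z w * f w).

Lemma A2B f h : A2 E f -> A2 E h -> A2 E (fun w => f w - h w).
Proof.
move=> [f1 f2] [h1 h2]; split; last exact: L2B.
by move=> z Ez; exact: (differentiableB (f1 z Ez) (h1 z Ez)).
Qed.

Section G.
Variable g : 'M[C]_2.
Hypotheses (gu : unitary g) (gE : forall v, E (g *m v) <-> E v).

Let giu : unitary (invmx g). Proof. by have [] := unitary_inv gu. Qed.
Let gun : g \in unitmx. Proof. by have [] := unitary_inv gu. Qed.
Let giE v : E (invmx g *m v) <-> E v.
Proof. by rewrite -gE mulmxA mulmxV// mul1mx. Qed.

Lemma A2_mul h : A2 E h -> A2 E (fun w => h (g *m w)).
Proof.
move=> [h1 h2]; split; last exact: L2_act.
move=> z Ez; apply: (@differentiable_comp _ _ _ _ (fun w : V => g *m w) h).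
  exact: differentiable_mulmx.
by apply: h1; apply/gE.
Qed.

(** Elements of [L2] are functions rather than classes, so a vanishing norm is turned into a
    vanishing value at a point of continuity. *)
Lemma norm2_eq0 (u : V -> C) w0 : cintg E (fun w => u w * (u w)^*) ->
  cint E (fun w => u w * (u w)^*) = 0 -> E w0 ->
  (forall e : R, 0 < e -> exists d : R, 0 < d /\ forall w, vn (w - w0) <= d -> cabs (u w - u w0) <= e) ->
  u w0 = 0.
Proof.
move=> [iu _] /eqP; rewrite cintE eq_complex /= => /andP[/eqP I0 _] Ew0 cu.
apply/eqP; rewrite -cabs_eq0; apply: contraT => u0.
have u0' : 0 < cabs (u w0) by rewrite lt_def u0 cabs_ge0.
have [d [d0 Hd]] := cu (cabs (u w0) / 2) ltac:(by rewrite divr_gt0).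
have Re2 w : complex.Re (u w * (u w)^*) = cabs (u w) ^+ 2.
  by rewrite -normCK -cabsE -rmorphXn.
exfalso; apply: (@Rintegral_pos _ E oE (fun w => complex.Re (u w * (u w)^*)) w0 d ((cabs (u w0) / 2) ^+ 2)).
- exact: iu.
- by move=> w _; rewrite Re2 sqr_ge0.
- exact: Ew0.
- exact: d0.
- by rewrite exprn_gt0// divr_gt0.
- move=> w /Hd h; have h2 : cabs (u w0) / 2 <= cabs (u w).
    have := cabsD (u w) (u w0 - u w); rewrite addrC subrK [cabs (u w0 - _)]cabsB; lra.
  by rewrite Re2; apply: lerXn2r h2; rewrite nnegrE ?cabs_ge0// divr_ge0// cabs_ge0.
- exact: I0.
Qed.

(** Uniqueness of the orthogonal projection: both sides, as functions of [z], lie in [A2] and differ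
    from [f] by something orthogonal to their difference [u]. Subtraction shows that [u] has norm
    0. *)
Lemma projection_invariant f z : L2 E f -> E z -> proj f z = proj (fun w => f (invmx g *m w)) (g *m z).
Proof.
move=> Lf Ez; pose f' w := f (invmx g *m w).
have Lf' : L2 E f' by exact: (L2_act oE giu giE Lf).
have [_ Af orf] := bK.2 f Lf; have [_ Af' orf'] := bK.2 f' Lf'.
pose P := proj f; pose P' z := proj f' (g *m z).
have AP' : A2 E P' by exact: (A2_mul Af').
pose u z := P z - P' z; have Au : A2 E u by exact: A2B.
have gK : cancel (mulmx g) (mulmx (invmx g) : V -> V) by move=> v; rewrite mulmxA mulVmx// mul1mx.
have Aui : A2 E (fun w => u (invmx g *m w)).
  have [u1 u2] := Au; split; last exact: (L2_act oE giu giE u2).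
  move=> v Ev; apply: (@differentiable_comp _ _ _ _ (fun w : V => invmx g *m w) u).
    exact: differentiable_mulmx.
  by apply: u1; apply/giE.
have o1 : cint E (fun w => (f w - P w) * (u w)^*) = 0 by exact: orf.
have o2 : cint E (fun w => (f w - P' w) * (u w)^*) = 0.
  rewrite -(orf' _ Aui) -[RHS](@cint_act _ E oE g gu gE).
    by apply: eq_cint => w _; rewrite /f' /P' !gK.
  apply: cmeasM; first by apply: cmeasB => //; [exact: L2_cmeas|exact: L2_cmeas Af'.2].
  by apply: cmeasJ; exact: L2_cmeas Aui.2.
have Lu := Au.2; have i1 : cintg E (fun w => (f w - P w) * (u w)^*) by apply: L2_mul => //; apply: L2B => //; exact: Af.2.
have i2 : cintg E (fun w => (f w - P' w) * (u w)^*) by apply: L2_mul => //; apply: L2B => //; exact: AP'.2.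
have o3 : cint E (fun w => u w * (u w)^*) = 0.
  rewrite -[RHS](subrr 0) -{1}o2 -o1 -cintB//; apply: eq_cint => w _.
  by rewrite -mulrBl; congr (_ * _); rewrite /u; ring.
have := @norm2_eq0 u z (L2_mul oE Lu Lu) o3 Ez (differentiable_vn_cont (Au.1 z Ez)).
by move/eqP; rewrite subr_eq0 => /eqP.
Qed.

(** By invariance of the projection, [K z] and [k] have the same integral against every [f] in [L2].
    The test function is the conjugate of their difference [d], cut off to a small ball about [w] so
    that it is bounded; then the integral of |f|^2 is 0 and [d w = 0] by continuity. *)
Theorem kernel_invariant z w : E z -> E w -> K (g *m z) (g *m w) = K z w.
Proof.
move=> Ez Ew; have Egz : E (g *m z) by apply/gE.
pose k w := K (g *m z) (g *m w); pose d w := K z w - k w.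
have ck v : E v -> forall e : R, 0 < e -> exists d : R, 0 < d /\ forall v', vn (v' - v) <= d -> cabs (k v' - k v) <= e.
  move=> Ev e e0; have dk : differentiable (fun v => (k v)^*) v.
    apply: (@differentiable_comp _ _ _ _ (fun w : V => g *m w) (fun v => (K (g *m z) v)^*)).
      exact: differentiable_mulmx.
    by apply: bK.1 => //; apply/gE.
  have [d0 [d00 H]] := differentiable_vn_cont dk e0.
  by exists d0; split => // w' /H; rewrite -rmorphB cabsJ.
have cd v : E v -> forall e : R, 0 < e -> exists d0 : R, 0 < d0 /\ forall v', vn (v' - v) <= d0 -> cabs (d v' - d v) <= e.
  move=> Ev e e0; have e2 : 0 < e / 2 by rewrite divr_gt0.
  have [d1 [d10 H1]] := kernel_conj_cont Ez Ev e2; have [d2 [d20 H2]] := ck v Ev _ e2.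
  exists (Num.min d1 d2); split; first by rewrite lt_min d10.
  move=> v'; rewrite le_min => /andP[/H1 h1 /H2 h2].
  rewrite /d opprD addrACA -opprD (splitr e) (le_trans (cabsD _ _))// cabsN lerD//.
have md : cmeas E d by apply: cmeas_cont.
have [r [r0 Hr]] := cd w Ew 1 ltr01.
have oB : open [set v | vn (v - w) < r].
  rewrite openE => v /= hv; apply/nbhsV; exists ((r - vn (v - w)) / 2).
  split; first by rewrite divr_gt0// subr_gt0.
  move=> v' h; rewrite /=; apply: le_lt_trans (_ : vn (v' - v) + vn (v - w) < r).
    by rewrite -[v' - w](subrKA v) vnD.
  by lra.
pose ind v : C := if vn (v - w) < r then 1 else 0.
have mind : cmeas E ind.
  have mB : measurable (@toC2 R @^-1` [set v | vn (v - w) < r] : set T4) by exact: open_toC2_measurable.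
  have mi : measurable_fun E' (fun x : T4 => \1_(@toC2 R @^-1` [set v | vn (v - w) < r]) x : R).
    by apply: measurable_funTS; exact: measurable_indic.
  split.
    rewrite (_ : (fun x => _) = (fun x : T4 => \1_(@toC2 R @^-1` [set v | vn (v - w) < r]) x)) //.
    by apply/funext => x; rewrite indicE /ind; case: ifPn => [h|/negP h]; [rewrite mem_set|rewrite memNset].
  rewrite (_ : (fun x => _) = (fun x : T4 => 0)); first exact: measurable_cst.
  by apply/funext => x; rewrite /ind; case: ifP.
pose f v := (d v)^* * ind v.
have mf : cmeas E f by apply: cmeasM => //; exact: cmeasJ.
have bf v : cabs (f v) <= cabs (d w) + 1.
  rewrite /f cabsM cabsJ /ind; case: ifP => [/ltW/Hr h|_]; last by rewrite cabs0 mulr0 addr_ge0// cabs_ge0.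
  rewrite cabs1 mulr1 -[d v](subrK (d w)) addrC (le_trans (cabsD _ _))// lerD2l//.
have Lf : L2 E f.
  have [mf1 mf2] := mf; split => //.
  apply: (integrable_dominated (b := fun=> (cabs (d w) + 1) ^+ 2) mE).
  - by apply: integrable_cst_fin => //; exact: finite_volume.
  - exact: cmeas_cabs2 mf.
  - by move=> x _; rewrite ger0_norm ?sqr_ge0// lerXn2r ?nnegrE ?cabs_ge0 ?addr_ge0 ?cabs_ge0.
have Lf' : L2 E (fun v => f (invmx g *m v)) by exact: (L2_act oE giu giE Lf).
have gK : cancel (mulmx g) (mulmx (invmx g) : V -> V) by move=> v; rewrite mulmxA mulVmx// mul1mx.
have I1 : cint E (fun v => K z v * f v) = cint E (fun v => k v * f v).
  rewrite -[LHS]/(proj f z) (projection_invariant Lf Ez) /proj -[LHS](@cint_act _ E oE g gu gE).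
    by apply: eq_cint => v _; rewrite gK.
  by apply: cmeasM; [exact: kernel_cmeas|exact: L2_cmeas].
(* On the support of [f] the product [d * f] is |f|^2, so [k * f] is the integrable function
   [K z * f] minus a bounded one. *)
have kf : cintg E (fun v => k v * f v).
  have mk : cmeas E k by apply: cmeas_cont.
  have := kernel_cintg Ez Lf => -[i1 i2].
  apply: (@cintg_dom _ E oE _ (fun x => cabs (K z (toC2 x) * f (toC2 x)) + (cabs (d w) + 1) ^+ 2)).
  - exact: cmeasM.
  - have [H _ _] := bK.2 f Lf.
    have := integrableD mE (H z Ez) (integrable_cst_fin ((cabs (d w) + 1) ^+ 2) mE finite_volume).
    by apply.
  - move=> x Ex; have -> : k (toC2 x) * f (toC2 x) = K z (toC2 x) * f (toC2 x) - d (toC2 x) * f (toC2 x).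
      by rewrite /d; ring.
    rewrite (le_trans (cabsD _ _))// cabsN lerD2l.
    have -> : cabs (d (toC2 x) * f (toC2 x)) = cabs (f (toC2 x)) ^+ 2.
      rewrite /f /ind; case: ifP => _; last by rewrite !mulr0 cabs0 expr0n.
      by rewrite mulr1 cabsM cabsJ expr2.
    by rewrite lerXn2r ?nnegrE ?cabs_ge0 ?addr_ge0 ?cabs_ge0.
pose u v := (f v)^*.
have uE v : u v * (u v)^* = K z v * f v - k v * f v.
  rewrite /u conjCK -mulrBl -/(d v) /f /ind; case: ifP => _; last by rewrite !mulr0.
  by rewrite !mulr1 conjCK.
have : u w = 0.
  apply: norm2_eq0 => //.
  - rewrite (_ : (fun v => _) = (fun v => (f v)^* * ((f v)^*)^*))//.
    have Lu : L2 E u.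
      have [mu1 mu2] := cmeasJ mf; case: Lf => _ _ i3; split => //.
      by under eq_fun do rewrite cabsJ.
    exact: L2_mul.
  - rewrite (eq_cint (h := fun v => K z v * f v - k v * f v)) => [|v _]; last exact: uE.
    by rewrite cintB// ?I1 ?subrr//; exact: kernel_cintg.
  - move=> e e0; have [d1 [d10 H1]] := cd w Ew e e0.
    exists (Num.min d1 (r / 2)); split; first by rewrite lt_min d10 divr_gt0.
    move=> v; rewrite le_min => /andP[/H1 h1 h2].
    have hr : vn (v - w) < r by apply: le_lt_trans h2 _; rewrite ltr_pdivrMr// ltr_pMr// ltr1n.
    by rewrite /u /f /ind hr subrr vn0 r0 !mulr1 !conjCK.
rewrite /u /f /ind subrr vn0 r0 mulr1 conjCK /d => /eqP; rewrite subr_eq0 => /eqP ->.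
by [].
Qed.
End G.
End KernelInvariance.

(** * Reflection groups and their Jacobian polynomials *)

Section Geometry.
Variable R : realType.
Local Notation C := (complex R).
Local Notation V := 'cV[C]_2.
Implicit Types (v w z e : V) (g h : 'M[C]_2) (Y : set V).

Lemma hprodJ v w : hprod w v = (hprod v w)^*.
Proof. by rewrite !hprodE rmorphD !rmorphM /= !conjCK; ring. Qed.

Lemma hprodZr (t : C) v e : hprod e (t *: v) = t^* * hprod e v.
Proof. by rewrite !hprodE !mxE !rmorphM /=; ring. Qed.

Lemma hprod_cabs v : hprod v v = ((cabs (v 0 0) ^+ 2 + cabs (v 1 0) ^+ 2)%:C)%C.
Proof.
rewrite hprodE; have E (x : C) : x * x^* = ((cabs x ^+ 2)%:C)%C by rewrite -normCK -cabsE rmorphXn.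
by rewrite !E -rmorphD.
Qed.

Lemma hprod_eq0 v : hprod v v = 0 -> v = 0.
Proof.
rewrite hprod_cabs => /(@complexI R _ 0)/eqP.
rewrite paddr_eq0 ?sqr_ge0// !sqrf_eq0 !cabs_eq0 => /andP[/eqP h0 /eqP h1].
by apply: cV2P; rewrite ?h0 ?h1 mxE.
Qed.

Lemma normalize v : v != 0 -> exists k : C, k != 0 /\ hprod (k *: v) (k *: v) = 1.
Proof.
move=> v0; pose q := cabs (v 0 0) ^+ 2 + cabs (v 1 0) ^+ 2.
have q0 : 0 < q.
  rewrite lt_def addr_ge0 ?sqr_ge0// andbT; apply: contra_neq v0 => q0; apply: hprod_eq0.
  by rewrite hprod_cabs -/q q0.
exists ((Num.sqrt q)^-1%:C)%C; split; first by rewrite fmorph_eq0 invr_eq0 sqrtr_eq0 -ltNge.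
rewrite hprodZ hprodZr hprod_cabs -/q.
have -> : ((Num.sqrt q)^-1%:C)%C^* = ((Num.sqrt q)^-1%:C)%C :> C.
  by rewrite -[LHS]/(conjc _) conjc_real.
by rewrite -!rmorphM mulrA -expr2 exprVn sqr_sqrtr ?(ltW q0)// mulVf ?gt_eqF// rmorph1.
Qed.

(** A normal vector of the line spanned by [v]: pairing with it is the determinant z1 v0 - z0 v1. *)
Definition perp v : V := \col_i (if i == 0 then - (v 1 0)^* else (v 0 0)^*).

Lemma hprod_perp z v : hprod z (perp v) = z 1 0 * v 0 0 - z 0 0 * v 1 0.
Proof. by rewrite hprodE !mxE /= rmorphN /= !conjCK; ring. Qed.

Lemma perp_neq0 v : v != 0 -> perp v != 0.
Proof.
apply: contra_neq => p0; have := congr1 (fun w : V => w 0 0) p0; have := congr1 (fun w : V => w 1 0) p0.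
rewrite !mxE /= => /eqP; rewrite conjC_eq0 => /eqP h0 /eqP; rewrite oppr_eq0 conjC_eq0 => /eqP h1.
by apply: cV2P; rewrite ?h0 ?h1 mxE.
Qed.

(** In C^2 the orthogonal complement of [e] is the line spanned by [w], so a vector orthogonal to
    [w] is orthogonal to all of it. *)
Lemma same_perp e e' w : w != 0 -> e != 0 -> hprod w e = 0 -> hprod w e' = 0 ->
  forall v, hprod v e = 0 -> hprod v e' = 0.
Proof.
move=> w0 e0 he he' v hv.
have D : v 0 0 * w 1 0 = v 1 0 * w 0 0.
  move: he hv; rewrite !hprodE => he hv.
  have [e1|e1] := eqVneq (e 0 0) 0.
    have e2 : (e 1 0)^* != 0.
      rewrite conjC_eq0; apply: contra_neq e0 => e2; apply: cV2P; by rewrite ?e1 ?e2 mxE.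
    move: he hv; rewrite e1 conjC0 !mulr0 !add0r => /eqP; rewrite mulf_eq0 (negPf e2) orbF => /eqP -> /eqP.
    by rewrite mulf_eq0 (negPf e2) orbF => /eqP ->; rewrite mulr0 mul0r.
  have e2 : (e 0 0)^* != 0 by rewrite conjC_eq0.
  apply: (mulIf e2); rewrite mulrAC; move/eqP: hv; rewrite addr_eq0 => /eqP ->.
  move/eqP: he; rewrite addr_eq0 => /eqP he; rewrite -[in RHS]mulrA he; ring.
have [w1|w1] := eqVneq (w 0 0) 0.
  have w2 : w 1 0 != 0 by apply: contra_neq w0 => w2; apply: cV2P; rewrite ?w1 ?w2 mxE.
  have v0 : v 0 0 = 0 by apply: (mulIf w2); rewrite D w1 mulr0 mul0r.
  move: he'; rewrite !hprodE w1 v0 !mul0r !add0r => /eqP; rewrite mulf_eq0 (negPf w2) /= => /eqP ->.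
  by rewrite mulr0.
apply: (mulfI w1); rewrite mulr0; transitivity (v 0 0 * hprod w e'); last by rewrite he' mulr0.
by rewrite !hprodE !mulrDr mulrCA mulrA; congr (_ + _); rewrite !mulrA D; ring.
Qed.

Lemma perp_exists w : w != 0 -> exists e, hprod e e = 1 /\ hprod w e = 0.
Proof.
move=> w0; have [k [k0 h]] := normalize (perp_neq0 w0); exists (k *: perp w); split=> //.
by rewrite hprodZr hprod_perp; ring.
Qed.

(** [root_of] is a choice with default 0, so a unit normal must first be shown to exist; it is the
    normalized perpendicular of an explicit nonzero vector of [Y]. *)
Lemma rootP Y : hyperplane Y ->
  hprod (root_of Y) (root_of Y) = 1 /\ forall v, Y v <-> hprod v (root_of Y) = 0.
Proof.
move=> [a [a0 YE]].
have YP v : Y v <-> a 0 0 * v 0 0 + a 0 1 * v 1 0 = 0.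
  have E : (a *m v) 0 0 = a 0 0 * v 0 0 + a 0 1 * v 1 0.
    rewrite mxE big_ord_recl big_ord1; congr (_ + a _ _ * v _ _); exact: val_inj.
  rewrite YE /=; split => [h|h]; first by rewrite -E h mxE.
  by apply/matrixP => i j; rewrite !ord1 E h mxE.
pose y : V := \col_i (if i == 0 then - a 0 1 else a 0 0).
have Yy : Y y by apply/YP; rewrite !mxE /=; ring.
have y0 : y != 0.
  apply: contra_neq a0 => y0; have := congr1 (fun w : V => w 0 0) y0; have := congr1 (fun w : V => w 1 0) y0.
  rewrite !mxE /= => h0 /eqP; rewrite oppr_eq0 => /eqP h1; apply/matrixP => i j; rewrite ord1 mxE.
  case/orP: (orbN (j == 0)) => [/eqP ->//|i0].
  by have -> : j = 1 by case: j i0 => [[|[|]]]// ? ?; exact: val_inj.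
have [e [ee ye]] := perp_exists y0.
have e0 : e != 0 by apply: contra_eq_neq ee => ->; rewrite hprodE !mxE !mul0r addr0 eq_sym oner_eq0.
have YpE v : Y v <-> hprod v (perp y) = 0.
  have -> : hprod v (perp y) = - (a 0 0 * v 0 0 + a 0 1 * v 1 0).
    by rewrite hprod_perp !mxE /=; ring.
  by rewrite YP; split => [->|/eqP]; rewrite ?oppr0// oppr_eq0 => /eqP.
have p0 := perp_neq0 y0; have yp : hprod y (perp y) = 0 by rewrite hprod_perp; ring.
have H : hprod (root_of Y) (root_of Y) = 1 /\ forall y, Y y -> hprod y (root_of Y) = 0.
  rewrite /root_of; case: xgetP => [x _ //|/(_ e)[]]; split => // v /YpE hv.
  exact: (same_perp y0 p0 yp ye).
have [H1 H2] := H; split => // v; split; first exact: H2.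
have r0 : root_of Y != 0 by apply: contra_eq_neq H1 => ->; rewrite hprodE !mxE !mul0r addr0 eq_sym oner_eq0.
by move=> hv; apply/YpE; exact: (same_perp y0 r0 (H2 _ Yy) yp).
Qed.

Lemma unit_neq0 e : hprod e e = 1 -> e != 0.
Proof. by move=> ee; apply: contra_eq_neq ee => ->; rewrite hprodE !mxE !mul0r addr0 eq_sym oner_eq0. Qed.

Lemma hprod_dec v e : hprod e e = 1 -> hprod (v - hprod v e *: e) e = 0.
Proof. by move=> ee; rewrite hprodB hprodZ ee mulr1 subrr. Qed.

Definition refl_mx e (t : C) : 'M[C]_2 := 1%:M + (t - 1) *: (e *m (map_mx Num.conj e)^T).

Lemma refl_mxE e t v : refl_mx e t *m v = refl_map e t v.
Proof.
rewrite /refl_mx /refl_map mulmxDl mul1mx -scalemxAl -mulmxA -scalerA.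
congr (_ + _); congr (_ *: _).
by apply/matrixP => i j; rewrite !ord1 mxE big_ord1 -hprod_mx [RHS]mxE mulrC.
Qed.

Lemma det2 (A : 'M[C]_2) : \det A = A 0 0 * A 1 1 - A 0 1 * A 1 0.
Proof.
rewrite (expand_det_row _ 0) big_ord_recl big_ord1 /cofactor !det_mx11 !mxE /=.
have -> : lift ord0 ord0 = 1 :> 'I_2 by exact: val_inj.
have -> : lift (1 : 'I_2) 0 = 0 :> 'I_2 by exact: val_inj.
by rewrite /= expr0 mul1r expr1; ring.
Qed.

Lemma det_refl_mx e t : hprod e e = 1 -> \det (refl_mx e t) = t.
Proof.
rewrite hprodE => ee; rewrite det2 !mxE !big_ord1 !mxE /=.
transitivity (1 + (t - 1) * (e 0 0 * (e 0 0)^* + e 1 0 * (e 1 0)^*)); first by rewrite mulr1n mulr0n; ring.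
by rewrite ee mulr1 addrC subrK.
Qed.

Lemma mx_eqP (A B : 'M[C]_2) : (forall v : V, A *m v = B *m v) -> A = B.
Proof.
move=> h; apply/matrixP => i j; have := h (delta_mx j 0); rewrite -!colE => /matrixP/(_ i 0).
by rewrite !mxE.
Qed.

(** Being unitary, [g] preserves the orthogonal complement of the space it fixes, so [e] is an
    eigenvector; its eigenvalue is the determinant. *)
Lemma fix_perp_refl g e : unitary g -> hprod e e = 1 ->
  (forall v, hprod v e = 0 -> g *m v = v) -> g = refl_mx e (\det g).
Proof.
move=> gu ee gf.
suff [t gt] : exists t, g = refl_mx e t by rewrite {1}gt gt det_refl_mx.
pose t := hprod (g *m e) e; exists t.
have ge : g *m e = t *: e.
  apply/eqP; rewrite -subr_eq0; apply/eqP; apply: hprod_eq0.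
  set x := _ - _; have xe : hprod x e = 0 by exact: hprod_dec.
  have : hprod (g *m x) (g *m e) = 0 by rewrite hprod_unitary.
  rewrite (gf _ xe) => h.
  by rewrite {1}/x hprodB hprodZ (hprodJ x (g *m e)) (hprodJ x e) xe h conjC0 mulr0 subr0.
apply: mx_eqP => v; rewrite refl_mxE /refl_map.
rewrite -{1}[v](subrK (hprod v e *: e)) mulmxDr (gf _ (hprod_dec v ee)) -scalemxAr ge scalerA.
by rewrite -addrA; congr (_ + _); rewrite -scaleNr -scalerDl; congr (_ *: _); ring.
Qed.

Lemma fixset_refl_mx e t : hprod e e = 1 -> t != 1 -> Defs.fixset (refl_mx e t) = [set v | hprod v e = 0].
Proof.
move=> ee t1; apply/seteqP; split => v; rewrite /Defs.fixset /= refl_mxE /refl_map.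
  move=> /eqP; rewrite -subr_eq0 addrAC subrr add0r scaler_eq0 (negPf (unit_neq0 ee)) orbF mulf_eq0 subr_eq0 (negPf t1).
  by move/eqP.
by move=> ->; rewrite mulr0 scale0r addr0.
Qed.

Lemma hyperplane_perp e : hprod e e = 1 -> hyperplane [set v | hprod v e = 0].
Proof.
move=> ee; exists (map_mx Num.conj e)^T; split.
  apply: contra_neq (unit_neq0 ee) => h; have := congr1 trmx h; rewrite trmxK trmx0 => h2.
  by apply/matrixP => i j; have := congr1 (fun w : V => w i j) h2; rewrite !mxE => /eqP; rewrite conjC_eq0 => /eqP.
apply/seteqP; split => v /=; rewrite hprod_mx.
  by move=> h; apply/matrixP => i j; rewrite !ord1 h mxE.
by move=> ->; rewrite mxE.
Qed.

(** In C^2 the line spanned by a fixed vector is already a hyperplane, which makes [g] a reflection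
    along its normal. *)
Lemma fix_vector g w : unitary g -> w != 0 -> g *m w = w -> g != 1%:M ->
  exists e, [/\ hprod e e = 1, hprod w e = 0, g = refl_mx e (\det g) & Defs.fixset g = [set v | hprod v e = 0]].
Proof.
move=> gu w0 gw g1; have [e [ee we]] := perp_exists w0; exists e.
have gf v : hprod v e = 0 -> g *m v = v.
  move=> ve; suff [k ->] : exists k, v = k *: w by rewrite -scalemxAr gw.
  have vp : hprod v (perp w) = 0.
    by apply: (same_perp w0 (unit_neq0 ee) we) => //; rewrite hprod_perp; ring.
  rewrite hprod_perp in vp; move/eqP: vp; rewrite subr_eq0 => /eqP vp.
  have [w1|w1] := eqVneq (w 0 0) 0.
    have w2 : w 1 0 != 0 by apply: contra_neq w0 => w2; apply: cV2P; rewrite ?w1 ?w2 mxE.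
    exists (v 1 0 / w 1 0); apply: cV2P; rewrite !mxE ?divfK// w1 mulr0.
    by apply: (mulIf w2); rewrite -vp w1 mulr0 mul0r.
  exists (v 0 0 / w 0 0); apply: cV2P; rewrite !mxE ?divfK//.
  by apply: (mulIf w1); rewrite vp mulrAC divfK.
have gE := fix_perp_refl gu ee gf; split=> //.
rewrite gE fixset_refl_mx//; apply: contra_neq g1 => t1; rewrite gE t1 /refl_mx subrr scale0r addr0.
by [].
Qed.

End Geometry.

(** * Stabilizers, determinants and mirrors of finite unitary groups *)

Section Groups.
Variable R : realType.
Local Notation C := (complex R).
Local Notation V := 'cV[C]_2.
Implicit Types (v w z e : V) (g h r : 'M[C]_2) (Y : set V) (G H : {fset 'M[C]_2}).

(** Closure under product and inverse replaces generation by reflections, so that the same lemmas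
    serve [G] and the subgroups [Gsub G S]. *)
Definition umx_group H : Prop :=
  [/\ forall g, g \in H -> unitary g, 1%:M \in H,
      forall g h, g \in H -> h \in H -> g *m h \in H & forall g, g \in H -> invmx g \in H].

Lemma gen_by1 (S : set 'M[C]_2) : gen_by S 1%:M.
Proof. by exists [::]; split=> //; rewrite big_nil. Qed.

Lemma gen_byM (S : set 'M[C]_2) g h : gen_by S g -> gen_by S h -> gen_by S (g *m h).
Proof.
move=> [s [sS ->]] [t [tS ->]]; exists (s ++ t); split; last by rewrite big_cat.
by move=> x; rewrite mem_cat => /orP[/sS|/tS].
Qed.

Lemma gen_by_unitmx (S : set 'M[C]_2) g : (forall r, S r -> r \in unitmx) -> gen_by S g -> g \in unitmx.
Proof.
move=> Su [s [sS ->]]; elim: s sS => [|x s IH] sS; first by rewrite big_nil unitmx1.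
rewrite big_cons -mulmxE unitmx_mul IH ?andbT; last by move=> y ys; apply: sS; rewrite inE ys orbT.
by case: (sS x (mem_head _ _)) => /Su; rewrite ?unitmx_inv.
Qed.

Lemma gen_byV (S : set 'M[C]_2) g : (forall r, S r -> r \in unitmx) -> gen_by S g -> gen_by S (invmx g).
Proof.
move=> Su [s [sS ->]]; elim: s sS => [|x s IH] sS; first by rewrite big_nil invmx1; exact: gen_by1.
have sS' y : y \in s -> S y \/ S (invmx y) by move=> ys; apply: sS; rewrite inE ys orbT.
have xS : S x \/ S (invmx x) by apply: sS; exact: mem_head.
have ux : x \in unitmx by case: xS => /Su; rewrite ?unitmx_inv.
have us : \prod_(y <- s) y \in unitmx by apply: (gen_by_unitmx Su); exists s.
rewrite big_cons [invmx _](invrM ux us); apply: gen_byM; first exact: IH.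
exists [:: invmx x]; split; last by rewrite big_seq1.
by move=> y; rewrite inE => /eqP ->; rewrite invmxK; case: xS; [right|left].
Qed.

Lemma fin_refl_group_umx G : fin_refl_group G -> umx_group G.
Proof.
move=> [Gu [S [Sr GE]]].
have Su r : S r -> r \in unitmx by move=> /Sr[/unitary_inv[]].
split=> //; first by apply/GE; exact: gen_by1.
  by move=> g h /GE ? /GE ?; apply/GE; exact: gen_byM.
by move=> g /GE ?; apply/GE; exact: gen_byV.
Qed.

Lemma in_Gsub G (S : set (set V)) g : g \in Gsub G S <->
  g \in G /\ gen_by [set r | r \in G /\ reflection r /\ S (Defs.fixset r)] g.
Proof. by rewrite !inE /=; split=> [/andP[? /asboolP]|[-> ?]] //=; apply/asboolP. Qed.

Lemma Gsub_umx G (S : set (set V)) : umx_group G -> umx_group (Gsub G S).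
Proof.
move=> [Gu G1 GM GV]; split.
- by move=> g /in_Gsub[/Gu].
- by apply/in_Gsub; split => //; exact: gen_by1.
- by move=> g h /in_Gsub[? ?] /in_Gsub[? ?]; apply/in_Gsub; split; [exact: GM|exact: gen_byM].
- move=> g /in_Gsub[? ?]; apply/in_Gsub; split; [exact: GV|apply: gen_byV => // r /= [rG _]].
  by have [] := unitary_inv (Gu _ rG).
Qed.

Lemma reflection_Gsub G (S : set (set V)) r :
  r \in G -> reflection r -> S (Defs.fixset r) -> r \in Gsub G S.
Proof.
move=> rG rr rS; apply/in_Gsub; split=> //; exists [:: r]; split; last by rewrite big_seq1.
by move=> x; rewrite inE => /eqP ->; left.
Qed.

(** For a hyperplane [Y] the determinant is injective on these elements, so [dets] lists a
    multiplicative group of [mult H Y] distinct numbers. *)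
Definition stab H Y := [seq g <- enum_fset H | `[< forall v, Y v -> g *m v = v >]].
Definition dets H Y := [seq \det g | g <- stab H Y].

Lemma in_stab H Y g : g \in stab H Y <-> g \in H /\ forall v, Y v -> g *m v = v.
Proof. by rewrite mem_filter; split=> [/andP[/asboolP ? ?]|[? ?]] //; apply/andP; split => //; apply/asboolP. Qed.

Lemma size_dets H Y : size (dets H Y) = mult H Y.
Proof. by rewrite size_map. Qed.

Lemma stab_refl H Y g : umx_group H -> hyperplane Y -> g \in stab H Y -> g = refl_mx (root_of Y) (\det g).
Proof.
move=> [Hu _ _ _] /rootP[ee YE] /in_stab[gH gY]; apply: fix_perp_refl; [exact: Hu|by []|].
by move=> v /YE /gY.
Qed.

Lemma good_mirror_dets H Y : umx_group H -> hyperplane Y -> good_mirror (root_of Y) (dets H Y).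
Proof.
move=> gH hY; have [ee YE] := rootP hY; have [Hu H1 HM HV] := gH; split=> //.
- rewrite map_inj_in_uniq; first by apply: filter_uniq; exact: fset_uniq.
  by move=> g h gs hs E; rewrite (stab_refl gH hY gs) E -(stab_refl gH hY hs).
- by move=> t /mapP[g /in_stab[/Hu/unitary_det ? _] ->].
- move=> t t' /mapP[g /in_stab[gG gY] ->] /mapP[h /in_stab[hG hYY] ->].
  rewrite -det_mulmx; apply: map_f; apply/in_stab; split; first exact: HM.
  by move=> v Yv; rewrite -mulmxA hYY// gY.
- rewrite size_map; case E : (stab H Y) => [|//]; have : 1%:M \in stab H Y.
    by apply/in_stab; split => // v _; rewrite mul1mx.
  by rewrite E.
Qed.

(** [fix_vector] provides the mirror. The finite order is the pigeonhole principle: the list [s] has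
    one power of [g] more than [H] has elements. *)
Lemma fix_reflection H g w : umx_group H -> g \in H -> w != 0 -> g *m w = w -> g != 1%:M -> reflection g.
Proof.
move=> [Hu H1 HM HV] gH w0 gw g1.
have [e [ee we gE gf]] := fix_vector (Hu _ gH) w0 gw g1.
split; [exact: Hu| |by rewrite gf; exact: hyperplane_perp].
have gX n : g ^+ n \in H by elim: n => [|n IH]; [rewrite expr0|rewrite exprS; exact: HM].
have [gu _ _] := unitary_inv (Hu _ gH).
pose s := [seq g ^+ i | i <- iota 0 (size (enum_fset H)).+1].
have : ~~ uniq s.
  apply/negP => us; have := uniq_leq_size us (s2 := enum_fset H).
  rewrite size_map size_iota ltnn => h; suff : false by []; apply: h.
  by move=> x /mapP[i _ ->]; exact: gX.
move=> /(uniqPn 0)[i [j [ij]]]; rewrite size_map size_iota => js.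
rewrite !(nth_map 0%N) ?size_iota ?(ltn_trans ij js)// !nth_iota ?(ltn_trans ij js)// !add0n => E.
exists (j - i)%N; split; first by rewrite subn_gt0.
have ui : g ^+ i \is a GRing.unit by rewrite unitrX.
by apply: (mulrI ui); rewrite -exprD subnKC ?(ltnW ij)// mulr1.
Qed.

Lemma RH_hyperplane H Y : RH H Y -> hyperplane Y.
Proof. by move=> [r [rH [_ _ rY]] <-]. Qed.

Lemma hyperplane_unique Y Y' w : hyperplane Y -> hyperplane Y' -> w != 0 -> Y w -> Y' w -> Y = Y'.
Proof.
move=> /rootP[e1 E1] /rootP[e2 E2] w0 /E1 h1 /E2 h2; apply/seteqP; split => v.
  by move=> /E1 h; apply/E2; exact: (same_perp w0 (unit_neq0 e1) h1 h2).
by move=> /E2 h; apply/E1; exact: (same_perp w0 (unit_neq0 e2) h2 h1).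
Qed.

Lemma finite_RH H : finite_set (RH H).
Proof.
apply: finite_image; apply: (@sub_finite_set _ _ [set` H]); last exact: finite_fset.
by move=> r [].
Qed.

Definition mirrors H : seq (set V) := enum_fset (fset_set (RH H)).

Lemma in_mirrors H Y : Y \in mirrors H <-> RH H Y.
Proof.
have -> : (Y \in mirrors H) = (Y \in fset_set (RH H)) by [].
by rewrite in_fset_set; [rewrite in_setE|exact: finite_RH].
Qed.

Lemma mirrors_uniq H : uniq (mirrors H).
Proof. exact: fset_uniq. Qed.

Lemma absJE H z : absJ H z = mirror_prod (@root_of R) (dets H) (mirrors H) z.
Proof.
rewrite /absJ fsbig_finite; last exact: finite_RH.
by apply: eq_bigr => Y _; rewrite size_dets.
Qed.

(** Two unit normals of the same line differ by a unimodular factor; hence the choice of roots does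
    not affect [absJ]. *)
Lemma hprod_cabs_eq e e' z : hprod e e = 1 -> hprod e' e' = 1 ->
  (forall v, hprod v e = 0 -> hprod v e' = 0) -> cabs (hprod z e) = cabs (hprod z e').
Proof.
move=> ee ee' h; set x := e' - hprod e' e *: e; have xe : hprod x e = 0 by exact: hprod_dec.
have x0 : x = 0.
  apply: hprod_eq0; rewrite {1}/x hprodB hprodZ (hprodJ x e') (hprodJ x e) xe (h _ xe).
  by rewrite conjC0 mulr0 subr0.
have E : e' = hprod e' e *: e by apply/eqP; rewrite -subr_eq0 -/x x0.
set k := hprod e' e in E.
have k1 : cabs k = 1.
  have := ee'; rewrite E hprodZ hprodZr ee mulr1 => /(congr1 (@cabs R)).
  by rewrite cabsM cabsJ cabs1 -expr2 => /eqP; rewrite sqrp_eq1 ?cabs_ge0// => /eqP.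
by rewrite E hprodZr cabsM cabsJ k1 mul1r.
Qed.

Definition im g Y : set V := [set g *m v | v in Y].

Lemma im_inP g Y v : unitary g -> im g Y v <-> Y (invmx g *m v).
Proof.
move=> /unitary_inv[gu _ _]; split => [[u Yu <-]|h]; first by rewrite mulKmx.
by exists (invmx g *m v) => //; rewrite mulKVmx.
Qed.

Lemma imK g Y : unitary g -> im (invmx g) (im g Y) = Y.
Proof.
move=> gu; have [gm _ iu] := unitary_inv gu; apply/seteqP; split => v.
  by move=> /(im_inP _ _ iu)/(im_inP _ _ gu); rewrite invmxK mulKmx.
by move=> Yv; apply/(im_inP _ _ iu)/(im_inP _ _ gu); rewrite invmxK mulKmx.
Qed.

(** Conjugating a reflection by [g] moves its mirror by [g]. *)
Lemma im_RH H g Y : umx_group H -> g \in H -> RH H Y -> RH H (im g Y).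
Proof.
move=> [Hu H1 HM HV] gH [r [rH [ru [n [n0 rn]] [a [a0 rY]]]] <-].
have gu := Hu _ gH; have [gm _ iu] := unitary_inv gu.
have E : Defs.fixset (g *m r *m invmx g) = im g (Defs.fixset r).
  apply/seteqP; split => v.
    rewrite /Defs.fixset /= => h; apply/(im_inP _ _ gu); rewrite /= -{2}h.
    by rewrite -!mulmxA mulKmx.
  by move=> [u ru' <-]; rewrite /Defs.fixset /= -!mulmxA mulKmx// ru'.
exists (g *m r *m invmx g) => //; split; first by rewrite /= HM ?HM ?HV.
have cH : g *m r *m invmx g \in H by rewrite HM ?HM ?HV.
split; first exact: Hu.
  exists n; split => //.
  have cE k : (g *m r *m invmx g) ^+ k = g *m r ^+ k *m invmx g.
    elim: k => [|k IH]; first by rewrite !expr0 -[g *m 1]/(g *m 1%:M) mulmx1 mulmxV.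
    by rewrite !exprS IH -!mulmxE -!mulmxA mulKmx.
  by rewrite cE rn -[g *m 1]/(g *m 1%:M) mulmx1 mulmxV.
rewrite E; exists (a *m invmx g); split.
  by apply: contra_neq a0 => h; rewrite -[a]mulmx1 -(mulVmx gm) mulmxA h mul0mx.
apply/seteqP; split => v.
  by move=> /(im_inP _ _ gu); rewrite rY /= mulmxA.
by move=> /= h; apply/(im_inP _ _ gu); rewrite rY /= mulmxA.
Qed.

Lemma mult_im_le H g Y : umx_group H -> g \in H -> (mult H Y <= mult H (im g Y))%N.
Proof.
move=> [Hu H1 HM HV] gH; have gu := Hu _ gH; have [gm _ iu] := unitary_inv gu.
rewrite -[mult H Y](size_map (fun h => g *m h *m invmx g)); apply: uniq_leq_size.
  rewrite map_inj_uniq; first by apply: filter_uniq; exact: fset_uniq.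
  move=> h h' /(congr1 (fun m => invmx g *m m *m g)).
  by rewrite -!mulmxA !mulKmx// !mulVmx// !mulmx1.
move=> x /mapP[h /in_stab[hH hY] ->]; apply/in_stab; split; first by rewrite HM ?HM ?HV.
by move=> v [u Yu <-]; rewrite -!mulmxA mulKmx// hY.
Qed.

Lemma mult_im H g Y : umx_group H -> g \in H -> mult H (im g Y) = mult H Y.
Proof.
move=> gH gg; have [Hu H1 HM HV] := gH; apply/eqP; rewrite eqn_leq mult_im_le// andbT.
by rewrite -{2}(imK Y (Hu _ gg)); apply: mult_im_le => //; exact: HV.
Qed.

(** [g] permutes the mirrors, preserves multiplicities by conjugation, and sends a root of [Y] to a
    root of [im g Y], so the product is merely reindexed. *)
Lemma absJ_act H g z : umx_group H -> g \in H -> absJ H (g *m z) = absJ H z.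
Proof.
move=> gH gg; have [Hu H1 HM HV] := gH; have gu := Hu _ gg; have [gm _ iu] := unitary_inv gu.
rewrite {1}/absJ (@reindex_fsbig _ _ _ _ _ (im g) (RH H) (RH H)); last first.
  split; first by move=> Y; exact: im_RH.
    by move=> Y Y' _ _ /(congr1 (im (invmx g))); rewrite !imK.
  move=> Y hY; exists (im (invmx g) Y); first by apply: im_RH => //; exact: HV.
  by rewrite -{1}(invmxK g) imK.
apply: eq_fsbigr => Y /set_mem hY; rewrite mult_im//; congr (_ ^+ _).
have [r1 E1] := rootP (RH_hyperplane hY); have [r2 E2] := rootP (RH_hyperplane (im_RH gH gg hY)).
rewrite -(hprod_unitary z (root_of Y) gu); apply: hprod_cabs_eq; rewrite ?hprod_unitary//.
move=> v /E2/(im_inP _ _ gu)/E1 <-.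
by rewrite -[in LHS](mulKVmx gm v) hprod_unitary.
Qed.

End Groups.

(** * Inequalities for real powers *)

Section Powers.
Variable R : realType.
Implicit Types x y a c M : R.

Lemma powR_compare x y c a : 0 <= x -> 0 <= y -> 1 <= c -> x <= c * y -> y <= c * x ->
  x `^ a <= c `^ `|a| * y `^ a.
Proof.
move=> x0 y0 c1 xy yx; have c0 : 0 <= c by lra.
(* Then [x = 0] too, and both sides contain the same power of 0, whatever its conventional value; a
   constant factor of at least 1 suffices. *)
have [y00|yn0] := eqVneq y 0.
  have -> : x = 0 by apply/eqP; rewrite eq_le x0 andbT; move: xy; rewrite y00 mulr0.
  by rewrite y00 ler_peMl ?powR_ge0// -[leLHS](powRr0 c) ler_powR.
have yp : 0 < y by rewrite lt_def yn0.
have xp : 0 < x.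
  rewrite lt_def x0 andbT; apply: contra_neq yn0 => x00; apply/eqP; rewrite eq_le y0 andbT.
  by move: yx; rewrite x00 mulr0.
have [a0|a0] := leP 0 a.
  rewrite ger0_norm// -powRM//; apply: ge0_ler_powR; rewrite ?nnegrE//; exact: mulr_ge0.
rewrite ltr0_norm// -[X in x `^ X]opprK -[X in y `^ X]opprK; set b := - a.
have b0 : 0 <= b by rewrite oppr_ge0 ltW.
clearbody b.
rewrite !powRN ler_pdivlMr ?powR_gt0// ler_pdivrMl ?powR_gt0// mulrC -powRM//.
by apply: ge0_ler_powR; rewrite ?nnegrE// mulr_ge0.
Qed.

(** The factor [y] in the bound on [f] turns the exponent [- a] into [1 - a > 0]. Both exponents
    that remain lie between 0 and 1, so [M >= 1] bounds the powers. *)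
Lemma weighted_le x y f a M N : 0 <= x <= M -> 0 <= y <= M -> 1 <= M -> 0 <= a < 1 ->
  0 <= f <= N * y -> 0 <= N -> x `^ a * f * y `^ (- a) <= M * (N * M).
Proof.
move=> /andP[x0 xM] /andP[y0 yM] M1 /andP[a0 a1] /andP[f0 fy] N0; have M0 : 0 <= M by lra.
have powM u b : 0 <= u <= M -> 0 <= b <= 1 -> u `^ b <= M.
  move=> /andP[u0 uM] /andP[b0 b1]; apply: (@le_trans _ _ (M `^ b)); first exact: ge0_ler_powR.
  by rewrite -[leRHS]powRr1// ler_powR.
rewrite -mulrA; apply: ler_pM; rewrite ?powR_ge0 ?mulr_ge0 ?powR_ge0//.
  by apply: powM; rewrite ?x0 ?a0//= ltW.
have [y00|yn0] := eqVneq y 0.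
  have -> : f = 0 by apply/eqP; rewrite eq_le f0 andbT; move: fy; rewrite y00 mulr0.
  by rewrite mul0r mulr_ge0.
have yp : 0 < y by rewrite lt_def yn0.
apply: (@le_trans _ _ (N * y * y `^ (- a))); first by rewrite ler_wpM2r ?powR_ge0.
rewrite -mulrA ler_wpM2l// -[X in X * _](powRr1 y0) -powRD; last by rewrite yn0 implybT.
by apply: powM; rewrite ?y0//; apply/andP; split; lra.
Qed.
End Powers.

(** * Local size of the Jacobian *)

Section Jacobian.
Variable R : realType.
Local Notation C := (complex R).
Local Notation V := 'cV[C]_2.
Implicit Types (v w z e : V) (g h r : 'M[C]_2) (Y : set V) (G H : {fset 'M[C]_2}).

Lemma mirror_prod_ub (T : eqType) (e : T -> V) (Om : T -> seq C) (L : seq T) (M : R) :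
  (forall t, t \in L -> hprod (e t) (e t) = 1) ->
  exists B : R, 1 <= B /\ forall z, vn z <= M -> mirror_prod e Om L z <= B.
Proof.
elim: L => [|Y L IH] eu; first by exists 1; split => // z _; rewrite /mirror_prod big_nil.
have [|B [B1 H]] := IH; first by move=> Y' h; apply: eu; rewrite inE h orbT.
pose m := Num.max M 1; have m1 : 1 <= m by rewrite le_max lexx orbT.
have Mm : M <= m by rewrite le_max lexx.
exists (m ^+ (size (Om Y)).-1 * B); split.
  by rewrite -[leLHS]mulr1; apply: ler_pM => //; exact: exprn_ege1.
move=> z hz; rewrite /mirror_prod big_cons; apply: ler_pM; last exact: H.
- by rewrite exprn_ge0 ?cabs_ge0.
- exact: mirror_prod_ge0.
- apply: lerXn2r; rewrite ?nnegrE ?cabs_ge0//; first by lra.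
  by apply: le_trans (cabs_hprod_le z (eu Y (mem_head _ _))) _; exact: le_trans hz Mm.
Qed.

Lemma mirrors_unit H Y : Y \in mirrors H -> hprod (root_of Y) (root_of Y) = 1.
Proof. by move=> /in_mirrors/RH_hyperplane/rootP[]. Qed.

Lemma absJ_ge0 H z : 0 <= absJ H z.
Proof. by rewrite absJE; exact: mirror_prod_ge0. Qed.

Lemma absJ_ub H (M : R) : exists B : R, 1 <= B /\ forall z, vn z <= M -> absJ H z <= B.
Proof.
have [B [B1 h]] := mirror_prod_ub (dets H) M (@mirrors_unit H).
by exists B; split => // z hz; rewrite absJE; exact: h.
Qed.

(** No other mirror passes through [w0], so the remaining factors are bounded above and away from 0
    near it. *)
Lemma absJ_on_mirror H Y w0 : RH H Y -> w0 != 0 -> Y w0 ->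
  exists d c : R, [/\ 0 < d, 1 <= c & forall w, vn (w - w0) <= d ->
    absJ H w <= c * cabs (hprod w (root_of Y)) ^+ (mult H Y).-1 /\
    cabs (hprod w (root_of Y)) ^+ (mult H Y).-1 <= c * absJ H w].
Proof.
move=> hY w00 Yw; have YL : Y \in mirrors H by apply/in_mirrors.
have [Y' Y'L|Y' Y'L|d1 [c1 [d10 c10 lb]]] := @mirror_prod_lb _ _ (@root_of R) (dets H) (rem Y (mirrors H)) w0.
- by apply: (@mirrors_unit H); exact: mem_rem Y'L.
- have Y'H := mem_rem Y'L; have hY' := RH_hyperplane (proj1 (in_mirrors _ _) Y'H).
  apply/negP => /eqP h; have [_ /(_ w0) [_ /(_ h) Y'w]] := rootP hY'.
  have E := hyperplane_unique hY' (RH_hyperplane hY) w00 Y'w Yw.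
  by move: Y'L; rewrite E mem_rem_uniqF// mirrors_uniq.
have [Y' Y'L|B [B1 ub]] := @mirror_prod_ub _ (@root_of R) (dets H) (rem Y (mirrors H)) (vn w0 + d1).
  by apply: (@mirrors_unit H); exact: mem_rem Y'L.
exists d1, (Num.max B c1^-1); split; rewrite ?le_max ?B1//.
move=> w hw; have wM : vn w <= vn w0 + d1.
  by rewrite -[w](subrK w0) addrC (le_trans (vnD _ _))// lerD2l.
rewrite absJE /mirror_prod (perm_big _ (perm_to_rem YL)) big_cons /= size_dets.
rewrite -/(mirror_prod _ _ _ _); set x := _ ^+ _; have x0 : 0 <= x by rewrite exprn_ge0 ?cabs_ge0.
set y := mirror_prod _ _ _ _; split.
  by rewrite mulrC ler_wpM2r// (le_trans (ub w wM))// le_max lexx.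
rewrite mulrCA ler_peMr//; apply: (@le_trans _ _ (c1^-1 * c1)); first by rewrite mulVf ?gt_eqF.
by apply: ler_pM; rewrite ?invr_ge0 ?(ltW c10)// ?le_max ?lexx ?orbT// lb.
Qed.

Lemma absJ_off_mirrors H w0 : (forall Y, RH H Y -> ~ Y w0) ->
  exists d c : R, [/\ 0 < d, 1 <= c & forall w, vn (w - w0) <= d -> absJ H w <= c /\ 1 <= c * absJ H w].
Proof.
move=> off; have [Y YL|Y YL|d1 [c1 [d10 c10 lb]]] := @mirror_prod_lb _ _ (@root_of R) (dets H) (mirrors H) w0.
- exact: mirrors_unit YL.
- move/in_mirrors: YL => hY; apply/negP => /eqP h; apply: (off Y hY).
  by have [_ /(_ w0) [_ /(_ h)]] := rootP (RH_hyperplane hY).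
have [B [B1 ub]] := absJ_ub H (vn w0 + d1).
exists d1, (Num.max B c1^-1); split; rewrite ?le_max ?B1//.
move=> w hw; have wM : vn w <= vn w0 + d1.
  by rewrite -[w](subrK w0) addrC (le_trans (vnD _ _))// lerD2l.
split; first by rewrite (le_trans (ub w wM))// le_max lexx.
apply: (@le_trans _ _ (c1^-1 * c1)); first by rewrite mulVf ?gt_eqF.
by apply: ler_pM; rewrite ?invr_ge0 ?(ltW c10)// ?le_max ?lexx ?orbT// absJE lb.
Qed.

(** A mirror of [G] through [w0] belongs to a reflection that fixes [w0], hence lies in [H], and it
    has the same multiplicity in both groups. Both Jacobians are then comparable to the same power
    of the same linear form, or to 1 if no mirror passes through [w0]. *)
Lemma absJ_compare G H w0 : umx_group G -> umx_group H -> (forall g, g \in H -> g \in G) ->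
  w0 != 0 -> (forall g, g \in G -> g *m w0 = w0 -> g \in H) ->
  exists d c : R, [/\ 0 < d, 1 <= c & forall w, vn (w - w0) <= d ->
    absJ G w <= c * absJ H w /\ absJ H w <= c * absJ G w].
Proof.
move=> gG gH HG w00 st.
have [[Y [hY Yw]]|none] := pselect (exists Y, RH G Y /\ Y w0).
  have hY' : RH H Y.
    case: hY Yw => r [rG rr] <- rw; exists r => //; split => //; exact: st.
  have mE : mult G Y = mult H Y.
    apply/eqP; rewrite eqn_leq; apply/andP; split; apply: uniq_leq_size.
    - by apply: filter_uniq; exact: fset_uniq.
    - move=> g /in_stab[gg gY]; apply/in_stab; split => //; apply: st => //; exact: gY.
    - by apply: filter_uniq; exact: fset_uniq.
    - by move=> g /in_stab[gg gY]; apply/in_stab; split => //; exact: HG.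
  have [d1 [c1 [d10 c11 h1]]] := absJ_on_mirror hY w00 Yw.
  have [d2 [c2 [d20 c21 h2]]] := absJ_on_mirror hY' w00 Yw.
  exists (Num.min d1 d2), (c1 * c2); split.
  - by rewrite lt_min d10.
  - by rewrite -[leLHS]mulr1; apply: ler_pM.
  move=> w; rewrite le_min => /andP[/h1[l1 u1] /h2[l2 u2]]; rewrite mE in l1 u1.
  split; first by apply: le_trans l1 _; rewrite -mulrA; apply: ler_wpM2l => //; exact: le_trans c11.
  by apply: le_trans l2 _; rewrite mulrAC [leRHS]mulrC; apply: ler_wpM2l => //; exact: le_trans c21.
have offG Y : RH G Y -> ~ Y w0 by move=> hY Yw; apply: none; exists Y.
have offH Y : RH H Y -> ~ Y w0.
  by move=> [r [rH rr] <-]; apply: offG; exists r => //; split => //; exact: HG.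
have [d1 [c1 [d10 c11 h1]]] := absJ_off_mirrors offG.
have [d2 [c2 [d20 c21 h2]]] := absJ_off_mirrors offH.
exists (Num.min d1 d2), (c1 * c2); split.
- by rewrite lt_min d10.
- by rewrite -[leLHS]mulr1; apply: ler_pM.
have c10 : 0 <= c1 by exact: le_trans c11.
have c20 : 0 <= c2 by exact: le_trans c21.
move=> w; rewrite le_min => /andP[/h1[l1 u1] /h2[l2 u2]]; split.
  by apply: le_trans l1 _; rewrite -mulrA; apply: ler_peMr.
by apply: le_trans l2 _; rewrite mulrAC mulrC; apply: ler_peMr.
Qed.
End Jacobian.

(** * Comparison of the kernels *)

Section Conjugation.
Variable R : realType.
Local Notation C := (complex R).
Local Notation V := 'cV[C]_2.
Implicit Types (v w z e : V) (A : set V).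

Definition cj v : V := map_mx Num.conj v.

Lemma cjK v : cj (cj v) = v.
Proof. by apply/matrixP => i j; rewrite !mxE conjCK. Qed.

Lemma cjB v w : cj (v - w) = cj v - cj w.
Proof. by apply/matrixP => i j; rewrite !mxE rmorphB. Qed.

Lemma cj0 : cj 0 = 0.
Proof. by apply/matrixP => i j; rewrite !mxE conjC0. Qed.

Lemma vn_cj v : vn (cj v) = vn v.
Proof. by rewrite /vn !mxE !cabsJ. Qed.

Lemma vn_cjB v w : vn (cj v - cj w) = vn (v - w).
Proof. by rewrite -cjB vn_cj. Qed.

Lemma cj_mulmx (g : 'M[C]_2) v : cj (g *m v) = map_mx Num.conj g *m cj v.
Proof. exact: map_mxM. Qed.

Lemma hprod_cj z e : hprod (cj z) (cj e) = (hprod z e)^*.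
Proof. by rewrite !hprodE !mxE rmorphD !rmorphM. Qed.

Lemma openV A : (forall z, A z -> exists d : R, 0 < d /\ forall v, vn (v - z) <= d -> A v) -> open A.
Proof. by move=> h; rewrite openE => z /h /nbhsV. Qed.

Lemma closureV A z : (forall d : R, 0 < d -> exists2 a, A a & vn (a - z) <= d) -> closure A z.
Proof. by move=> h B /nbhsV[d [/h[a Aa ad] H]]; exists a; split => //; exact: H. Qed.

Lemma open_cj A : open A -> open (cj @^-1` A).
Proof.
move=> oA; apply: openV => z Az; have [d [d0 H]] := open_vn oA Az; exists d; split => // v hv.
by apply: H; rewrite vn_cjB.
Qed.

Lemma closure_cj A z : closure A z -> closure (cj @^-1` A) (cj z).
Proof.
move=> cA; apply: closureV => d /(closure_vn cA)[a Aa ad].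
by exists (cj a); rewrite /= ?cjK// vn_cjB.
Qed.

Lemma closure_mulmx A (g : 'M[C]_2) z : (forall v, A v -> A (g *m v)) -> closure A z -> closure A (g *m z).
Proof.
move=> gA cA; apply: closureV => d d0; have [d' [d'0 H]] := mulmx_vn_cont g d0.
have [a Aa ad] := closure_vn cA d'0; exists (g *m a); first exact: gA.
exact: H.
Qed.
End Conjugation.

(** * Holomorphic extension and equivariance of partial sums *)

Section Extension.
Variable R : realType.
Local Notation C := (complex R).
Local Notation V := 'cV[C]_2.
Implicit Types (v w z e : V) (f : V -> V -> C) (F : V * V -> C) (h g : 'M[C]_2).
Variable E : set V.

(* [f (z, w)], holomorphic in [z] and antiholomorphic in [w], extends across [(z0, w0)]. *)
Definition extends_at f z0 w0 : Prop := exists (d : R) F, [/\ 0 < d,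
  (forall v u, vn (v - z0) <= d -> vn (u - cj w0) <= d -> differentiable F (v, u)) &
  (forall z w, E z -> E w -> vn (z - z0) <= d -> vn (w - w0) <= d -> F (z, cj w) = f z w)].

Lemma extends_at0 z0 w0 : extends_at (fun _ _ => 0) z0 w0.
Proof. by exists 1, (fun=> 0); split => // v u _ _; exact: differentiable_cst. Qed.

Lemma extends_atD f1 f2 z0 w0 : extends_at f1 z0 w0 -> extends_at f2 z0 w0 ->
  extends_at (fun z w => f1 z w + f2 z w) z0 w0.
Proof.
move=> [d1 [F1 [d10 D1 E1]]] [d2 [F2 [d20 D2 E2]]].
exists (Num.min d1 d2), (fun x => F1 x + F2 x); split; first by rewrite lt_min d10.
  move=> v u; rewrite !le_min => /andP[v1 v2] /andP[u1 u2].
  by apply: differentiableD; [exact: D1|exact: D2].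
move=> z w Ez Ew; rewrite !le_min => /andP[v1 v2] /andP[u1 u2].
by rewrite E1 ?E2.
Qed.

Lemma extends_atM f a z0 w0 : extends_at f z0 w0 -> extends_at (fun z w => f z w * a) z0 w0.
Proof.
move=> [d [F [d0 D EF]]]; exists d, (fun x => F x * a); split => //.
  move=> v u hv hu; apply: differentiableM; first exact: D.
  exact: differentiable_cst.
by move=> z w Ez Ew hz hw; rewrite EF.
Qed.

Lemma extends_at_sum (T : eqType) (s : seq T) (f : T -> V -> V -> C) z0 w0 :
  (forall t, t \in s -> extends_at (f t) z0 w0) ->
  extends_at (fun z w => \sum_(t <- s) f t z w) z0 w0.
Proof.
elim: s => [|t s IH] h.
  have -> : (fun z w => \sum_(t <- [::]) f t z w) = (fun _ _ => 0 : C).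
    by apply/funext => z; apply/funext => w; rewrite big_nil.
  exact: extends_at0.
have -> : (fun z w => \sum_(t <- t :: s) f t z w) = (fun z w => f t z w + \sum_(t <- s) f t z w).
  by apply/funext => z; apply/funext => w; rewrite big_cons.
apply: extends_atD; first by apply: h; exact: mem_head.
by apply: IH => t' t's; apply: h; rewrite inE t's orbT.
Qed.

(** In the variable conj w the map [h] acts through its conjugate matrix [h'], which keeps the
    extension holomorphic. *)
Lemma extends_at_act f h z0 w0 : (forall v, E v -> E (h *m v)) ->
  extends_at f z0 (h *m w0) -> extends_at (fun z w => f z (h *m w)) z0 w0.
Proof.
move=> hE [d [F [d0 D EF]]]; pose h' : 'M[C]_2 := map_mx Num.conj h.
have [d1 [d10 hk]] := mulmx_vn_cont h' d0.
have dk : Num.min d d1 <= d by rewrite ge_min lexx.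
have dk1 : Num.min d d1 <= d1 by rewrite ge_min lexx orbT.
exists (Num.min d d1), (fun x => F (x.1, h' *m x.2)); split; first by rewrite lt_min d0.
  move=> v u hv hu; apply: (@differentiable_comp _ _ _ _ (fun x : V * V => (x.1, h' *m x.2)) F).
    apply: differentiable_pair; first exact: differentiable_fst.
    apply: (@differentiable_comp _ _ _ _ (fun x : V * V => x.2) (fun w : V => h' *m w)).
      exact: differentiable_snd.
    exact: differentiable_mulmx.
  apply: D => /=; first exact: le_trans hv dk.
  by rewrite cj_mulmx; apply: hk; exact: le_trans hu dk1.
move=> z w Ez Ew hz hw; rewrite /= -cj_mulmx EF//; [exact: hE|exact: le_trans hz dk|].
by rewrite -vn_cjB !cj_mulmx; apply: hk; rewrite vn_cjB; exact: le_trans hw dk1.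
Qed.

Definition Phi (K : V -> V -> C) (T : seq 'M[C]_2) z w : C := \sum_(h <- T) K z (h *m w) * (\det h)^*.

Lemma extends_at_Phi K (T : seq 'M[C]_2) z0 w0 : (forall h v, h \in T -> E v -> E (h *m v)) ->
  (forall h, h \in T -> extends_at K z0 (h *m w0)) -> extends_at (Phi K T) z0 w0.
Proof.
move=> hE hK; apply: extends_at_sum => h hT; apply: extends_atM.
by apply: extends_at_act; [move=> v; exact: hE|exact: hK].
Qed.

Lemma Phi_perm K (T T' : seq 'M[C]_2) z w : perm_eq T T' -> Phi K T z w = Phi K T' z w.
Proof. by move=> h; rewrite /Phi (perm_big _ h). Qed.

Lemma perm_map_stable (T : seq 'M[C]_2) (m : 'M[C]_2 -> 'M[C]_2) : uniq T -> injective m ->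
  (forall h, h \in T -> m h \in T) -> perm_eq (map m T) T.
Proof.
move=> uT mi mT; have um : uniq (map m T) by rewrite map_inj_uniq.
have sub : {subset map m T <= T} by move=> x /mapP[h hT ->]; exact: mT.
have [_ eqi] := uniq_min_size um sub (eq_leq (esym (size_map m T))).
exact: uniq_perm.
Qed.

(** Right multiplication by [g] permutes [T]; the factor appears because [\det g] and its conjugate
    are inverse to each other. *)
Lemma Phi_actr K (T : seq 'M[C]_2) g z w : uniq T -> unitary g ->
  (forall h, h \in T -> h *m g \in T) -> Phi K T z (g *m w) = \det g * Phi K T z w.
Proof.
move=> uT gu gT; have [gm _ _] := unitary_inv gu.
have gi : injective (fun h : 'M[C]_2 => h *m g).
  by move=> h h' /(congr1 (fun m => m *m invmx g)); rewrite /= !mulmxK.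
rewrite -(Phi_perm K z w (perm_map_stable uT gi gT)) /Phi big_map big_distrr /=.
apply: eq_bigr => h _; rewrite -mulmxA mulrCA; congr (_ * _).
by rewrite det_mulmx rmorphM /= mulrCA (unitary_detJ gu) mulr1.
Qed.

(** Left multiplication by [g] permutes [T], and invariance of [K] removes [g] from both arguments;
    what is left is the conjugate determinant. *)
Lemma Phi_actl K (T : seq 'M[C]_2) g z w : uniq T -> unitary g ->
  (forall h, h \in T -> g *m h \in T) ->
  (forall z w, E z -> E w -> K (g *m z) (g *m w) = K z w) ->
  E z -> (forall h, h \in T -> E (h *m w)) ->
  Phi K T (g *m z) w = (\det g)^* * Phi K T z w.
Proof.
move=> uT gu gT Kg Ez hE; have [gm _ _] := unitary_inv gu.
have gi : injective (mulmx g : 'M[C]_2 -> 'M[C]_2).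
  by move=> h h' /(congr1 (mulmx (invmx g))); rewrite !mulKmx.
rewrite -(Phi_perm K (g *m z) w (perm_map_stable uT gi gT)) /Phi big_map big_distrr /=.
rewrite [LHS]big_seq [RHS]big_seq; apply: eq_bigr => h hT.
by rewrite -mulmxA (Kg _ _ Ez (hE _ hT)) det_mulmx rmorphM /= mulrCA.
Qed.
End Extension.

Section WeightedBound.
Variable R : realType.
Local Notation C := (complex R).
Local Notation V := 'cV[C]_2.
Implicit Types (v w z : V) (f : V -> V -> C) (F : V * V -> C) (h g : 'M[C]_2) (Y : set V).
Variables (G : {fset 'M[C]_2}) (E : set V).
Hypotheses (gG : umx_group G) (oE : open E) (E0 : E 0).
Hypothesis EG : forall g v, g \in G -> E v -> E (g *m v).

(** The point 0 lies on every mirror and needs [mirror_bound_at0]; any other point lies on at most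
    one. *)
Lemma mirror_bound F (x0 z0 : V) (d : R) (A B : set V) (e : set V -> V) Om : 0 < d ->
  open A -> open B -> closure A x0 -> closure B z0 -> B 0 ->
  (forall v w, vn (v - x0) <= d -> vn (w - z0) <= d -> differentiable F (v, w)) ->
  (forall Y, Y \in mirrors G -> good_mirror (e Y) (Om Y)) ->
  (forall z Y Y', z != 0 -> Y \in mirrors G -> Y' \in mirrors G ->
     hprod z (e Y) = 0 -> hprod z (e Y') = 0 -> Y = Y') ->
  (forall Y, Y \in mirrors G -> hprod z0 (e Y) = 0 -> skew_near F x0 z0 d A B (e Y) (Om Y)) ->
  exists d' c : R, [/\ 0 < d', 0 <= c & forall x z, A x -> vn (x - x0) <= d' -> vn (z - z0) <= d' ->
    cabs (F (x, z)) <= c * mirror_prod e Om (mirrors G) z].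
Proof.
move=> d0 oA oB cA cB B0 dF gm one skew; have uL := mirrors_uniq G.
have [z00|z00] := eqVneq z0 0; last first.
  have [d' [c [d'0 c0 H]]] := mirror_bound_off0 d0 oA oB cA cB dF uL gm
    (fun Y Y' hY hY' => one z0 Y Y' z00 hY hY') skew.
  by exists d', c; split => // x z _; exact: H.
subst z0; have [d1 [d10 H1]] := open_vn oB B0.
pose d2 := Num.min d d1; have d20 : 0 < d2 by rewrite lt_min d0.
have d2d : d2 <= d by rewrite ge_min lexx.
have [|||d' [c [d'0 c0 H]]] := @mirror_bound_at0 _ _ F x0 d2 A B e Om (mirrors G) d20 oA oB _ _ uL gm one.
- by move=> z hz; apply: H1; rewrite subr0 (le_trans hz)// ge_min lexx orbT.
- move=> v w hv hw; apply: dF; first exact: le_trans hv d2d.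
  by rewrite subr0; exact: le_trans hw d2d.
- move=> Y hY t x z tO Ax Bz hx hz hr; apply: (skew Y hY _ t x z tO Ax Bz).
  + by rewrite hprodE !mxE !mul0r addr0.
  + exact: le_trans hx d2d.
  + exact: le_trans hz d2d.
  + exact: le_trans hr d2d.
by exists d', c; split => // x z Ax hx; rewrite subr0; exact: H.
Qed.

Lemma mirrors_unique z Y Y' : z != 0 -> Y \in mirrors G -> Y' \in mirrors G ->
  hprod z (root_of Y) = 0 -> hprod z (root_of Y') = 0 -> Y = Y'.
Proof.
move=> z0 /in_mirrors/RH_hyperplane hY /in_mirrors/RH_hyperplane hY' h h'.
have [_ /(_ z)[_ /(_ h) Yz]] := rootP hY; have [_ /(_ z)[_ /(_ h') Y'z]] := rootP hY'.
exact: hyperplane_unique hY hY' z0 Yz Y'z.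
Qed.

Lemma dets_refl Y t : Y \in mirrors G -> t \in dets G Y ->
  exists g, [/\ g \in G, t = \det g, (forall v, Y v -> g *m v = v) &
    forall v, refl_map (root_of Y) t v = g *m v].
Proof.
move=> /in_mirrors/RH_hyperplane hY /mapP[g gs ->]; have /in_stab[gg gY] := gs.
by exists g; split => // v; rewrite [in RHS](stab_refl gG hY gs) refl_mxE.
Qed.

Lemma boundz f z0 w0 : extends_at E f z0 w0 -> closure E z0 -> closure E w0 ->
  (forall g, g \in G -> g *m z0 = z0 -> forall z w, E z -> E w -> f (g *m z) w = (\det g)^* * f z w) ->
  exists d c : R, [/\ 0 < d, 0 <= c & forall z w, E z -> E w -> vn (z - z0) <= d -> vn (w - w0) <= d ->
    cabs (f z w) <= c * absJ G z].
Proof.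
(* The variables are exchanged because [mirror_bound] divides in the second one. *)
move=> [d [F [d0 D EF]]] cz cw sk; pose F' (x : V * V) := F (x.2, x.1).
have [|||d' [c [d'0 c0 H]]] := @mirror_bound F' (cj w0) z0 d (@cj R @^-1` E) E
  (@root_of R) (dets G) d0 (open_cj oE) oE (closure_cj cw) cz E0 _ _ mirrors_unique.
- move=> v u hv hu; apply: (@differentiable_comp _ _ _ _ (fun x : V * V => (x.2, x.1)) F); last exact: D.
  by apply: differentiable_pair; [exact: differentiable_snd|exact: differentiable_fst].
- by move=> Y /in_mirrors/RH_hyperplane; exact: good_mirror_dets.
- move=> Y hY Y0 t x z tO Ax Bz hx hz hr.
  have [g [gg tE gY gE]] := dets_refl hY tO; rewrite gE in hr *.
  have gz0 : g *m z0 = z0.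
    by apply: gY; have [_ /(_ z0)[_]] := rootP (RH_hyperplane (proj1 (in_mirrors _ _) hY)); apply.
  have hx' : vn (cj x - w0) <= d by rewrite -vn_cjB cjK.
  have Fx v : E v -> vn (v - z0) <= d -> F (v, x) = f v (cj x).
    by move=> Ev hv; rewrite -(EF v (cj x))// cjK.
  rewrite /F' /= !Fx//; last exact: EG.
  rewrite (sk g gg gz0 _ _ Bz Ax) tE mulrA unitary_detJ ?mul1r//; case: gG => Gu _ _ _; exact: Gu.
pose d2 := Num.min d d'; have d2d : d2 <= d by rewrite ge_min lexx.
have d2d' : d2 <= d' by rewrite ge_min lexx orbT.
exists d2, c; split => //; first by rewrite lt_min d0.
move=> z w Ez Ew hz hw; rewrite absJE -EF//; [|exact: le_trans hz d2d|exact: le_trans hw d2d].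
apply: (H (cj w) z); rewrite /= ?cjK ?vn_cjB//; [exact: le_trans hw d2d'|exact: le_trans hz d2d'].
Qed.

(* In the variable conj w the reflection with multiplier t becomes the one with multiplier conj t. *)
Lemma boundw f z0 w0 : extends_at E f z0 w0 -> closure E z0 -> closure E w0 ->
  (forall g, g \in G -> g *m w0 = w0 -> forall z w, E z -> E w -> f z (g *m w) = \det g * f z w) ->
  exists d c : R, [/\ 0 < d, 0 <= c & forall z w, E z -> E w -> vn (z - z0) <= d -> vn (w - w0) <= d ->
    cabs (f z w) <= c * absJ G w].
Proof.
move=> [d [F [d0 D EF]]] cz cw sk.
pose e Y := cj (root_of Y); pose Om Y := [seq t^* | t <- dets G Y].
have cE0 : (@cj R @^-1` E) 0 by rewrite /= cj0.
have hpE z Y : hprod z (e Y) = (hprod (cj z) (root_of Y))^* by rewrite -hprod_cj cjK.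
have [|||d' [c [d'0 c0 H]]] := @mirror_bound F z0 (cj w0) d E (@cj R @^-1` E)
  e Om d0 oE (open_cj oE) cz (closure_cj cw) cE0 D.
- move=> Y /in_mirrors/RH_hyperplane hY; have [ee uO O1 OM Os] := good_mirror_dets gG hY; split.
  + by rewrite hprod_cj ee conjC1.
  + by rewrite map_inj_uniq//; exact: (can_inj (@conjCK _)).
  + by move=> t /mapP[s /O1 s1 ->]; rewrite cabsJ.
  + by move=> t t' /mapP[s sO ->] /mapP[s' s'O ->]; rewrite -rmorphM; apply: map_f; exact: OM.
  + by rewrite size_map.
- move=> z Y Y' z0' hY hY'; rewrite !hpE => /eqP; rewrite conjC_eq0 => /eqP h /eqP; rewrite conjC_eq0 => /eqP h'.
  apply: (@mirrors_unique (cj z)) => //.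
  by apply: contra_neq z0' => h0; rewrite -(cjK z) h0 cj0.
- move=> Y hY; rewrite hpE cjK => /eqP; rewrite conjC_eq0 => /eqP Y0 t x z /mapP[s sO ->] Ax Bz hx hz hr.
  have [g [gg tE gY gE]] := dets_refl hY sO.
  have rE : refl_map (e Y) s^* z = cj (g *m cj z).
    rewrite -gE; apply: cV2P; rewrite !mxE hpE rmorphD /= conjCK !rmorphM rmorphB /= conjC1; by [].
  rewrite rE in hr *.
  have gw0 : g *m w0 = w0.
    by apply: gY; have [_ /(_ w0)[_]] := rootP (RH_hyperplane (proj1 (in_mirrors _ _) hY)); apply.
  have hz' : vn (cj z - w0) <= d by rewrite -vn_cjB cjK.
  rewrite vn_cjB in hr; rewrite (EF x (g *m cj z) Ax (EG gg Bz) hx hr).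
  rewrite -[in RHS](cjK z) (EF x (cj z) Ax Bz hx hz') (sk g gg gw0 _ _ Ax Bz) tE mulrA [X in X * _]mulrC.
  rewrite unitary_detJ ?mul1r//; case: gG => Gu _ _ _; exact: Gu.
pose d2 := Num.min d d'; have d2d : d2 <= d by rewrite ge_min lexx.
have d2d' : d2 <= d' by rewrite ge_min lexx orbT.
exists d2, c; split => //; first by rewrite lt_min d0.
move=> z w Ez Ew hz hw; rewrite absJE -EF//; [|exact: le_trans hz d2d|exact: le_trans hw d2d].
have -> : mirror_prod (@root_of R) (dets G) (mirrors G) w = mirror_prod e Om (mirrors G) (cj w).
  by apply: eq_bigr => Y _; rewrite hpE cjK cabsJ /Om /dets !size_map.
by apply: (H z (cj w)); rewrite ?vn_cjB//; [exact: le_trans hz d2d'|exact: le_trans hw d2d'].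
Qed.

(** The factor that may blow up is the power of [absJ G w] for [a >= 0] and that of [absJ G z] for
    [a < 0]; the bound in the same variable compensates it. *)
Lemma weighted_bound f z0 w0 (a : R) : -1 < a < 1 ->
  extends_at E f z0 w0 -> closure E z0 -> closure E w0 ->
  (forall g, g \in G -> g *m z0 = z0 -> forall z w, E z -> E w -> f (g *m z) w = (\det g)^* * f z w) ->
  (forall g, g \in G -> g *m w0 = w0 -> forall z w, E z -> E w -> f z (g *m w) = \det g * f z w) ->
  exists d c : R, [/\ 0 < d, 0 <= c & forall z w, E z -> E w -> vn (z - z0) <= d -> vn (w - w0) <= d ->
    absJ G z `^ a * cabs (f z w) * absJ G w `^ (- a) <= c].
Proof.
move=> /andP[a1 a2] ef cz cw skz skw.
have [B1 [B11 ub1]] := absJ_ub G (vn z0 + 1); have [B2 [B21 ub2]] := absJ_ub G (vn w0 + 1).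
pose M := Num.max B1 B2; have M1 : 1 <= M by rewrite le_max B11.
have M0 : 0 <= M by exact: le_trans M1.
have near z z1 : vn (z - z1) <= 1 -> vn z <= vn z1 + 1.
  by move=> h; rewrite -[z](subrK z1) addrC (le_trans (vnD _ _))// lerD2l.
have Jz z : vn (z - z0) <= 1 -> 0 <= absJ G z <= M.
  by move=> /near/ub1 h; rewrite absJ_ge0/= le_max h.
have Jw w : vn (w - w0) <= 1 -> 0 <= absJ G w <= M.
  by move=> /near/ub2 h; rewrite absJ_ge0/= le_max h orbT.
have [a0|a0] := leP 0 a.
  have [d [c [d0 c0 H]]] := boundw ef cz cw skw.
  exists (Num.min 1 d), (M * (c * M)); split; first by rewrite lt_min ltr01.
    by rewrite mulr_ge0// mulr_ge0.
  move=> z w Ez Ew; rewrite !le_min => /andP[z1 zd] /andP[w1 wd].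
  apply: weighted_le => //; [exact: Jz|exact: Jw|by rewrite a0|by rewrite cabs_ge0/= H].
have [d [c [d0 c0 H]]] := boundz ef cz cw skz.
exists (Num.min 1 d), (M * (c * M)); split; first by rewrite lt_min ltr01.
  by rewrite mulr_ge0// mulr_ge0.
move=> z w Ez Ew; rewrite !le_min => /andP[z1 zd] /andP[w1 wd].
have := @weighted_le _ (absJ G w) (absJ G z) (cabs (f z w)) (- a) M c (Jw w w1) (Jz z z1) M1.
rewrite opprK oppr_ge0 (ltW a0) ltrNl a1 cabs_ge0 /= => h.
by rewrite mulrC mulrA mulrAC; apply: h => //; exact: H.
Qed.
End WeightedBound.

(** * Continuation of the kernel, and compactness of the closure *)

Section Continuation.
Variable R : realType.
Local Notation C := (complex R).
Local Notation V := 'cV[C]_2.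
Implicit Types (v w z : V) (E : set V) (K : V -> V -> C).

Lemma bounded_vn E : bounded_set E -> exists M : R, forall v, E v -> vn v <= M.
Proof.
move=> /pinfty_ex_gt0[M M0 H]; have [m m0 ME] := cltE M0.
exists ((m + 1) + (m + 1)) => v /H; rewrite ME => hv.
have vb : ball (0 : V) ((m + 1)%:C)%C v.
  by rewrite mx_norm_ball /ball_ /= sub0r normrN (le_lt_trans hv)// ltcR ltrDl.
have hi i : cabs (v i 0) <= m + 1.
  by have := vb.2 i 0; rewrite -ball_normE /= mxE sub0r normrN -cabsE ltcR => /ltW.
by apply: lerD.
Qed.

(** A real ray from 0 leaves the bounded set [E]; the supremum of the parameters that stay in [E]
    gives the point. It supplies an off-diagonal boundary point at which the continuation hypothesis
    can be invoked. *)
Lemma boundary_exists E (M : R) : open E -> E 0 -> (forall v, E v -> vn v <= M) ->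
  exists w, closure E w /\ ~ E w.
Proof.
move=> oE E0 EM; pose u : V := \col_i (if i == 0 then 1 else 0).
have u1 (t : R) : vn ((t%:C)%C *: u) = `|t| by rewrite vnZ /vn !mxE /= cabs0 cabs1 addr0 mulr1 cabsR.
pose S : set R := [set t | E ((t%:C)%C *: u)].
have S0 : S 0 by rewrite /S /= scale0r.
have SM : ubound S M by move=> t /EM; rewrite u1; apply: le_trans; exact: ler_norm.
have hS : has_sup S by split; [exists 0|exists M].
have uB (a b : R) : vn ((a%:C)%C *: u - (b%:C)%C *: u) = `|a - b| by rewrite -scalerBl -rmorphB u1.
exists ((sup S)%:C%C *: u); split.
  apply: closureV => d d0; have [t St ht] := sup_adherent d0 hS; exists ((t%:C)%C *: u) => //.
  have tS : t <= sup S by exact: (ub_le_sup (proj2 hS)).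
  rewrite uB distrC ger0_norm; lra.
move=> /(open_vn oE)[d [d0 H]].
have : S (sup S + d) by apply: H; rewrite uB addrAC subrr add0r gtr0_norm.
by move=> /(ub_le_sup (proj2 hS)); lra.
Qed.

Lemma open_tildeE E : open E -> open (tildeE E).
Proof.
move=> oE; rewrite openE => _ [z [w [Ez [Ew ->]]]]; apply/nbhsVV => /=.
have [d1 [d10 H1]] := open_vn oE Ez; have [d2 [d20 H2]] := open_vn oE Ew.
exists (Num.min d1 d2); split; first by rewrite lt_min d10.
move=> v u; rewrite !le_min => /andP[hv _] /andP[_ hu].
exists v, (cj u); split; [exact: H1|split; last by rewrite -/(cj _) cjK].
by apply: H2; rewrite -vn_cjB cjK.
Qed.

(** If z0 or w0 is outside [E], the pair (z0, conj w0) is a boundary point off the diagonal and the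
    hypothesis applies to it. Inside, joint holomorphy is obtained from the continuation past some
    other boundary point, because that extension coincides with [K] on all of [tildeE E]. *)
Lemma continuation_extends E K z0 w0 : open E -> E 0 -> (exists w, closure E w /\ ~ E w) ->
  continuation_hyp E K -> closure E z0 -> closure E w0 -> (z0 = w0 -> E z0) ->
  extends_at E K z0 w0.
Proof.
move=> oE E0 [w1 [cw1 nw1]] hyp cz cw h.
have bd z w : closure E z -> closure E w -> ~ (E z /\ E w) -> bdry (tildeE E) (z, cj w).
  move=> cz' cw' nE; split.
    move=> B /nbhsVV[d [d0 H]] /=; have [a Ea ha] := closure_vn cz' d0; have [b Eb hb] := closure_vn cw' d0.
    exists (a, cj b); split; first by exists a, b.
    by apply: H => //=; rewrite vn_cjB.
  move=> /interior_subset[a [b [Ea [Eb [za wb]]]]]; apply: nE; rewrite za; split => //.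
  by rewrite -(cjK w) wb -/(cj _) cjK.
have near D (F : V * V -> C) q (d : R) : 0 < d -> holo_on D F ->
    (forall v u, vn (v - q.1) <= d -> vn (u - q.2) <= d -> D (v, u)) ->
    forall v u, vn (v - q.1) <= d -> vn (u - q.2) <= d -> differentiable F (v, u).
  by move=> d0 hF hD v u hv hu; apply: hF; exact: hD.
have [[Ez Ew]|nE] := pselect (E z0 /\ E w0).
  (* [0] lies in [E] and [w1] does not, so this boundary point is off the diagonal. *)
  have b1 : bdry (tildeE E) (0, cj w1).
    apply: bd; [exact: (@subset_closure _ E)|exact: cw1|by case=> _ /nw1].
  have [/=|r [r0 [F [hF FK]]]] := hyp _ b1.
    by rewrite -/(cj _) cjK; apply/eqP => w10; apply: nw1; rewrite -w10.
  have : \forall x \near (z0, cj w0), tildeE E x.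
    by apply: open_nbhs_nbhs; split; [exact: open_tildeE|exists z0, w0].
  move=> /nbhsVV[d [d0 H]]; exists d, F; split => //.
    by apply: (near _ _ (z0, cj w0) d d0 hF) => v u hv hu; left; exact: H.
  by move=> z w Ez' Ew' _ _; rewrite FK; [rewrite /= -/(cj (cj w)) cjK|exists z, w].
have [/=|r [r0 [F [hF FK]]]] := hyp _ (bd _ _ cz cw nE).
  rewrite -/(cj _) cjK; apply/eqP => zw; apply: nE; split; first exact: h.
  by rewrite -zw; exact: h.
have : \forall x \near (z0, cj w0), ball (z0, cj w0) (r%:C)%C x by apply: nbhsx_ballx; rewrite ltcR.
move=> /nbhsVV[d [d0 H]]; exists d, F; split => //.
  by apply: (near _ _ (z0, cj w0) d d0 hF) => v u hv hu; right; exact: H.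
by move=> z w Ez' Ew' _ _; rewrite FK; [rewrite /= -/(cj (cj w)) cjK|exists z, w].
Qed.

(** The closure is a closed subset of the image of a compact real box under the continuous map
    [toC2]. *)
Lemma closure_compact E (M : R) : (forall v, E v -> vn v <= M) -> compact (closure E).
Proof.
move=> EM; pose I : set R := [set` `[(- (M + 1)), (M + 1)]].
have cI : compact (I `*` I `*` I `*` I) by do 3 (apply: compact_setX; last exact: segment_compact); exact: segment_compact.
have ct : continuous (@toC2 R : R * R * R * R -> V).
  move=> x A /nbhsV[d [d0 H]].
  have d4 : 0 < d / 4 by rewrite divr_gt0.
  have nb (a : R) : \forall b \near a, `|b - a| <= d / 4.
    by apply/nbhs_ballP; exists (d / 4) => //= b; rewrite -ball_normE /= distrC => /ltW.
  exists (([set y | `|y.1.1 - x.1.1.1| <= d / 4 /\ `|y.1.2 - x.1.1.2| <= d / 4 /\ `|y.2 - x.1.2| <= d / 4]),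
    ([set y | `|y - x.2| <= d / 4])).
    split => /=; last exact: nb.
    exists ([set y | `|y.1 - x.1.1.1| <= d / 4 /\ `|y.2 - x.1.1.2| <= d / 4], [set y | `|y - x.1.2| <= d / 4]).
      split => /=; last exact: nb.
      exists ([set y | `|y - x.1.1.1| <= d / 4], [set y | `|y - x.1.1.2| <= d / 4]); first by split => /=; exact: nb.
      by move=> [a b] [].
    by move=> [[a b] c] [[h1 h2] h3].
  move=> y [[h1 [h2 h3]] h4]; apply: H; apply: le_trans (toC2_dist _ _) _ => /=; simpl in h1, h2, h3, h4.
  by lra.
have := @continuous_compact _ _ _ _ (continuous_subspaceT ct) cI.
move=> /(subclosed_compact (@closed_closure _ E)); apply => z cz.
have [a Ea ha] := closure_vn cz (ltr01 : 0 < (1 : R)).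
have zM : vn z <= M + 1.
  by rewrite -[z](subrK a) addrC (le_trans (vnD _ _))// vnB lerD// EM.
have hi i : cabs (z i 0) <= M + 1 by exact: le_trans (cabs_le_vn z i) zM.
have hR i : I (complex.Re (z i 0)).
  by rewrite /I /= in_itv /= -ler_norml (le_trans (normRe_le_cabs _)).
have hI i : I (complex.Im (z i 0)).
  by rewrite /I /= in_itv /= -ler_norml (le_trans (normIm_le_cabs _)).
exists (ofC2 z); last exact: ofC2K.
by split; [split; [split|]|] => /=.
Qed.
End Continuation.

(** * Local comparison of the weighted kernels *)

Section Comparison.
Variable R : realType.
Local Notation C := (complex R).
Local Notation V := 'cV[C]_2.
Implicit Types (v w z : V) (g h : 'M[C]_2) (Y : set V) (H : {fset 'M[C]_2}).
Variables (G : {fset 'M[C]_2}) (E : set V) (K : V -> V -> C) (M p : R).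
Hypotheses (gG : umx_group G) (oE : open E) (E0 : E 0) (bE : forall v, E v -> vn v <= M).
Hypothesis EG : forall g v, g \in G -> E v -> E (g *m v).
Hypothesis bK : bergman_kernel E K.
Hypothesis hK : continuation_hyp E K.
Hypothesis p1 : 1 < p.

Let a := 2 / p - 1.

Let a_bound : -1 < a < 1.
Proof.
have p0 : 0 < p by exact: lt_trans p1.
have h0 : 0 < 2 / p by rewrite divr_gt0.
have h2 : 2 / p < 2 by rewrite ltr_pdivrMr// ltr_pMr.
by apply/andP; rewrite /a; split; lra.
Qed.

Lemma KH_Phi H z w : KH K H z w = (#|` H|%:R)^-1 * Phi K (enum_fset H) z w.
Proof. by []. Qed.

Lemma cabs_KHp H z w : cabs (KHp K H p z w) =
  (#|` H|%:R)^-1 * (absJ H z `^ a * cabs (Phi K (enum_fset H) z w) * absJ H w `^ (- a)).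
Proof.
have cn : cabs ((#|` H|%:R)^-1 : C) = (#|` H|%:R)^-1 by rewrite cabsV cabs_nat.
rewrite /KHp KH_Phi /a opprB; move: (Phi K _ z w) (absJ H z) (absJ H w) => f x y.
by rewrite !cabsM cn !cabsR !ger0_norm ?powR_ge0// mulrCA !mulrA.
Qed.

Let Gu g : g \in G -> unitary g. Proof. by case: gG => h _ _ _; exact: h. Qed.
Let GM g h : g \in G -> h \in G -> g *m h \in G. Proof. by case: gG => _ _ H _; exact: H. Qed.
Let GV g : g \in G -> invmx g \in G. Proof. by case: gG => _ _ _ H; exact: H. Qed.

Let EGK g v : g \in G -> E v <-> E (g *m v).
Proof.
move=> gg; split; first exact: EG.
by move=> /(EG (GV gg)); rewrite mulKmx//; case: (unitary_inv (Gu gg)).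
Qed.

Let KG g z w : g \in G -> E z -> E w -> K (g *m z) (g *m w) = K z w.
Proof.
move=> gg; apply: (kernel_invariant oE bE bK (Gu gg)) => v.
by apply: iff_sym; exact: EGK.
Qed.

Let K_extends z0 w0 : closure E z0 -> closure E w0 -> (z0 = w0 -> E z0) -> extends_at E K z0 w0.
Proof. exact: (continuation_extends oE E0 (boundary_exists oE E0 bE) hK). Qed.

Let card_G : 0 < (#|` G|%:R : R).
Proof. by rewrite ltr0n cardfs_gt0; apply/fset0Pn; exists 1%:M; case: gG. Qed.

(** The last hypothesis keeps each pair (z0, h w0), for [h] in [T], off the boundary diagonal, so
    every term of the sum extends. *)
Lemma bound_partial (T : seq 'M[C]_2) z0 w0 : closure E z0 -> closure E w0 ->
  uniq T -> {subset T <= G} ->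
  (forall g h, g \in G -> g *m z0 = z0 -> h \in T -> g *m h \in T) ->
  (forall g h, g \in G -> g *m w0 = w0 -> h \in T -> h *m g \in T) ->
  (forall h, h \in T -> z0 = h *m w0 -> E z0) ->
  exists d c : R, [/\ 0 < d, 0 <= c & forall z w, E z -> E w -> vn (z - z0) <= d -> vn (w - w0) <= d ->
    absJ G z `^ a * cabs (Phi K T z w) * absJ G w `^ (- a) <= c].
Proof.
move=> cz cw uT TG Tl Tr Tb; apply: weighted_bound => //.
- apply: extends_at_Phi => h; first by move=> v /TG hG; exact: EG.
  move=> hT; apply: (K_extends cz _ (Tb h hT)).
  by apply: (closure_mulmx _ cw) => v; apply: EG; exact: TG.
- move=> g gg gz z w Ez Ew; apply: (Phi_actl (E := E)) => //.
  + exact: Gu.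
  + by move=> h; exact: Tl.
  + by move=> z' w'; exact: KG.
  + by move=> h /TG hG; exact: EG.
- move=> g gg gw z w Ez Ew; apply: Phi_actr => //; first exact: Gu.
  by move=> h; exact: Tr.
Qed.

(** The sum changes by a unimodular determinant and the Jacobian not at all. This allows a point
    [z0] in the orbit of [w0] to be moved onto [w0]. *)
Lemma KHp_actl g z w : g \in G -> E z -> E w -> cabs (KHp K G p (g *m z) w) = cabs (KHp K G p z w).
Proof.
move=> gg Ez Ew; have Pg : Phi K (enum_fset G) (g *m z) w = (\det g)^* * Phi K (enum_fset G) z w.
  apply: (Phi_actl (E := E) (fset_uniq _) (Gu gg) _ _ Ez).
  - by move=> h; exact: GM.
  - by move=> z' w'; exact: KG.
  - by move=> h hG; exact: EG.
have {}Pg : cabs (Phi K (enum_fset G) (g *m z) w) = cabs (Phi K (enum_fset G) z w).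
  by rewrite Pg; move: (Phi _ _ _ _) => f; rewrite cabsM cabsJ (unitary_det (Gu gg)) mul1r.
apply: etrans (cabs_KHp G (g *m z) w) _; apply: etrans _ (esym (cabs_KHp G z w)).
by rewrite (absJ_act z gG gg) Pg.
Qed.

Lemma KHp_bounded z0 w0 : closure E z0 -> closure E w0 ->
  (forall h, h \in G -> z0 = h *m w0 -> E z0) ->
  exists d c : R, [/\ 0 < d, 0 <= c & forall z w, E z -> E w -> vn (z - z0) <= d -> vn (w - w0) <= d ->
    cabs (KHp K G p z w) <= c].
Proof.
move=> cz cw hb; have [|||d [c [d0 c0 B]]] := @bound_partial (enum_fset G) z0 w0 cz cw (fset_uniq _) _ _ _ hb.
- by [].
- by move=> g h gg _; exact: GM.
- by move=> g h gg _ hh; exact: GM.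
exists d, ((#|` G|%:R)^-1 * c); split => //; first by rewrite mulr_ge0// invr_ge0 ltW.
by move=> z w Ez Ew hz hw; rewrite cabs_KHp ler_wpM2l ?invr_ge0 ?(ltW card_G)// B.
Qed.

Lemma KHp_subgroup H w0 : umx_group H -> (forall h, h \in H -> h \in G) ->
  (forall g, g \in G -> g *m w0 = w0 -> g \in H) -> closure E w0 -> ~ E w0 ->
  exists d c : R, [/\ 0 < d, 0 <= c & forall z w, E z -> E w -> vn (z - w0) <= d -> vn (w - w0) <= d ->
    cabs (KHp K G p z w) <= c * (cabs (KHp K H p z w) + 1)].
Proof.
move=> gH HG st cw nw; have [Hu H1 HM HV] := gH.
have w00 : w0 != 0 by apply/eqP => w00; apply: nw; rewrite w00.
(* The stabilizer of [w0] lies in [H], and multiplication by elements of [H] on either side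
   preserves this complement. *)
pose T := [seq h <- enum_fset G | h \notin H].
have HK g h : g \in H -> (g *m h \in H) = (h \in H).
  move=> gg; apply/idP/idP => [|hh]; last exact: HM.
  by move=> /(HM _ _ (HV _ gg)); rewrite mulKmx//; case: (unitary_inv (Hu _ gg)).
have HKr g h : g \in H -> (h *m g \in H) = (h \in H).
  move=> gg; apply/idP/idP => [hh|hh]; last exact: HM.
  by have := HM _ _ hh (HV _ gg); rewrite mulmxK//; case: (unitary_inv (Hu _ gg)).
have [|||||d1 [c1 [d10 c10 B1]]] := @bound_partial T w0 w0 cw cw.
- by apply: filter_uniq; exact: fset_uniq.
- by move=> h; rewrite mem_filter => /andP[].
- move=> g h gg gw; rewrite !mem_filter HK; last exact: st.
  by move=> /andP[-> hG]; exact: GM.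
- move=> g h gg gw; rewrite !mem_filter HKr; last exact: st.
  by move=> /andP[-> hG]; exact: GM.
(* An [h] with [w0 = h *m w0] would lie in [H], so no term of [T] meets the singular diagonal. *)
- by move=> h; rewrite mem_filter => /andP[/negP hH hG] hw; case: hH; apply: st.
have [d2 [c2 [d20 c21 B2]]] := absJ_compare gG gH HG w00 st.
have TE z w : Phi K (enum_fset G) z w = Phi K (enum_fset H) z w + Phi K T z w.
  rewrite /Phi (bigID (fun h => h \in H)) /=; congr (_ + _); last by rewrite big_filter.
  rewrite -big_filter; apply: perm_big; apply: uniq_perm; rewrite ?filter_uniq ?fset_uniq// => h.
  by rewrite mem_filter; apply/andP/idP => [[]//|hh]; split => //; exact: HG.
(* One comparison factor for each of the two Jacobian weights. *)
pose k := c2 `^ `|a| * c2 `^ `|a|.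
have k0 : 0 <= k by rewrite mulr_ge0 ?powR_ge0.
(* The cardinality of [H] undoes the normalization inside [KHp K H]; [c1] bounds the part over
   [T]. *)
pose N := Num.max (k * #|` H|%:R) c1.
have N0 : 0 <= N by rewrite le_max c10 orbT.
exists (Num.min d1 d2), ((#|` G|%:R)^-1 * N); split; first by rewrite lt_min d10.
  by rewrite mulr_ge0// invr_ge0 ltW.
move=> z w Ez Ew; rewrite !le_min => /andP[z1 /B2[zl zu]] /andP[w1 /B2[wl wu]].
have Pz : absJ G z `^ a <= c2 `^ `|a| * absJ H z `^ a.
  by apply: powR_compare => //; exact: absJ_ge0.
have Pw : absJ G w `^ (- a) <= c2 `^ `|a| * absJ H w `^ (- a).
  by rewrite -[X in c2 `^ X]normrN; apply: powR_compare => //; exact: absJ_ge0.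
rewrite (cabs_KHp G z w) -[leRHS]mulrA ler_wpM2l ?invr_ge0 ?(ltW card_G)// TE.
apply: (@le_trans _ _ (absJ G z `^ a * (cabs (Phi K (enum_fset H) z w) + cabs (Phi K T z w)) * absJ G w `^ (- a))).
  by rewrite ler_wpM2r ?powR_ge0// ler_wpM2l ?powR_ge0// cabsD.
rewrite mulrDr mulrDl mulrDr mulr1; apply: lerD; last first.
  by apply: le_trans (B1 z w Ez Ew z1 w1) _; rewrite le_max lexx orbT.
have cH : (0 : R) < #|` H|%:R.
  by rewrite ltr0n cardfs_gt0; apply/fset0Pn; exists 1%:M.
apply: (@le_trans _ _ (k * #|` H|%:R * cabs (KHp K H p z w))); last first.
  by rewrite ler_wpM2r ?cabs_ge0// le_max lexx.
rewrite (cabs_KHp H z w) -[k * _ * _]mulrA; move: (cabs (Phi K (enum_fset H) z w)) (cabs_ge0 (Phi K (enum_fset H) z w)) => f f0.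
rewrite (mulrA #|` H|%:R) mulfV ?gt_eqF// mul1r.
have kE (l x y : R) : l * l * (x * f * y) = l * x * f * (l * y) by ring.
rewrite kE; apply: ler_pM; [|exact: powR_ge0| |exact: Pw].
  by rewrite mulr_ge0 ?powR_ge0.
exact: (ler_wpM2r f0 Pz).
Qed.

Lemma stabilizer_Gsub (S1 S2 : set (set V)) w0 : RH G = S1 `|` S2 -> w0 != 0 ->
  exists S, (S = S1 \/ S = S2) /\ forall g, g \in G -> g *m w0 = w0 -> g \in Gsub G S.
Proof.
move=> GS w00.
have inG S g Y : RH G Y -> Y w0 -> S Y -> g \in G -> g *m w0 = w0 -> g \in Gsub G S.
  move=> hY Yw SY gg gw; have [->|g1] := eqVneq g 1%:M; first by case: (Gsub_umx S gG).
  have gr := fix_reflection gG gg w00 gw g1; apply: reflection_Gsub => //.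
  by rewrite (@hyperplane_unique _ (Defs.fixset g) Y w0) //; [case: gr|exact: RH_hyperplane hY].
have [[Y [hY Yw]]|none] := pselect (exists Y, RH G Y /\ Y w0).
  have := hY; rewrite GS => -[SY|SY].
    by exists S1; split; [left|move=> g; exact: inG hY Yw SY].
  by exists S2; split; [right|move=> g; exact: inG hY Yw SY].
(* No mirror passes through [w0], so its stabilizer is trivial and either of the two sets would
   do. *)
exists S1; split; first by left.
move=> g gg gw; have [->|g1] := eqVneq g 1%:M; first by case: (Gsub_umx S1 gG).
have gr := fix_reflection gG gg w00 gw g1.
by case: none; exists (Defs.fixset g); split => //; exists g.
Qed.

Lemma local_comparison (S1 S2 : set (set V)) z0 w0 : RH G = S1 `|` S2 ->
  closure E z0 -> closure E w0 ->
  exists d c : R, [/\ 0 < d, 0 <= c & forall z w, E z -> E w -> vn (z - z0) <= d -> vn (w - w0) <= d ->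
    cabs (KHp K G p z w) <= c * \sum_(g <- enum_fset G)
      (cabs (KHp K (Gsub G S1) p (g *m z) w) + cabs (KHp K (Gsub G S2) p (g *m z) w) + 1)].
Proof.
move=> GS cz cw.
have sum_lb g z w : g \in G -> cabs (KHp K (Gsub G S1) p (g *m z) w)
    + cabs (KHp K (Gsub G S2) p (g *m z) w) + 1 <= \sum_(g <- enum_fset G)
      (cabs (KHp K (Gsub G S1) p (g *m z) w) + cabs (KHp K (Gsub G S2) p (g *m z) w) + 1).
  move=> gg; rewrite (big_rem g)//= lerDl; apply: sumr_ge0 => h _.
  by rewrite !addr_ge0 ?cabs_ge0.
have [[g0 [g0G zE nEz]]|none] := pselect (exists g, [/\ g \in G, z0 = g *m w0 & ~ E z0]); last first.
  have [|d [c [d0 c0 B]]] := KHp_bounded cz cw.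
    by move=> h hG zE; apply: contrapT => nEz; apply: none; exists h.
  exists d, c; split => // z w Ez Ew hz hw; apply: le_trans (B z w Ez Ew hz hw) _.
  (* A bounded kernel is absorbed by the summand 1 in the term of the identity. *)
  rewrite ler_peMr//; apply: le_trans (sum_lb 1%:M z w _); last by case: gG.
  by rewrite lerDr addr_ge0 ?cabs_ge0.
have nw : ~ E w0 by move=> /(EG g0G); rewrite -zE.
have w00 : w0 != 0 by apply/eqP => w00; apply: nw; rewrite w00.
have [S [SE st]] := stabilizer_Gsub GS w00.
have [|d [c [d0 c0 B]]] := KHp_subgroup (Gsub_umx S gG) _ st cw nw; first by move=> h /in_Gsub[].
(* Applying the inverse of [g0] brings [z] close to [w0], and the term of the sum indexed by this
   inverse then dominates. *)
have gi := GV g0G; have [gm _ _] := unitary_inv (Gu g0G).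
have [d1 [d10 H1]] := mulmx_vn_cont (invmx g0) d0.
exists (Num.min d d1), c; split => //; first by rewrite lt_min d0.
move=> z w Ez Ew; rewrite !le_min => /andP[_ hz] /andP[hw _].
rewrite -(KHp_actl gi Ez Ew); apply: le_trans (B _ _ (EG gi Ez) Ew _ hw) _.
  by rewrite -(mulKmx gm w0) -zE; exact: H1.
apply: ler_wpM2l => //; apply: le_trans (sum_lb _ z w gi); rewrite lerD2r.
by case: SE => ->; [rewrite lerDl|rewrite lerDr]; exact: cabs_ge0.
Qed.

End Comparison.

Theorem theorem1p13 (R : realType) (G : {fset 'M[complex R]_2})
  (E : set 'cV[complex R]_2) (K : 'cV[complex R]_2 -> 'cV[complex R]_2 -> complex R)
  (S1 S2 : set (set 'cV[complex R]_2)) :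
  fin_refl_group G ->
  domain E -> bounded_set E -> G_invariant G E -> good G E -> E 0 ->
  bergman_kernel E K ->
  continuation_hyp E K ->
  splitting_hyp G S1 S2 ->
  forall p : R, 1 < p ->
  exists c : R, 0 < c /\
    forall z w, E z -> E w ->
      cabs (KHp K G p z w) <=
      c * (#|` G|%:R)^-1 *
        \sum_(g <- enum_fset G)
          (cabs (KHp K (Gsub G S1) p (g *m z) w)
           + cabs (KHp K (Gsub G S2) p (g *m z) w) + 1).
Proof.
move=> /fin_refl_group_umx gG [oE _] /bounded_vn[M bE] EG _ E0 bK hK [_ _ GS _ _] p p1.
pose Sg z w := \sum_(g <- enum_fset G) (cabs (KHp K (Gsub G S1) p (g *m z) w)
  + cabs (KHp K (Gsub G S2) p (g *m z) w) + 1).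
have Sg0 z w : 0 <= Sg z w by apply: sumr_ge0 => g _; rewrite !addr_ge0 ?cabs_ge0.
have cG : (0 : R) < #|` G|%:R.
  by rewrite ltr0n cardfs_gt0; apply/fset0Pn; exists 1%:M; case: gG.
have cE := closure_compact bE; have := compact_setX cE cE.
(* Near each point the bound holds for all constants [c] beyond a local threshold. Compactness, with
   the filter at [+oo] on the constants, makes the threshold uniform. *)
move=> /compact_near_coveringP/(_ R +oo
  (fun c q => E q.1 -> E q.2 -> cabs (KHp K G p q.1 q.2) <= c * Sg q.1 q.2)).
case=> [[z0 w0] [/= cz cw]|N [_ H]].
  have [d [c [d0 c0 B]]] := local_comparison gG oE E0 bE EG bK hK p1 GS cz cw.
  exists ([set q | vn (q.1 - z0) <= d /\ vn (q.2 - w0) <= d], [set c' | c <= c']).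
    split => /=; last by apply: nbhs_pinfty_ge; exact: num_real.
    by apply/nbhsVV; exists d; split.
  move=> [[z w] c'] [[/= hz hw] cc'] Ez Ew; apply: le_trans (B z w Ez Ew hz hw) _.
  exact: (ler_wpM2r (Sg0 z w) cc').
pose m := Num.max 1 (N + 1).
have m0 : 0 < m by rewrite lt_max ltr01.
(* The cardinality cancels the mean over [G] in the statement, since [m] was found for the plain
   sum. *)
exists (m * #|` G|%:R); split; first exact: mulr_gt0.
move=> z w Ez Ew; rewrite -/(Sg z w) mulfK ?gt_eqF//.
apply: (H m _ (z, w)) => //; first by rewrite lt_max ltrDl ltr01 orbT.
by split; exact: subset_closure.
Qed.
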